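(* For all $(\beta_1,\beta_2,\beta_3)\in[0,1]^3$, the semigroup $S_2(t)=e^{t\mathbb{B}_2}$ on $\mathbb{H}_2$ is exponentially stable, i.e. there exist constants $M\ge 1$ and $\omega>0$ such that $\|S_2(t)\|_{\mathcal{L}(\mathbb{H}_2)}\le Me^{-\omega t}$ for all $t\ge 0$.
   Context: Let $l>0$ and let $\rho_1,\dots,\rho_5,\kappa_1,\kappa_2,b_1,b_2,\jmath,\gamma_1,\gamma_2,\gamma_3,\delta,K$ be positive constants; let $\beta_1,\beta_2,\beta_3\in[0,1]$. $\langle\cdot,\cdot\rangle$ and $\|\cdot\|$ denote the inner product and norm of the complex space $L^2(0,l)$. $A=-\partial_{xx}$ with domain $\mathfrak{D}(A)=H^2(0,l)\cap H^1_0(0,l)$, a strictly positive self-adjoint operator in $L^2(0,l)$; $A^\sigma$, $\sigma\in\mathbb{R}$, are its fractional powers, $\mathfrak{D}(A^\sigma)$ carries the norm $\|A^\sigma\cdot\|$ (completion of $L^2(0,l)$ if $\sigma<0$, and $A^\sigma$ is extended accordingly to this scale); $\mathfrak{D}(A^0)=L^2(0,l)$, $\mathfrak{D}(A^{1/2})=H^1_0(0,l)$, $\mathfrak{D}(A^{-1/2})=H^{-1}(0,l)$. Phase space: $\mathbb{H}_2=[\mathfrak{D}(A^{1/2})\times\mathfrak{D}(A^0)]^4\times\mathfrak{D}(A^0)$, with elements $U=(\varphi,u,\psi,v,y,s,z,w,\theta)^T$ and the Hilbert norm (induced by the corresponding inner product) $$\|U\|_{\mathbb{H}_2}^2=\rho_1\|u\|^2+\rho_2\|v\|^2+\rho_3\|s\|^2+\rho_4\|w\|^2+b_1\|A^{1/2}\psi\|^2+b_2\|A^{1/2}z\|^2+\kappa_1\|\varphi_x-\psi\|^2+\kappa_2\|y_x-z\|^2+\jmath\|y-\varphi\|^2+\rho_5\|\theta\|^2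 .$$ The operator $\mathbb{B}_2:\mathfrak{D}(\mathbb{B}_2)\subset\mathbb{H}_2\to\mathbb{H}_2$ maps $U$ to the vector with components, in order, $u$; $\ -\frac{\kappa_1}{\rho_1}A\varphi-\frac{\kappa_1}{\rho_1}\psi_x+\frac{\jmath}{\rho_1}(y-\varphi)-\frac{\gamma_1}{\rho_1}A^{\beta_1}u$; $\ v$; $\ -\frac{b_1}{\rho_2}A\psi+\frac{\kappa_1}{\rho_2}(\varphi_x-\psi)+\frac{\delta}{\rho_2}A\theta$; $\ s$; $\ -\frac{\kappa_2}{\rho_3}Ay-\frac{\kappa_2}{\rho_3}z_x-\frac{\jmath}{\rho_3}(y-\varphi)-\frac{\gamma_2}{\rho_3}A^{\beta_2}s$; $\ w$; $\ -\frac{b_2}{\rho_4}Az+\frac{\kappa_2}{\rho_4}(y_x-z)-\frac{\gamma_3}{\rho_4}A^{\beta_3}w$; $\ -\frac{K}{\rho_5}A\theta-\frac{\delta}{\rho_5}Av$. Its domain is $$\mathfrak{D}(\mathbb{B}_2)=\{U\in\mathbb{H}_2:\ (u,v,s,w)\in[\mathfrak{D}(A^{1/2})]^4,\ \theta\in\mathfrak{D}(A),\ \varphi\in\mathfrak{D}(A)\cap\mathfrak{D}(A^{\beta_1}),\ \psi\in\mathfrak{D}(A),\ y\in\mathfrak{D}(A)\cap\mathfrak{D}(A^{\beta_2}),\ z\in\mathfrak{D}(A)\cap\mathfrak{D}(A^{\beta_3})\}.$$ $S_2(t)=e^{t\mathbb{B}_2}$ denotes the $C_0$-semigroup of contractions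 generated by $\mathbb{B}_2$ on $\mathbb{H}_2$. It is the first-order form of the Timoshenko double wall carbon nanotube system coupled with the heat equation, with $\varphi_t=u$, $\psi_t=v$, $y_t=s$, $z_t=w$ and homogeneous Dirichlet boundary conditions. *)

(* Defs.v *)
From HB Require Import structures.
From mathcomp Require Import all_boot all_order all_algebra.
From mathcomp Require Import all_classical all_reals all_analysis.
From mathcomp Require Import complex.

Set Implicit Arguments.
Unset Strict Implicit.
Unset Printing Implicit Defensive.
Import Order.TTheory GRing.Theory Num.Theory.
Import numFieldNormedType.Exports.
Local Open Scope classical_set_scope.
Local Open Scope ring_scope.
Local Open Scope complex_scope.

(* A Hilbert space is represented by a complex vector space V of
   representatives, the set H of those representatives that belong to the
   space, and the (semi)norm N on H; two elements U, V of H denote the same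
   vector when N (U - V) = 0.  Operators are given by their graphs. *)
Section Semigroups.
Context {R : realType} {V : lmodType R[i]} (H : set V) (N : V -> R).

Definition opnorm (T : V -> V) : \bar R :=
  ereal_sup [set (N (T U))%:E | U in [set U | H U /\ N U <= 1]].

Record C0_contraction_semigroup (S : R -> V -> V) : Prop := {
  sg_stable : forall t U, 0 <= t -> H U -> H (S t U) ;
  sg_linear : forall t c U W, 0 <= t -> H U -> H W ->
    N (S t (c *: U + W) - (c *: S t U + S t W)) = 0 ;
  sg_contraction : forall t, 0 <= t -> (opnorm (S t) <= 1%:E)%E ;
  sg_zero : forall U, H U -> N (S 0 U - U) = 0 ;
  sg_add : forall t s U, 0 <= t -> 0 <= s -> H U ->
    N (S (t + s) U - S t (S s U)) = 0 ;
  sg_strong_continuity : forall U, H U -> N (S t U - U) @[t --> 0^'+] --> 0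
}.

Definition generator (S : R -> V -> V) (U F : V) : Prop :=
  [/\ H U, H F & N ((t^-1)%:C *: (S t U - U) - F) @[t --> 0^'+] --> 0].

Definition op_closure (B : V -> V -> Prop) (U F : V) : Prop :=
  [/\ H U, H F & forall e : R, 0 < e ->
     exists U' F', [/\ B U' F', N (U' - U) < e & N (F' - F) < e]].

(* S is the semigroup generated by B when its infinitesimal generator is the
   closure of B, i.e. when B is defined on a core of the generator (if B is
   closed, this means that B itself is the generator).  The closure matters for
   operators such as B_2 below, which is given on a domain of regular elements
   on which it is not closed. *)
Definition generates (B : V -> V -> Prop) (S : R -> V -> V) : Prop :=
  forall U F, generator S U F <-> op_closure B U F.

Definition exponentially_stable (S : R -> V -> V) : Prop :=
  exists M omega : R, [/\ 1 <= M, 0 < omega &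
    forall t, 0 <= t -> (opnorm (S t) <= (M * expR (- omega * t))%:E)%E].

End Semigroups.

Section DirichletLaplacian.
Context {R : realType} (l : R).

Local Notation mu := (@lebesgue_measure R).
Local Notation Omega := (`]0, l[%classic : set R).

(* R[i]^o is R[i] seen as a vector space over itself. *)
Definition cfun := R -> R[i]^o.

Definition reP (f : cfun) (x : R) : R := complex.Re (f x).
Definition imP (f : cfun) (x : R) : R := complex.Im (f x).

Definition sqmod (z : R[i]) : R := complex.Re z ^+ 2 + complex.Im z ^+ 2.

Definition L2 (f : cfun) : Prop :=
  [/\ measurable_fun Omega (reP f), measurable_fun Omega (imP f)
    & mu.-integrable Omega (fun x => (sqmod (f x))%:E)].

Definition cintegral (f : cfun) : R[i] :=
  (\int[mu]_(x in Omega) reP f x) +i* (\int[mu]_(x in Omega) imP f x).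

Definition inner (f g : cfun) : R[i] := cintegral (fun x => f x * (g x)^*).

Definition norm2 (f : cfun) : R :=
  Num.sqrt (\int[mu]_(x in Omega) sqmod (f x)).

Definition aeeq (f g : cfun) : Prop :=
  {ae mu, forall x, Omega x -> f x = g x}.

Definition smooth (f : R -> R) : Prop :=
  forall n x, derivable (derive1n n f) x 1.

(* C_c^oo(0,l) *)
Definition test_function (eta : cfun) : Prop :=
  [/\ smooth (reP eta), smooth (imP eta)
    & exists a b : R, [/\ 0 < a, b < l & forall x, x < a \/ b < x -> eta x = 0]].

Definition cderive (eta : cfun) : cfun :=
  fun x => (derive1 (reP eta) x) +i* (derive1 (imP eta) x).

Definition weak_derivative (f g : cfun) : Prop :=
  [/\ L2 f, L2 g
    & forall eta, test_function eta -> inner f (cderive eta) = - inner g eta].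

(* f \in H^1_0(0,l), the closure of C_c^oo(0,l) in H^1(0,l), and f_x = g. *)
Definition H10_derivative (f g : cfun) : Prop :=
  [/\ L2 f, L2 g & forall e : R, 0 < e -> exists eta,
     [/\ test_function eta, norm2 (f - eta) < e & norm2 (g - cderive eta) < e]].

(* H^1_0(0,l) = D(A^{1/2}) *)
Definition H10 (f : cfun) : Prop := exists g, H10_derivative f g.

Definition dx (f : cfun) : cfun := xget 0 [set g | H10_derivative f g].

(* f \in D(A) = H^2(0,l) `&` H^1_0(0,l) and g = A f = - f_xx.  This is also
   what it means for the extension of A to H^1_0(0,l), with values in
   H^{-1}(0,l), to send f to the element g of L^2(0,l). *)
Definition laplacian (f g : cfun) : Prop :=
  H10 f /\ weak_derivative (dx f) (- g).

Definition dom_laplacian (f : cfun) : Prop := exists g, laplacian f g.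

(* Spectral resolution of A: the eigenvalues are (k pi / l)^2 for k >= 1, with
   normalized eigenfunctions sqrt(2/l) sin(k pi x / l); here k = n.+1. *)
Definition eigval (n : nat) : R := (n.+1%:R * pi / l) ^+ 2.

Definition eigfun (n : nat) : cfun :=
  fun x => (Num.sqrt (2 / l) * sin (n.+1%:R * pi * x / l))%:C.

Definition coef (f : cfun) (n : nat) : R[i] := inner f (eigfun n).

(* || A^sigma f ||^2, as a series in [0, +oo] *)
Definition sqnorm_frac (sigma : R) (f : cfun) : \bar R :=
  (\sum_(0 <= n <oo) (eigval n `^ (2 * sigma) * sqmod (coef f n))%:E)%E.

Definition norm_frac (sigma : R) (f : cfun) : R :=
  Num.sqrt (fine (sqnorm_frac sigma f)).

(* D(A^sigma), for sigma >= 0 *)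
Definition dom_frac (sigma : R) (f : cfun) : Prop :=
  L2 f /\ (sqnorm_frac sigma f < +oo)%E.

(* A^sigma f = g, with f and g in L^2(0,l) *)
Definition frac_power (sigma : R) (f g : cfun) : Prop :=
  [/\ L2 f, L2 g & forall n, coef g n = (eigval n `^ sigma)%:C * coef f n].

End DirichletLaplacian.

(* len, jj and KK are the length l and the constants written \jmath and K. *)
Record constants (R : realType) := Constants {
  len : R ; rho1 : R ; rho2 : R ; rho3 : R ; rho4 : R ; rho5 : R ;
  kappa1 : R ; kappa2 : R ; b1 : R ; b2 : R ; jj : R ;
  gamma1 : R ; gamma2 : R ; gamma3 : R ; delta : R ; KK : R
}.

Definition positive_constants (R : realType) (p : constants R) : Prop :=
  0 < len p /\
  [/\ 0 < rho1 p, 0 < rho2 p, 0 < rho3 p, 0 < rho4 p & 0 < rho5 p] /\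
  [/\ 0 < kappa1 p, 0 < kappa2 p, 0 < b1 p, 0 < b2 p & 0 < jj p] /\
  [/\ 0 < gamma1 p, 0 < gamma2 p, 0 < gamma3 p, 0 < delta p & 0 < KK p].

(* Representatives (phi, u, psi, v, y, s, z, w, theta) of phase-space vectors. *)
Definition phase (R : realType) : Type :=
  (@cfun R * @cfun R * @cfun R * @cfun R * @cfun R * @cfun R * @cfun R *
   @cfun R * @cfun R)%type.

Section Nanotube.
Context {R : realType} (p : constants R).

Local Notation l := (len p).

Definition H2 (U : phase R) : Prop :=
  let: (phi, u, psi, v, y, s, z, w, theta) := U in
  [/\ H10 l phi, H10 l psi, H10 l y & H10 l z] /\
  [/\ L2 l u, L2 l v, L2 l s, L2 l w & L2 l theta].

Definition normH2 (U : phase R) : R :=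
  let: (phi, u, psi, v, y, s, z, w, theta) := U in
  Num.sqrt (
    rho1 p * norm2 l u ^+ 2 + rho2 p * norm2 l v ^+ 2
  + rho3 p * norm2 l s ^+ 2 + rho4 p * norm2 l w ^+ 2
  + b1 p * norm_frac l 2^-1 psi ^+ 2 + b2 p * norm_frac l 2^-1 z ^+ 2
  + kappa1 p * norm2 l (dx l phi - psi) ^+ 2
  + kappa2 p * norm2 l (dx l y - z) ^+ 2
  + jj p * norm2 l (y - phi) ^+ 2 + rho5 p * norm2 l theta ^+ 2).

Context (beta1 beta2 beta3 : R).

Definition domB2 (U : phase R) : Prop :=
  H2 U /\
  let: (phi, u, psi, v, y, s, z, w, theta) := U in
  [/\ H10 l u, H10 l v, H10 l s & H10 l w] /\
  [/\ dom_laplacian l theta,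
      dom_laplacian l phi /\ dom_frac l beta1 phi,
      dom_laplacian l psi,
      dom_laplacian l y /\ dom_frac l beta2 y
    & dom_laplacian l z /\ dom_frac l beta3 z].

(* Graph of B_2 : D(B_2) -> H_2.  For U as in [domB2] the terms A^beta1 u,
   A^beta2 s, A^beta3 w and A v are a priori only in negative-order spaces of
   the scale; since all other terms of their components lie in L^2(0,l), the
   requirement that B_2 U belong to H_2 says exactly that these four terms are
   elements Pu, Ps, Pw and Av of L^2(0,l). *)
Definition B2 (U G : phase R) : Prop :=
  [/\ domB2 U, H2 G &
  let: (phi, u, psi, v, y, s, z, w, theta) := U in
  let: (g1, g2, g3, g4, g5, g6, g7, g8, g9) := G in
  exists Aphi Apsi Ay Az Atheta Av Pu Ps Pw : @cfun R,
  [/\ [/\ laplacian l phi Aphi, laplacian l psi Apsi,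
          laplacian l y Ay & laplacian l z Az],
      laplacian l theta Atheta /\ laplacian l v Av,
      [/\ frac_power l beta1 u Pu, frac_power l beta2 s Ps
        & frac_power l beta3 w Pw],
      [/\ aeeq l g1 u, aeeq l g3 v, aeeq l g5 s & aeeq l g7 w]
    & [/\ aeeq l g2 (
            - (kappa1 p / rho1 p)%:C *: Aphi - (kappa1 p / rho1 p)%:C *: dx l psi
            + (jj p / rho1 p)%:C *: (y - phi) - (gamma1 p / rho1 p)%:C *: Pu),
          aeeq l g4 (
            - (b1 p / rho2 p)%:C *: Apsi
            + (kappa1 p / rho2 p)%:C *: (dx l phi - psi)
            + (delta p / rho2 p)%:C *: Atheta),
          aeeq l g6 (
            - (kappa2 p / rho3 p)%:C *: Ay - (kappa2 p / rho3 p)%:C *: dx l z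
            - (jj p / rho3 p)%:C *: (y - phi) - (gamma2 p / rho3 p)%:C *: Ps),
          aeeq l g8 (
            - (b2 p / rho4 p)%:C *: Az
            + (kappa2 p / rho4 p)%:C *: (dx l y - z)
            - (gamma3 p / rho4 p)%:C *: Pw)
        & aeeq l g9 (
            - (KK p / rho5 p)%:C *: Atheta - (delta p / rho5 p)%:C *: Av)]]].

End Nanotube.

(* Main.v *)
(* Let E be the energy form, i.e. the real part of the inner product of H_2.  On
   the domain of B_2 one has E(B_2 U, U) = - D with
     D = gamma1 <A^beta1 u, u> + gamma2 <A^beta2 s, s> + gamma3 <A^beta3 w, w>
         + K ||theta_x||^2 >= 0,
   which controls u, s, w and theta, but neither v nor the positions.  The missing
   terms come from the bounded form
     J(U, U) = 2 (rho1 <u, phi> + rho2 <v, psi> + rho3 <s, y> + rho4 <w, z>)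
               + 2 m rho5 <A^-1 theta, v>,   m = 2 rho2 / delta.
   The products velocity * position produce minus the potential energy, and since
   rho5 theta_t contains - delta A v, the last product produces
   - m delta ||v||^2 = - 2 rho2 ||v||^2.  The remaining terms are absorbed by Young's
   inequality; for the damping terms this uses beta <= 1, in the form
   |<A^beta u, phi>| <= T/2 <A^beta u, u> + C/(2T) ||phi_x||^2.  Altogether
   J(B_2 U, U) <= - E(U, U) / 2 + C D, so that E + eps J is, for small eps > 0,
   equivalent to E and decays exponentially along B_2, hence along the semigroup,
   whose generator is the closure of B_2.

   Fractional powers, Poincare's inequality and A^-1 are handled through sine
   series.  The sine system is complete because the closure of its span in L^2 is
   stable under multiplication by cos (pi x / l), hence by the indicator functions
   of intervals, and contains a positive function. *)

Require Import Defs.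
From mathcomp Require Import all_boot all_order all_algebra.
From mathcomp Require Import all_classical all_reals all_analysis.
From mathcomp Require Import complex.
From mathcomp Require Import measurable_realfun ring lra.

Set Implicit Arguments.
Unset Strict Implicit.
Unset Printing Implicit Defensive.
Import Order.TTheory GRing.Theory Num.Theory.
Import numFieldNormedType.Exports.
Local Open Scope classical_set_scope.
Local Open Scope ring_scope.
Local Open Scope complex_scope.
Local Notation "f ^` ()" := (derive1 f) : ring_scope.

(** * Symmetric forms *)

(** The estimates are available only on the given domain of [B_2], where every term is a function of
    L^2, and a general orbit of the generator need not meet that domain. Both forms are bounded in
    the phase norm, so the pointwise inequality passes from [B_2] to its closure. Decay is then
    obtained without differentiating along an orbit: one short time step is compared with its linear
    approximation, the remainder being taken at time 0 and carried along by the contraction, hence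
    uniform in time; the steps are then multiplied.

    Equality of vectors means only that the difference is null, and [dx] is a chosen representative,
    so everything is expressed through forms that ignore null changes.

    The value of m is forced by v: when J(B_2 U, U) is written as - E plus a rest, the kinetic
    energies are left over twice. Those of u, s, w are controlled by D, that of v is not, and m
    delta = 2 rho2 removes exactly this surplus. The weight A^-1 turns A v into v and A psi into
    psi, so the added product is bounded on the phase space and creates no term above the energy
    level. *)

(** The scalar core of the Cauchy-Schwarz inequality. Stated for the polynomial alone, it serves
    semidefinite forms, where [c] may vanish, and products whose laws hold only on part of the
    space. *)
Lemma discriminant_le (R : realType) (a b c : R) :
  (forall t, 0 <= a + 2 * t * b + t ^+ 2 * c) -> b <= Num.sqrt a * Num.sqrt c.
Proof.
move=> key.
have a0 : 0 <= a by have := key 0; rewrite mulr0 mul0r expr0n mul0r !addr0.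
have [b0|b0] := leP b 0; first by rewrite (le_trans b0)// mulr_ge0 ?sqrtr_ge0.
have c0 : 0 < c.
  rewrite ltNge; apply/negP => c0.
  (* At this [t] the linear term equals [- (a + 1)], so with [c <= 0] the polynomial is at most
     -1. *)
  have := key (- (a + 1) / (2 * b)).
  have -> : 2 * (- (a + 1) / (2 * b)) * b = - (a + 1) by field; rewrite gt_eqF.
  have : (- (a + 1) / (2 * b)) ^+ 2 * c <= 0 by rewrite mulr_ge0_le0 ?sqr_ge0.
  lra.
rewrite -sqrtrM// -ler_sqr ?nnegrE ?sqrtr_ge0 ?(ltW b0)//.
rewrite sqr_sqrtr ?mulr_ge0 ?(ltW c0)//.
have := key (- b / c).
have -> : a + 2 * (- b / c) * b + (- b / c) ^+ 2 * c = (a * c - b ^+ 2) / c.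
  by field; rewrite gt_eqF.
by rewrite pmulr_lge0 ?invr_gt0// subr_ge0.
Qed.

Section SymmetricForms.
Context {R : realType} {V : lmodType R[i]} (H : set V).
Hypothesis Hlin : forall (c : R) U W, H U -> H W -> H (c%:C *: U + W).

(** Scalars are real because the forms in use are real parts of Hermitian ones. The laws are
    restricted to [H] because integrals are additive only on integrable representatives. *)
Record symform (b : V -> V -> R) : Prop := {
  symformD : forall U W Z, H U -> H W -> H Z -> b (U + W) Z = b U Z + b W Z ;
  symformZ : forall c U Z, H U -> H Z -> b (c%:C *: U) Z = c * b U Z ;
  symformC : forall U W, H U -> H W -> b U W = b W U
}.

Lemma real_scaleN (c : R) : (- c)%:C = - c%:C :> R[i].
Proof. by apply/eqP; rewrite eq_complex /= oppr0 !eqxx. Qed.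

Lemma stable0 U : H U -> H 0.
Proof. by move=> HU; have := Hlin (-1) HU HU; rewrite real_scaleN scaleN1r addNr. Qed.

Lemma stableZ c U : H U -> H (c%:C *: U).
Proof. by move=> HU; have := Hlin c HU (stable0 HU); rewrite addr0. Qed.

Lemma stableD U W : H U -> H W -> H (U + W).
Proof. by move=> HU HW; have := Hlin 1 HU HW; rewrite scale1r. Qed.

Lemma stableN U : H U -> H (- U).
Proof. by move=> /(stableZ (-1)); rewrite real_scaleN scaleN1r. Qed.

Lemma stableB U W : H U -> H W -> H (U - W).
Proof. by move=> HU /stableN; exact: stableD. Qed.

Variable b : V -> V -> R.
Hypothesis bS : symform b.
Hypothesis b_ge0 : forall U, H U -> 0 <= b U U.

Definition formnorm (U : V) : R := Num.sqrt (b U U).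
Local Notation n := formnorm.

Lemma formnorm_ge0 U : 0 <= n U. Proof. exact: sqrtr_ge0. Qed.

Lemma formnorm_sqr U : H U -> n U ^+ 2 = b U U.
Proof. by move=> HU; rewrite sqr_sqrtr// b_ge0. Qed.

Lemma symform_sqrD c U W : H U -> H W ->
  b (U + c%:C *: W) (U + c%:C *: W) = b U U + 2 * c * b U W + c ^+ 2 * b W W.
Proof.
move=> HU HW; have HcW := stableZ c HW; have HUW := stableD HU HcW.
rewrite (symformD bS HU HcW HUW) (symformZ bS c HW HUW).
rewrite (symformC bS HU HUW) (symformC bS HW HUW).
rewrite (symformD bS HU HcW HU) (symformD bS HU HcW HW) !(symformZ bS)//.
by rewrite (symformC bS HW HU); ring.
Qed.

Lemma symform_le U W : H U -> H W -> b U W <= n U * n W.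
Proof.
move=> HU HW; apply: discriminant_le => t.
by rewrite -symform_sqrD// b_ge0//; apply: stableD => //; exact: stableZ.
Qed.

Lemma formnormZ c U : H U -> n (c%:C *: U) = `|c| * n U.
Proof.
move=> HU; have HcU := stableZ c HU.
rewrite /n (symformZ bS)// (symformC bS)// (symformZ bS)//.
by rewrite mulrA -expr2 sqrtrM ?sqr_ge0// sqrtr_sqr.
Qed.

Lemma formnormN U : H U -> n (- U) = n U.
Proof.
by move=> HU; rewrite -scaleN1r -real_scaleN formnormZ// normrN1 mul1r.
Qed.

Lemma formnormD U W : H U -> H W -> n (U + W) <= n U + n W.
Proof.
move=> HU HW; rewrite -ler_sqr ?nnegrE ?addr_ge0 ?formnorm_ge0//.
have HUW := stableD HU HW; rewrite formnorm_sqr//.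
have := symform_sqrD 1 HU HW; rewrite scale1r => ->.
have := symform_le HU HW; have := formnorm_sqr HU; have := formnorm_sqr HW; nra.
Qed.

Lemma formnorm_triangle W U Z : H U -> H W -> H Z -> n (U - Z) <= n (U - W) + n (W - Z).
Proof.
move=> HU HW HZ; rewrite (_ : U - Z = U - W + (W - Z)); last by rewrite addrA subrK.
by rewrite formnormD//; exact: stableB.
Qed.

Lemma formnorm_sym U W : H U -> H W -> n (U - W) = n (W - U).
Proof. by move=> HU HW; rewrite -opprB formnormN//; exact: stableB. Qed.

Lemma formnorm_le U W : H U -> H W -> n U <= n W + n (U - W).
Proof.
move=> HU HW; rewrite -[in n U](subrK W U) addrC [leRHS]addrC.
by rewrite addrC formnormD//; exact: stableB.
Qed.

(** The form may have nonzero null vectors; the triangle inequality makes the seminorm blind to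
    them. *)
Lemma formnorm_eq U W : H U -> H W -> n (U - W) = 0 -> n U = n W.
Proof.
move=> HU HW e; apply/eqP; rewrite eq_le.
have := formnorm_le HU HW; have := formnorm_le HW HU.
by rewrite formnorm_sym// e !addr0 => -> ->.
Qed.

End SymmetricForms.

(** * Lyapunov functions for contraction semigroups *)

Section Lyapunov.
Context {R : realType} {V : lmodType R[i]} (H : set V) (N : V -> R).
Hypothesis Hlin : forall (c : R) U W, H U -> H W -> H (c%:C *: U + W).
Variables E b : V -> V -> R.
Hypothesis ES : symform H E.
Hypothesis E_ge0 : forall U, H U -> 0 <= E U U.
Hypothesis NE : forall U, H U -> N U = formnorm E U.
Hypothesis bS : symform H b.
Variables k1 k2 w : R.
Hypothesis k1_gt0 : 0 < k1.
Hypothesis b_ge : forall U, H U -> k1 * E U U <= b U U.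
Hypothesis b_le : forall U, H U -> b U U <= k2 * E U U.
Hypothesis w_gt0 : 0 < w.
Variable B : V -> V -> Prop.
Hypothesis BH : forall U F, B U F -> H U /\ H F.
Hypothesis B_dissipative : forall U F, B U F -> b F U <= - w * b U U.
Hypothesis B_dense : forall U, H U -> forall e : R, 0 < e ->
  exists U' F', B U' F' /\ N (U' - U) < e.
Variable S : R -> V -> V.
Hypothesis HS : C0_contraction_semigroup H N S.
Hypothesis Hgen : generates H N B S.

Let H0 U : H U -> H 0. Proof. exact: stable0. Qed.
Let HZ c U : H U -> H (c%:C *: U). Proof. exact: stableZ. Qed.
Let HD U W : H U -> H W -> H (U + W). Proof. exact: stableD. Qed.
Let HN U : H U -> H (- U). Proof. exact: stableN. Qed.
Let HB U W : H U -> H W -> H (U - W). Proof. exact: stableB. Qed.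
Let HSt t U : 0 <= t -> H U -> H (S t U). Proof. exact: (sg_stable HS). Qed.

Let b_ge0 U : H U -> 0 <= b U U.
Proof. by move=> HU; rewrite (le_trans _ (b_ge HU))// mulr_ge0 ?(ltW k1_gt0)// E_ge0. Qed.

Let N_ge0 U : H U -> 0 <= N U.
Proof. by move=> HU; rewrite NE// formnorm_ge0. Qed.

Let NZ c U : H U -> N (c%:C *: U) = `|c| * N U.
Proof. by move=> HU; rewrite !NE//; [exact: (formnormZ Hlin ES)|exact: HZ]. Qed.

Let ND U W : H U -> H W -> N (U + W) <= N U + N W.
Proof. by move=> HU HW; rewrite !NE//; [exact: (formnormD Hlin ES E_ge0)|exact: HD]. Qed.

Let N_triangle W U Z : H U -> H W -> H Z -> N (U - Z) <= N (U - W) + N (W - Z).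
Proof. by move=> HU HW HZ'; rewrite !NE; [exact: (formnorm_triangle Hlin ES E_ge0)|exact: HB..]. Qed.

Let N_sym U W : H U -> H W -> N (U - W) = N (W - U).
Proof. by move=> HU HW; rewrite !NE; [exact: (formnorm_sym Hlin ES)|exact: HB..]. Qed.

Let NN U : H U -> N (- U) = N U.
Proof. by move=> HU; rewrite -scaleN1r -real_scaleN NZ// normrN1 mul1r. Qed.

Let N_le U W : H U -> H W -> N U <= N W + N (U - W).
Proof. by move=> HU HW; rewrite !NE//; [exact: (formnorm_le Hlin ES E_ge0)|exact: HB]. Qed.

(* [k2] itself need not be positive when [N] vanishes identically. *)
Let k := `|k2| + 1.
Let k_gt0 : 0 < k. Proof. by rewrite /k ltr_wpDl. Qed.

Let b_leN U : H U -> b U U <= k * N U ^+ 2.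
Proof.
move=> HU; apply: le_trans (b_le HU) _.
rewrite NE// (formnorm_sqr E_ge0 HU) ler_wpM2r ?E_ge0// /k.
by rewrite (le_trans (ler_norm _))// lerDl.
Qed.

Let b_absN U W : H U -> H W -> b U W <= k * (N U * N W).
Proof.
move=> HU HW; apply: le_trans (symform_le Hlin bS b_ge0 HU HW) _.
have le Z : H Z -> formnorm b Z <= Num.sqrt k * N Z.
  move=> HZ'; rewrite -[leRHS]ger0_norm ?mulr_ge0 ?sqrtr_ge0 ?N_ge0//.
  rewrite -sqrtr_sqr exprMn sqr_sqrtr ?(ltW k_gt0)//.
  by rewrite ler_wsqrtr// b_leN.
rewrite -[in leRHS](sqr_sqrtr (ltW k_gt0)) expr2 mulrACA.
by apply: ler_pM; rewrite ?formnorm_ge0 ?le.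
Qed.

(** The operator norm sees only the unit ball, so [U] has to be rescaled, while [S t] commutes with
    scalars only modulo null vectors. *)
Let NS t U : 0 <= t -> H U -> N (S t U) <= N U.
Proof.
move=> t0 HU; have HSU := HSt t0 HU.
have unit W : H W -> N W <= 1 -> N (S t W) <= 1.
  move=> HW W1; have := sg_contraction HS t0; rewrite -lee_fin.
  by apply: le_trans; apply: ereal_sup_ubound; exists W.
(* A free factor [c] covers both cases below: arbitrarily large [c] when [N U] vanishes, and the
   inverse of [N U] otherwise. *)
have scale c : 0 < c -> c * N U <= 1 -> c * N (S t U) <= 1.
  move=> c0 cU; have HcU := HZ c HU.
  have := unit _ HcU; rewrite NZ// gtr0_norm// => /(_ cU).
  apply: le_trans.
  have HScU := HSt t0 HcU.
  have := sg_linear HS c%:C t0 HU (H0 HU); rewrite addr0 => lin.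
  (* [S t 0] need not be the representative 0; linearity applied to 0 and 0 shows that it is
     null. *)
  have S00 : N (S t 0) = 0.
    have l0 := sg_linear HS 1 t0 (H0 HU) (H0 HU).
    rewrite scale1r addr0 scale1r opprD addrA subrr sub0r in l0.
    by rewrite NN// in l0; apply: HSt => //; exact: H0 HU.
  have HS0 := HSt t0 (H0 HU).
  have HcSU := HZ c HSU.
  have HY := HD HcSU HS0.
  have h1 : N (c%:C *: S t U + S t 0) <= N (S t (c%:C *: U)).
    by apply: le_trans (N_le HY HScU) _; rewrite N_sym// lin addr0.
  have h2 : N (c%:C *: S t U) <= N (c%:C *: S t U + S t 0).
    apply: le_trans (N_le HcSU HY) _.
    by rewrite opprD addrA subrr sub0r NN// S00 addr0.
  by apply: le_trans h1; apply: le_trans h2; rewrite NZ// gtr0_norm.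
have [U0|U0] := eqVneq (N U) 0.
  rewrite U0 leNgt; apply/negP => SU0.
  have := scale (2 / N (S t U)); rewrite divr_gt0// U0 mulr0 ler01.
  by move=> /(_ isT isT); rewrite divfK ?gt_eqF//; lra.
have Ugt : 0 < N U by rewrite lt_neqAle eq_sym U0 N_ge0.
have := scale (N U)^-1; rewrite invr_gt0 Ugt mulVf// lexx => /(_ isT isT).
by rewrite mulrC ler_pdivrMr// mul1r.
Qed.

(** The equality for which the semigroup laws hold. Carrying membership in [H] along lets these laws
    be chained by transitivity. *)
Let eqv U W := [/\ H U, H W & N (U - W) = 0].

Let eqv_trans U W Z : eqv U W -> eqv W Z -> eqv U Z.
Proof.
move=> [HU HW h1] [_ HZ' h2]; split => //; apply/eqP; rewrite eq_le N_ge0 ?andbT; last exact: HB.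
by apply: le_trans (N_triangle HU HW HZ') _; rewrite h1 h2 addr0.
Qed.

Let eqv_sym U W : eqv U W -> eqv W U.
Proof. by move=> [HU HW h]; split => //; rewrite N_sym. Qed.

Let eqv_refl U : H U -> eqv U U.
Proof.
move=> HU; split => //; rewrite subrr.
by have := NZ 0 HU; rewrite normr0 mul0r => <-; rewrite scale0r.
Qed.

Let eqvD U U' W W' : eqv U U' -> eqv W W' -> eqv (U + W) (U' + W').
Proof.
move=> [HU HU' h1] [HW HW' h2]; split; [exact: HD..|].
rewrite opprD addrACA; apply/eqP; rewrite eq_le N_ge0 ?andbT; last by apply: HD; exact: HB.
by apply: le_trans (ND _ _) _; [exact: HB..|rewrite h1 h2 addr0].
Qed.

Let eqvZ c U U' : eqv U U' -> eqv (c%:C *: U) (c%:C *: U').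
Proof.
move=> [HU HU' h1]; split; [exact: HZ..|].
by rewrite -scalerBr NZ ?h1 ?mulr0//; exact: HB.
Qed.

Let eqv_N U W : eqv U W -> N U = N W.
Proof.
move=> [HU HW h]; rewrite !NE//; apply: (formnorm_eq Hlin ES E_ge0) => //.
by rewrite -NE//; exact: HB.
Qed.

(** [b] is dominated by the square of [N], so a vector that is null for [N] is null for [b] as
    well. *)
Let eqv_b U W : eqv U W -> b U U = b W W.
Proof.
move=> [HU HW h]; rewrite -!(formnorm_sqr b_ge0)//; congr (_ ^+ 2).
apply: (formnorm_eq Hlin bS b_ge0) => //.
apply/eqP; rewrite sqrtr_eq0; apply: le_trans (b_leN (HB HU HW)) _.
by rewrite h expr0n mulr0.
Qed.

Let S_lin t (c : R) U W : 0 <= t -> H U -> H W ->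
  eqv (S t (c%:C *: U + W)) (c%:C *: S t U + S t W).
Proof.
move=> t0 HU HW; split.
- by apply: HSt => //; exact: Hlin.
- by apply: Hlin; exact: HSt.
- exact: (sg_linear HS).
Qed.

Let S_add t s U : 0 <= t -> 0 <= s -> H U -> eqv (S (t + s) U) (S t (S s U)).
Proof.
move=> t0 s0 HU; split; [|by apply: HSt => //; exact: HSt|exact: (sg_add HS)].
by apply: HSt => //; exact: addr_ge0.
Qed.

(** Both sides are continuous for [N] in [(U, F)], so the inequality survives the passage from [B]
    to its closure. *)
Let gen_dissipative U F : generator H N S U F -> b F U <= - w * b U U.
Proof.
move=> /Hgen[HU HF cl]; apply/ler_addgt0Pl => e e0.
have NU := N_ge0 HU; have NF := N_ge0 HF.
(* Replacing [(U, F)] by a pair at distance [d <= 1] changes the inequality by at most [d * M]. *)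
pose M := k * (w * (2 * N U + 1) + N U + N F + 1).
have M0 : 0 < M.
  rewrite /M mulr_gt0// ltr_wpDl// !addr_ge0// mulr_ge0 ?(ltW w_gt0)//.
  by rewrite addr_ge0// mulr_ge0.
(* The bound by 1 makes a product of two errors at most [d]. *)
pose d := Num.min 1 (e / M).
have d0 : 0 < d by rewrite lt_min ltr01 divr_gt0.
have d1 : d <= 1 by rewrite ge_min lexx.
have dM : d * M <= e by rewrite -ler_pdivlMr// ge_min lexx orbT.
have [U' [F' [BUF dU dF]]] := cl d d0.
have [HU' HF'] := BH BUF; have diss := B_dissipative BUF.
have HdU := HB HU' HU; have HdF := HB HF' HF.
have nU := N_ge0 HdU; have nF := N_ge0 HdF.
have FE : F' = F + (F' - F) by rewrite addrC subrK.
have UE : U' = U + (U' - U) by rewrite addrC subrK.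
set r := F' - F in HdF dF nF FE *; set s := U' - U in HdU dU nU UE *.
have e1 : b F' U' = b F U + b F s + b r U + b r s.
  have right X : H X -> b X U' = b X U + b X s.
    move=> HX; rewrite (symformC bS HX HU') UE (symformD bS HU HdU HX).
    by rewrite (symformC bS HU HX) (symformC bS HdU HX).
  by rewrite {1}FE (symformD bS HF HdF HU') !right//; ring.
have e2 : b U' U' = b U U + 2 * b U s + b s s.
  by have := symform_sqrD Hlin bS 1 HU HdU; rewrite scale1r -UE => ->; ring.
have lb X Y : H X -> H Y -> - (k * (N X * N Y)) <= b X Y.
  move=> HX HY; rewrite lerNl; have := b_absN (HN HX) HY.
  rewrite NN//.
  by rewrite -scaleN1r -real_scaleN (symformZ bS)// mulN1r.
have h1 := lb _ _ HF HdU; have h2 := lb _ _ HdF HU; have h3 := lb _ _ HdF HdU.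
have h4 := lb _ _ HU HdU; have h5 := b_ge0 HdU.
have a1 : N F * N s <= N F * d by rewrite ler_wpM2l// ltW.
have a2 : N r * N U <= d * N U by rewrite ler_wpM2r// ltW.
have a3 : N r * N s <= d by rewrite -[leRHS]mulr1 ler_pM// ltW// (lt_le_trans dU).
have a4 : N U * N s <= N U * d by rewrite ler_wpM2l// ltW.
have k0 := k_gt0.
have g1 : k * (N F * N s) + k * (N r * N U) + k * (N r * N s) <= k * (d * (N F + N U + 1)).
  by rewrite -!mulrDr ler_pM2l//; lra.
have g2 : w * (2 * (k * (N U * N s))) <= w * (2 * (k * (N U * d))).
  by rewrite ler_wpM2l ?(ltW w_gt0)// ler_wpM2l// ler_wpM2l ?(ltW k0).
have g3 : 0 <= w * b s s by rewrite mulr_ge0// ltW.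
have g4 : w * - (k * (N U * N s)) <= w * b U s by rewrite ler_pM2l.
have : d * M = k * (d * (N F + N U + 1)) + w * (2 * (k * (N U * d))) + k * (d * w).
  by rewrite /M; ring.
have : 0 <= k * (d * w) by rewrite !mulr_ge0 ?(ltW k0) ?(ltW d0) ?(ltW w_gt0).
rewrite e1 e2 in diss.
have : b F U + b F s + b r U + b r s <= - (w * b U U) - 2 * (w * b U s) - w * b s s.
  by move: diss; congr (_ <= _); ring.
rewrite !mulNr; lra.
Qed.

Let S_zero t U : 0 <= t -> H U -> eqv (S t 0) 0.
Proof.
move=> t0 HU; have h0 := H0 HU; split; [exact: HSt|by []|rewrite subr0].
apply/eqP; rewrite eq_le N_ge0 ?andbT; last exact: HSt.
apply: le_trans (NS t0 h0) _.
by have := NZ 0 HU; rewrite normr0 mul0r (_ : 0%:C = 0)// scale0r => ->.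
Qed.

Let S_Z t c U : 0 <= t -> H U -> eqv (S t (c%:C *: U)) (c%:C *: S t U).
Proof.
move=> t0 HU; have := S_lin c t0 HU (H0 HU); rewrite addr0 => /eqv_trans; apply.
rewrite -[X in eqv _ X]addr0; apply: eqvD; last exact: S_zero HU.
by apply: eqv_refl; apply: HZ; exact: HSt.
Qed.

Let S_D t U W : 0 <= t -> H U -> H W -> eqv (S t (U + W)) (S t U + S t W).
Proof. by move=> t0 HU HW; have := S_lin 1 t0 HU HW; rewrite !scale1r. Qed.

Let S_N t U : 0 <= t -> H U -> eqv (S t (- U)) (- S t U).
Proof. by move=> t0 HU; have := S_Z (-1) t0 HU; rewrite real_scaleN !scaleN1r. Qed.

Let S_comm t h U : 0 <= t -> 0 <= h -> H U -> eqv (S h (S t U)) (S t (S h U)).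
Proof.
move=> t0 h0 HU; apply: eqv_trans (eqv_sym (S_add h0 t0 HU)) _.
by rewrite addrC; exact: S_add.
Qed.

(** Up to a null vector, the difference quotient at [S t U] is the image under [S t] of the one at
    [U], and a contraction does not increase its distance to the limit. *)
Let gen_orbit t U F : 0 <= t -> generator H N S U F -> generator H N S (S t U) (S t F).
Proof.
move=> t0 [HU HF lim]; split; [exact: HSt..|].
apply: (@squeeze_cvgr _ _ _ _ (cst 0) _ _ _ _ _ lim); last exact: cvg_cst.
near=> h; have h0 : 0 <= h by apply/ltW.
have HhU := HSt h0 HU; have HtU := HSt t0 HU.
apply/andP; split.
  by apply: N_ge0; apply: HB; [apply: HZ; apply: HB => //; exact: HSt|exact: HSt].
have HD1 := HB HhU HU; have HD2 := HZ h^-1 HD1.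
suff e : eqv ((h^-1)%:C *: (S h (S t U) - S t U) - S t F)
    (S t ((h^-1)%:C *: (S h U - U) - F)).
  by rewrite (eqv_N e); apply: NS => //; exact: HB.
apply: eqv_sym; apply: eqv_trans (S_D t0 HD2 (HN HF)) _.
apply: eqvD; last exact: S_N.
apply: eqv_trans (S_Z _ t0 HD1) _; apply: eqvZ.
apply: eqv_trans (S_D t0 HhU (HN HU)) _.
by apply: eqvD; [exact: eqv_sym (S_comm _ _ _)|exact: S_N].
Unshelve. all: by end_near. Qed.

(** [S (t + h) U] is [S t U + h Y] with [Y = S t F + S t r], where [r] is the remainder of the
    difference quotient at time 0. By contraction the error [eps] is therefore the same for all [t],
    which is what permits iteration. *)
Let step U F t h : generator H N S U F -> 0 <= t -> 0 < h ->
  let eps := N ((h^-1)%:C *: (S h U - U) - F) in eps <= 1 ->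
  b (S (t + h) U) (S (t + h) U) <= (1 - 2 * w * h) * b (S t U) (S t U) +
    h * (k * (2 * N U + (N F + 1) ^+ 2) * (h + eps)).
Proof.
move=> gUF t0 h0 eps eps1; have [HU HF _] := gUF.
have HhU := HSt (ltW h0) HU; have HtU := HSt t0 HU; have HtF := HSt t0 HF.
have diss := gen_dissipative (gen_orbit t0 gUF).
set r := (h^-1)%:C *: (S h U - U) - F in eps eps1 *.
have Hr : H r by apply: HB => //; apply: HZ; exact: HB.
have HFr := HD HF Hr; have Htr := HSt t0 Hr.
have ShE : S h U = h%:C *: (F + r) + U.
  rewrite /r addrCA subrr addr0 scalerA -rmorphM divff ?gt_eqF//.
  by rewrite scale1r subrK.
set Y := S t F + S t r; have HY : H Y by exact: HD.
have e : eqv (S (t + h) U) (S t U + h%:C *: Y).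
  apply: eqv_trans (S_add t0 (ltW h0) HU) _; rewrite ShE.
  apply: eqv_trans (S_lin h t0 HFr HU) _; rewrite addrC.
  by apply: eqvD; [exact: eqv_refl|apply: eqvZ; exact: S_D].
rewrite (eqv_b e) (symform_sqrD Hlin bS)//.
have bXY : b (S t U) Y <= - w * b (S t U) (S t U) + k * (eps * N U).
  rewrite (symformC bS HtU HY) (symformD bS HtF Htr HtU); apply: lerD => //.
  apply: le_trans (b_absN Htr HtU) _; rewrite ler_wpM2l ?(ltW k_gt0)//.
  by rewrite ler_pM ?N_ge0 ?NS.
have e0 : 0 <= eps by exact: N_ge0.
have bYY : b Y Y <= k * (N F + 1) ^+ 2.
  apply: le_trans (b_leN HY) _; rewrite ler_wpM2l ?(ltW k_gt0)//.
  rewrite lerXn2r ?nnegrE ?N_ge0//; first by rewrite addr_ge0 ?N_ge0.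
  apply: le_trans (ND HtF Htr) _; apply: lerD; first exact: NS.
  exact: le_trans (NS t0 Hr) eps1.
have NU := N_ge0 HU; have NF := N_ge0 HF.
have q1 : 2 * h * b (S t U) Y <= 2 * h * (- w * b (S t U) (S t U) + k * (eps * N U)).
  by rewrite ler_wpM2l// mulr_ge0// ltW.
have q2 : h ^+ 2 * b Y Y <= h ^+ 2 * (k * (N F + 1) ^+ 2).
  by rewrite ler_wpM2l// sqr_ge0.
apply: le_trans (lerD (lerD (lexx _) q1) q2) _.
rewrite -subr_ge0.
have -> : (1 - 2 * w * h) * b (S t U) (S t U) +
    h * (k * (2 * N U + (N F + 1) ^+ 2) * (h + eps)) -
    (b (S t U) (S t U) + 2 * h * (- w * b (S t U) (S t U) + k * (eps * N U)) +
     h ^+ 2 * (k * (N F + 1) ^+ 2)) =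
    h * k * (2 * N U * h + (N F + 1) ^+ 2 * eps) by ring.
apply: mulr_ge0; first by rewrite mulr_ge0 ?(ltW h0) ?(ltW k_gt0).
by rewrite addr_ge0// mulr_ge0 ?sqr_ge0 ?(ltW h0)// mulr_ge0.
Qed.

(** The factor [1 - 2 w h] lies between 0 and 1, so earlier errors are not amplified and add up to a
    multiple of the elapsed time. *)
Let iterate U F h : generator H N S U F -> 0 < h -> 2 * w * h <= 1 ->
  let eps := N ((h^-1)%:C *: (S h U - U) - F) in eps <= 1 ->
  forall j : nat, b (S (j%:R * h) U) (S (j%:R * h) U) <=
    (1 - 2 * w * h) ^+ j * b U U +
    j%:R * h * (k * (2 * N U + (N F + 1) ^+ 2) * (h + eps)).
Proof.
move=> gUF h0 wh eps eps1; have [HU HF _] := gUF.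
set M := k * _ * _; have eps0 : 0 <= eps.
  by apply: N_ge0; apply: HB => //; apply: HZ; apply: HB => //; apply: HSt => //; exact: ltW.
have M0 : 0 <= M.
  rewrite /M mulr_ge0 ?addr_ge0 ?(ltW h0)// mulr_ge0 ?(ltW k_gt0)//.
  by rewrite addr_ge0 ?sqr_ge0// mulr_ge0 ?N_ge0.
elim=> [|j IH].
  rewrite expr0 !mul0r mul1r addr0.
  have e : eqv (S 0 U) U by split; [exact: HSt|by []|exact: (sg_zero HS)].
  by rewrite (eqv_b e).
have jh : 0 <= j%:R * h by rewrite mulr_ge0// ltW.
have -> : j.+1%:R * h = j%:R * h + h by rewrite -natr1 mulrDl mul1r.
apply: le_trans (step gUF jh h0 eps1) _; rewrite -/eps -/M.
have := ler_wpM2l (_ : 0 <= 1 - 2 * w * h) IH; rewrite subr_ge0 => /(_ wh) IH'.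
apply: le_trans (lerD IH' (lexx _)) _.
rewrite mulrDr mulrA -exprS -addrA lerD2l [leRHS]mulrDl lerD2r.
apply: ler_piMl; first exact: mulr_ge0.
by rewrite gerBl !mulr_ge0 ?(ltW w_gt0) ?(ltW h0).
Qed.

Let gen_decay U F T : 0 <= T -> generator H N S U F ->
  b (S T U) (S T U) <= expR (- (2 * w * T)) * b U U.
Proof.
move=> T0 gUF; have [HU HF lim] := gUF.
have [->|Tn0] := eqVneq T 0.
  have e : eqv (S 0 U) U by split; [exact: HSt|by []|exact: (sg_zero HS)].
  by rewrite (eqv_b e) mulr0 oppr0 expR0 mul1r.
have Tgt : 0 < T by rewrite lt_neqAle eq_sym Tn0.
apply/ler_addgt0Pl => e e0.
set K := k * (2 * N U + (N F + 1) ^+ 2).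
have K0 : 0 < K.
  rewrite /K mulr_gt0// ltr_wpDl ?mulr_ge0 ?N_ge0// exprn_gt0//.
  by rewrite ltr_wpDl ?N_ge0.
(* The accumulated error is [T * K * (h + eps)]; with [h] and [eps] both below [d] it stays below
   [e]. The bound by 1 is the condition [eps <= 1] of a single step. *)
pose d := Num.min 1 (e / (2 * T * K)).
have d0 : 0 < d.
  by rewrite lt_min ltr01/=; apply: divr_gt0 => //; rewrite mulr_gt0// mulr_gt0.
have TK : 0 < 2 * T * K by rewrite mulr_gt0// mulr_gt0.
have dK : 2 * T * K * d <= e by rewrite mulrC -ler_pdivlMr// /d ge_min lexx orbT.
have d1 : d <= 1 by rewrite /d ge_min lexx.
have /cvgrPdist_lt /(_ _ d0) := lim; rewrite near_withinE => -[rho /= rho0 Hrho].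
(* Three demands on the step: the difference quotient is within [d] of its limit, [h < d], and
   [2 w h <= 1]. The successor in [m] below makes [T / m] strictly smaller than [h0]. *)
pose h0 := Num.min rho (Num.min d (2 * w)^-1).
have w2 : 0 < (2 * w)^-1 by rewrite invr_gt0 mulr_gt0.
have h00 : 0 < h0 by rewrite /h0 lt_min rho0 lt_min d0 w2.
pose m := (Num.truncn (T / h0)).+1.
have m0 : 0 < m%:R :> R by rewrite ltr0n.
pose h := T / m%:R; have hgt : 0 < h by rewrite divr_gt0.
have hh0 : h < h0.
  rewrite ltr_pdivrMr// mulrC -ltr_pdivrMr//; exact: truncnS_gt.
have [hrho [hd hw]] : h < rho /\ h < d /\ h < (2 * w)^-1.
  by move: hh0; rewrite !lt_min => /andP[-> /andP[]].
have := Hrho h; rewrite /= sub0r normrN gtr0_norm// => /(_ hrho hgt).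
rewrite sub0r normrN ger0_norm; last first.
  by apply: N_ge0; apply: HB => //; apply: HZ; apply: HB => //; apply: HSt => //; exact: ltW.
move=> epsd; have eps1 := le_trans (ltW epsd) d1.
have wh : 2 * w * h <= 1.
  by rewrite mulrC -ler_pdivlMr ?mulr_gt0// div1r ltW.
have := iterate gUF hgt wh eps1 m.
rewrite (_ : m%:R * h = T); last by rewrite mulrC divfK ?gt_eqF.
move=> /le_trans; apply; rewrite addrC; apply: lerD.
  rewrite -/K; have : T * (K * (h + N ((h^-1)%:C *: (S h U - U) - F))) <= T * (K * (d + d)).
    by rewrite ler_pM2l// ler_pM2l// lerD// ltW.
  by move/le_trans; apply; move: dK; congr (_ <= _); ring.
rewrite ler_wpM2r ?b_ge0//.
have hT : 2 * w * T = m%:R * (2 * w * h) by rewrite /h; field; rewrite gt_eqF.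
(* Factor by factor, this is [1 + x <= expR x] at [x = - (2 w h)]. *)
rewrite hT -(mulrN m%:R) expRM_natl lerXn2r ?nnegrE ?subr_ge0 ?expR_ge0//.
exact: expR_ge1Dx.
Qed.

Theorem lyapunov_exponentially_stable : exponentially_stable H N S.
Proof.
(* The root is the price of passing from [N] to [b] and back; the summand 1 ensures [1 <= M]. *)
pose M := Num.sqrt (k / k1) + 1; have M1 : 1 <= M by rewrite /M lerDr sqrtr_ge0.
exists M, w; split => // t t0.
have gen_le U F : generator H N S U F -> N (S t U) <= M * expR (- w * t) * N U.
  move=> gUF; have [HU _ _] := gUF; have HtU := HSt t0 HU.
  have h1 := gen_decay t0 gUF; have h2 := b_leN HU; have h3 := b_ge HtU.
  have E0 : 0 <= expR (- w * t) by exact: expR_ge0.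
  have Ee : expR (- (2 * w * t)) = expR (- w * t) ^+ 2.
    by rewrite expr2 -expRD; congr expR; ring.
  have h4 : N (S t U) ^+ 2 <= k / k1 * (expR (- w * t) * N U) ^+ 2.
    rewrite (NE HtU) (formnorm_sqr E_ge0 HtU) mulrAC ler_pdivlMr// mulrC.
    apply: le_trans h3 _; apply: le_trans h1 _.
    rewrite Ee exprMn mulrCA; apply: ler_wpM2l => //; exact: sqr_ge0.
  apply: (@le_trans _ _ (Num.sqrt (k / k1) * (expR (- w * t) * N U))).
    rewrite -ler_sqr ?nnegrE ?N_ge0 ?mulr_ge0 ?sqrtr_ge0 ?N_ge0//.
    by rewrite exprMn sqr_sqrtr// divr_ge0// ltW.
  by rewrite -mulrA ler_wpM2r ?mulr_ge0 ?N_ge0// lerDl.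
have Bgen U F : B U F -> generator H N S U F.
  move=> BUF; have [HU HF] := BH BUF; apply/Hgen; split => // e e0.
  have zero W : H W -> N (W - W) < e by move=> /eqv_refl[_ _ ->].
  by exists U, F; split; [|exact: zero..].
apply: ge_ereal_sup => _ [U [HU U1] <-]; rewrite lee_fin.
apply/ler_addgt0Pl => e e0; set c := M * expR (- w * t).
have c0 : 0 <= c by rewrite mulr_ge0 ?expR_ge0// (le_trans ler01).
have c1 : 0 < c + 1 by rewrite ltr_wpDl.
(* The approximation error enters twice: with weight [c] through [N U'] and with weight 1 through
   the contracted difference. Hence the tolerance [e / (c + 1)]. *)
have [U' [F' [BUF dU]]] := B_dense HU (divr_gt0 e0 c1).
have [HU' HF'] := BH BUF; have HtU := HSt t0 HU; have HtU' := HSt t0 HU'.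
have h1 : N (S t U - S t U') <= N (U' - U).
  have e1 : eqv (S t (U - U')) (S t U - S t U').
    apply: eqv_trans (S_D t0 HU (HN HU')) _.
    by apply: eqvD; [exact: eqv_refl|exact: S_N].
  by rewrite -(eqv_N e1) N_sym//; apply: NS => //; exact: HB.
have h2 := gen_le _ _ (Bgen _ _ BUF); have h3 := N_le HtU HtU'.
have h4 := N_le HU' HU.
apply: le_trans h3 _.
have h5 : c * N U' <= c * (1 + N (U' - U)).
  by rewrite ler_wpM2l// (le_trans h4)// lerD2r.
have h6 : (c + 1) * N (U' - U) <= e by rewrite mulrC -ler_pdivlMr// ltW.
rewrite -/c in h2; lra.
Qed.

End Lyapunov.

(** * The real Hilbert space underlying L^2(0,l) *)

Section SquareIntegrable.
Context d (T : measurableType d) (R : realType).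
Variables (mu : {measure set T -> \bar R}) (D : set T).
Hypothesis mD : measurable D.

Definition sqint (f : T -> R) : Prop :=
  measurable_fun D f /\ mu.-integrable D (fun x => (f x ^+ 2)%:E).

Lemma sqint_mul_integrable (f g : T -> R) : sqint f -> sqint g ->
  mu.-integrable D (fun x => (f x * g x)%:E).
Proof.
move=> [mf If] [mg Ig].
apply: (le_integrable mD _ _ (integrableD mD If Ig)).
  by apply/measurable_EFinP; exact: measurable_funM.
move=> x _; rewrite /= lee_fin normrM [leRHS]ger0_norm ?addr_ge0 ?sqr_ge0//.
rewrite -(real_normK (num_real (f x))) -(real_normK (num_real (g x))).
nra.
Qed.

Lemma le_sqint (f g : T -> R) : sqint g -> measurable_fun D f ->
  (forall x, D x -> `|f x| <= `|g x|) -> sqint f.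
Proof.
move=> [mg Ig] mf fg; split => //.
apply: (le_integrable mD _ _ Ig).
  by apply/measurable_EFinP; exact: measurable_funX.
move=> x Dx; rewrite /= lee_fin !normrX lerXn2r ?nnegrE//; exact: fg.
Qed.

Lemma eq_sqint (f g : T -> R) : (forall x, D x -> f x = g x) -> sqint f -> sqint g.
Proof.
move=> fg sf; apply: (le_sqint sf); last by move=> x /fg ->.
by case: sf => + _; apply: eq_measurable_fun => x /set_mem; exact: fg.
Qed.

Lemma sqintD (f g : T -> R) : sqint f -> sqint g -> sqint (fun x => f x + g x).
Proof.
move=> sf sg; have [mf If] := sf; have [mg Ig] := sg.
split; first exact: measurable_funD.
have I2 := integrableZl mD 2 (integrableD mD If Ig).
apply: (le_integrable mD _ _ I2).
  by apply/measurable_EFinP; apply: measurable_funX; exact: measurable_funD.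
move=> x _; rewrite /= lee_fin [leLHS]ger0_norm ?sqr_ge0//.
rewrite [leRHS]ger0_norm ?mulr_ge0 ?addr_ge0 ?sqr_ge0//.
have := sqr_ge0 (f x - g x); nra.
Qed.

Lemma sqintZ (f : T -> R) c : sqint f -> sqint (fun x => c * f x).
Proof.
move=> [mf If]; split; first exact: measurable_funM.
apply: (eq_integrable mD _ _ _ (integrableZl mD (c ^+ 2) If)) => x _.
by rewrite -EFinM exprMn.
Qed.

Lemma sqintN (f : T -> R) : sqint f -> sqint (fun x => - f x).
Proof. by move=> /(sqintZ (-1)); apply: eq_sqint => x _; rewrite mulN1r. Qed.

Lemma sqintB (f g : T -> R) : sqint f -> sqint g -> sqint (fun x => f x - g x).
Proof. by move=> sf /sqintN; exact: sqintD. Qed.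

Lemma bounded_sqint (f : T -> R) M : (mu D < +oo)%E -> measurable_fun D f ->
  (forall x, D x -> `|f x| <= M) -> sqint f.
Proof.
move=> Dfin mf fM; split => //.
have If : mu.-integrable D (cst (M ^+ 2)%:E).
  apply/integrableP; split => //.
  under eq_integral do rewrite gee0_abs ?lee_fin ?sqr_ge0//.
  by rewrite integral_cst// lte_mul_pinfty ?lee_fin ?sqr_ge0.
apply: (le_integrable mD _ _ If).
  by apply/measurable_EFinP; exact: measurable_funX.
move=> x Dx; rewrite /= lee_fin !normrX lerXn2r ?nnegrE//.
by rewrite (le_trans (fM x Dx))// ler_norm.
Qed.

End SquareIntegrable.

Section ComplexL2.
Context {R : realType} (l : R).

Local Notation mu := (@lebesgue_measure R).
Local Notation Omega := (`]0, l[%classic : set R).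
Local Notation cfun := (@cfun R).
Local Notation L2 := (@L2 R l).
Local Notation norm2 := (@norm2 R l).

Lemma reD (z w : R[i]) : complex.Re (z + w) = complex.Re z + complex.Re w.
Proof. by case: z w => [a b] [c d]. Qed.

Lemma imD (z w : R[i]) : complex.Im (z + w) = complex.Im z + complex.Im w.
Proof. by case: z w => [a b] [c d]. Qed.

Lemma reM (z w : R[i]) : complex.Re (z * w) =
  complex.Re z * complex.Re w - complex.Im z * complex.Im w.
Proof. by case: z w => [a b] [c d]. Qed.

Lemma imM (z w : R[i]) : complex.Im (z * w) =
  complex.Re z * complex.Im w + complex.Im z * complex.Re w.
Proof. by case: z w => [a b] [c d]. Qed.

Lemma complex_eqP (z w : R[i]) : complex.Re z = complex.Re w ->
  complex.Im z = complex.Im w -> z = w.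
Proof. by case: z w => [a b] [c d] /= -> ->. Qed.

Lemma measure_Omega_lty : (mu Omega < +oo)%E.
Proof. by rewrite lebesgue_measure_itv/=; case: ifP => _; rewrite ?ltry. Qed.

Lemma L2P (f : cfun) : L2 f <-> sqint mu Omega (reP f) /\ sqint mu Omega (imP f).
Proof.
split=> [[mr mi If]|[[mr Ir] [mi Ii]]].
  split; split => //.
    apply: le_integrable If => //.
      by apply/measurable_EFinP; exact: measurable_funX.
    move=> x _; rewrite /= lee_fin !ger0_norm ?sqr_ge0 ?addr_ge0 ?sqr_ge0//.
    by rewrite /sqmod lerDl sqr_ge0.
  apply: le_integrable If => //.
    by apply/measurable_EFinP; exact: measurable_funX.
  move=> x _; rewrite /= lee_fin !ger0_norm ?sqr_ge0 ?addr_ge0 ?sqr_ge0//.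
  by rewrite /sqmod lerDr sqr_ge0.
by split => //; exact: (integrableD _ Ir Ii).
Qed.

Lemma L2D (f g : cfun) : L2 f -> L2 g -> L2 (f + g).
Proof.
move=> /L2P[f1 f2] /L2P[g1 g2]; apply/L2P; split.
  apply: (eq_sqint _ _ (sqintD _ f1 g1)) => // x _; exact/esym/reD.
apply: (eq_sqint _ _ (sqintD _ f2 g2)) => // x _; exact/esym/imD.
Qed.

Lemma L2Z (c : R[i]) (f : cfun) : L2 f -> L2 (c *: f).
Proof.
move=> /L2P[f1 f2]; apply/L2P; split.
  apply: (eq_sqint _ _ (sqintB _ (sqintZ _ (complex.Re c) f1)
    (sqintZ _ (complex.Im c) f2))) => // x _; exact/esym/reM.
apply: (eq_sqint _ _ (sqintD _ (sqintZ _ (complex.Re c) f2)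
  (sqintZ _ (complex.Im c) f1))) => // x _; exact/esym/imM.
Qed.

Lemma L20 : L2 (0 : cfun).
Proof.
have s0 : sqint mu Omega (cst 0).
  apply: (@bounded_sqint _ _ _ _ _ _ _ 0) => //.
    exact: measure_Omega_lty.
  by move=> x _; rewrite normr0.
by apply/L2P; split.
Qed.

Lemma L2N (f : cfun) : L2 f -> L2 (- f).
Proof. by rewrite -scaleN1r; exact: L2Z. Qed.

Lemma L2B (f g : cfun) : L2 f -> L2 g -> L2 (f - g).
Proof. by move=> Lf /L2N; exact: L2D. Qed.

Lemma L2_sum (I : Type) (r : seq I) (P : pred I) (F : I -> cfun) :
  (forall i, L2 (F i)) -> L2 (\sum_(i <- r | P i) F i).
Proof. by move=> LF; elim/big_ind: _ => //; [exact: L20|exact: L2D]. Qed.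

Definition real_inner (f g : cfun) : R :=
  \int[mu]_(x in Omega) (reP f x * reP g x + imP f x * imP g x).
Local Notation rip := real_inner.

Lemma rip_integrable (f g : cfun) : L2 f -> L2 g ->
  mu.-integrable Omega (EFin \o (fun x => reP f x * reP g x + imP f x * imP g x)).
Proof.
move=> /L2P[f1 f2] /L2P[g1 g2].
exact: (integrableD _ (sqint_mul_integrable _ f1 g1)
  (sqint_mul_integrable _ f2 g2)).
Qed.

Lemma ripC (f g : cfun) : rip f g = rip g f.
Proof. by apply: eq_Rintegral => x _; rewrite mulrC [X in _ + X]mulrC. Qed.

Lemma ripDl (f g h : cfun) : L2 f -> L2 g -> L2 h ->
  rip (f + g) h = rip f h + rip g h.
Proof.
move=> Lf Lg Lh; rewrite -RintegralD//; [|exact: rip_integrable..].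
by apply: eq_Rintegral => x _; rewrite /reP /imP reD imD; ring.
Qed.

Lemma ripZl (c : R) (f h : cfun) : L2 f -> L2 h ->
  rip (c%:C *: f) h = c * rip f h.
Proof.
move=> Lf Lh; rewrite -RintegralZl//; last exact: rip_integrable.
by apply: eq_Rintegral => x _; rewrite /reP /imP reM imM /=; ring.
Qed.

Lemma ripDr (f g h : cfun) : L2 f -> L2 g -> L2 h ->
  rip f (g + h) = rip f g + rip f h.
Proof. by move=> Lf Lg Lh; rewrite ripC ripDl// ![rip _ f]ripC. Qed.

Lemma ripZr (c : R) (f h : cfun) : L2 f -> L2 h ->
  rip f (c%:C *: h) = c * rip f h.
Proof. by move=> Lf Lh; rewrite ripC ripZl// ripC. Qed.

Lemma ripNl (f h : cfun) : L2 f -> L2 h -> rip (- f) h = - rip f h.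
Proof.
move=> Lf Lh; rewrite -(mulN1r (rip f h)) -ripZl//; congr (rip _ _).
by rewrite -scaleN1r; congr (_ *: _); apply: complex_eqP; rewrite //= oppr0.
Qed.

Lemma ripNr (f h : cfun) : L2 f -> L2 h -> rip f (- h) = - rip f h.
Proof. by move=> Lf Lh; rewrite ripC ripNl// ripC. Qed.

Lemma ripBl (f g h : cfun) : L2 f -> L2 g -> L2 h ->
  rip (f - g) h = rip f h - rip g h.
Proof. by move=> Lf Lg Lh; rewrite ripDl ?ripNl//; exact: L2N. Qed.

Lemma ripBr (f g h : cfun) : L2 f -> L2 g -> L2 h ->
  rip f (g - h) = rip f g - rip f h.
Proof. by move=> Lf Lg Lh; rewrite ripDr ?ripNr//; exact: L2N. Qed.

Lemma ripBB (f g h k : cfun) : L2 f -> L2 g -> L2 h -> L2 k ->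
  rip (f - g) (h - k) = rip f h - rip f k - rip g h + rip g k.
Proof.
move=> Lf Lg Lh Lk; rewrite (ripBl Lf Lg (L2B Lh Lk)) (ripBr Lf Lh Lk) (ripBr Lg Lh Lk).
by rewrite opprB addrA addrAC.
Qed.

Lemma rip0l (f : cfun) : rip 0 f = 0.
Proof.
rewrite /rip; under eq_Rintegral do rewrite !mul0r addr0.
by rewrite Rintegral_cst// mul0r.
Qed.

Lemma rip_suml (I : Type) (r : seq I) (F : I -> cfun) (h : cfun) :
  (forall i, L2 (F i)) -> L2 h ->
  rip (\sum_(i <- r) F i) h = \sum_(i <- r) rip (F i) h.
Proof.
move=> LF Lh; elim: r => [|i r IH]; first by rewrite !big_nil rip0l.
by rewrite !big_cons ripDl// ?IH//; exact: L2_sum.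
Qed.

Lemma rip_ge0 (f : cfun) : 0 <= rip f f.
Proof. by apply: Rintegral_ge0 => x _; rewrite -!expr2 addr_ge0 ?sqr_ge0. Qed.

Lemma rip_le_sub (f g : cfun) : L2 f -> L2 g ->
  rip f f <= 2 * rip (f - g) (f - g) + 2 * rip g g.
Proof.
move=> Lf Lg; have Lfg := L2B Lf Lg; have := rip_ge0 (f - g - g).
rewrite (ripBB Lfg Lg Lfg Lg) (ripC g (f - g)) (ripBl Lf Lg Lg) (ripBB Lf Lg Lf Lg).
by rewrite (ripC g f); lra.
Qed.

Lemma ripB_le (f g : cfun) : L2 f -> L2 g ->
  rip (f - g) (f - g) <= 2 * rip f f + 2 * rip g g.
Proof.
move=> Lf Lg; have := rip_ge0 (f + g).
rewrite (ripDl Lf Lg (L2D Lf Lg)) (ripDr Lf Lf Lg) (ripDr Lg Lf Lg) (ripBB Lf Lg Lf Lg).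
by rewrite (ripC g f); lra.
Qed.

Lemma norm2E (f : cfun) : norm2 f = Num.sqrt (rip f f).
Proof. by congr Num.sqrt; apply: eq_Rintegral => x _; rewrite /sqmod !expr2. Qed.

Lemma norm2_ge0 (f : cfun) : 0 <= norm2 f.
Proof. by rewrite norm2E sqrtr_ge0. Qed.

Lemma norm2_sqr (f : cfun) : norm2 f ^+ 2 = rip f f.
Proof. by rewrite norm2E sqr_sqrtr// rip_ge0. Qed.

Lemma rip_le (f g : cfun) : L2 f -> L2 g -> rip f g <= norm2 f * norm2 g.
Proof.
move=> Lf Lg; rewrite !norm2E; apply: discriminant_le => t.
have Ltg := L2Z t%:C Lg; have := rip_ge0 (f + t%:C *: g).
rewrite (ripDl Lf Ltg (L2D Lf Ltg)) (ripDr Lf Lf Ltg) (ripDr Ltg Lf Ltg).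
rewrite !ripZl// !ripZr// (ripC g f).
by congr (0 <= _); ring.
Qed.

Lemma normr_rip_le (f g : cfun) : L2 f -> L2 g ->
  `|rip f g| <= norm2 f * norm2 g.
Proof.
move=> Lf Lg; rewrite ler_norml rip_le// andbT lerNl -ripNl//.
apply: le_trans (rip_le (L2N Lf) Lg) _.
by rewrite !norm2E ripNl ?ripNr ?opprK//; exact: L2N.
Qed.

Lemma norm2Z (c : R) (f : cfun) : L2 f -> norm2 (c%:C *: f) = `|c| * norm2 f.
Proof.
move=> Lf; have Lcf := L2Z c%:C Lf.
by rewrite !norm2E ripZl// ripZr// mulrA -expr2 sqrtrM ?sqr_ge0// sqrtr_sqr.
Qed.

Lemma norm2N (f : cfun) : L2 f -> norm2 (- f) = norm2 f.
Proof. by move=> Lf; rewrite !norm2E ripNl ?ripNr ?opprK//; exact: L2N. Qed.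

Lemma norm2D (f g : cfun) : L2 f -> L2 g -> norm2 (f + g) <= norm2 f + norm2 g.
Proof.
move=> Lf Lg; rewrite -ler_sqr ?nnegrE ?addr_ge0 ?norm2_ge0//.
rewrite norm2_sqr ripDl ?ripDr//; try exact: L2D.
rewrite sqrrD !norm2_sqr (ripC g f).
have := rip_le Lf Lg; lra.
Qed.

(** Since <f, i g> = - i <f, g>, the imaginary part of the complex product is a real product against
    [i g]. Complex identities thus reduce to real ones tested on [g] and [i g]. *)
Lemma innerE (f g : cfun) : inner l f g = (rip f g +i* rip f ('i%C *: g))%C.
Proof.
apply: complex_eqP => /=; apply: eq_Rintegral => x _.
  by rewrite /reP /imP reM /=; case: (g x) => a b /=; ring.
by rewrite /reP /imP imM !reM !imM /=; case: (g x) => a b /=; ring.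
Qed.

Lemma rip_aeeq (f f' g : cfun) : L2 f -> L2 f' -> L2 g -> aeeq l f f' ->
  rip f g = rip f' g.
Proof.
move=> Lf Lf' Lg ff'; congr fine; apply: ae_eq_integral => //.
- by have /integrableP[] := rip_integrable Lf Lg.
- by have /integrableP[] := rip_integrable Lf' Lg.
- case: ff' => N [mN N0 subN]; exists N; split=> // x nx; apply: subN => /= fx.
  by apply: nx => Ox; rewrite /reP /imP fx.
Qed.

End ComplexL2.

(** * Completeness of the sine system *)

Section SquareClosure.
Context d (T : measurableType d) (R : realType).
Variables (mu : {measure set T -> \bar R}) (D : set T).
Hypothesis mD : measurable D.
Variable S : (T -> R) -> Prop.
Hypothesis S_sqint : forall f, S f -> sqint mu D f.
Hypothesis SD : forall f g, S f -> S g -> S (fun x => f x + g x).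
Hypothesis SZ : forall c f, S f -> S (fun x => c * f x).

Definition sqclosure (f : T -> R) : Prop := sqint mu D f /\
  forall e : R, 0 < e -> exists p, S p /\ \int[mu]_(x in D) ((f x - p x) ^+ 2) < e.

Lemma sub_sqclosure f : S f -> sqclosure f.
Proof.
move=> Sf; split=> [|e e0]; first exact: S_sqint.
exists f; split => //.
by under eq_Rintegral do rewrite subrr expr0n/=; rewrite Rintegral_cst// mul0r.
Qed.

(** A triangle inequality for squared distances, from (a + b)^2 <= 2 (a^2 + b^2). It avoids square
    roots and explains the tolerances [e / 4] used below. *)
Lemma sqint_dist_le (f g h : T -> R) :
  sqint mu D f -> sqint mu D g -> sqint mu D h ->
  \int[mu]_(x in D) ((f x - h x) ^+ 2) <=
  2 * (\int[mu]_(x in D) ((f x - g x) ^+ 2) +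
       \int[mu]_(x in D) ((g x - h x) ^+ 2)).
Proof.
move=> sf sg sh.
have [_ Ifg] := sqintB mD sf sg; have [_ Igh] := sqintB mD sg sh.
have [_ Ifh] := sqintB mD sf sh.
rewrite -RintegralD// -RintegralZl//; last exact: (integrableD mD Ifg Igh).
apply: le_Rintegral => //.
  exact: (integrableZl mD 2 (integrableD mD Ifg Igh)).
move=> x _; have := sqr_ge0 ((f x - g x) - (g x - h x)); nra.
Qed.

Lemma sqclosure_closed f : sqint mu D f ->
  (forall e : R, 0 < e -> exists g, sqclosure g /\
    \int[mu]_(x in D) ((f x - g x) ^+ 2) < e) -> sqclosure f.
Proof.
move=> sf H; split => // e e0.
have e4 : 0 < e / 4 by rewrite divr_gt0.
have [g [[sg Hg] fg]] := H _ e4; have [p [Sp gp]] := Hg _ e4.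
exists p; split => //.
apply: le_lt_trans (sqint_dist_le sf sg (S_sqint Sp)) _.
lra.
Qed.

Lemma eq_sqclosure f g : (forall x, D x -> f x = g x) -> sqclosure f -> sqclosure g.
Proof.
move=> fg [sf Hf]; split=> [|e /Hf[p [Sp fp]]]; first exact: (eq_sqint mD fg).
exists p; split => //; rewrite (@eq_Rintegral _ _ _ mu D (fun x => (f x - p x) ^+ 2))//.
by move=> x /set_mem Dx; rewrite fg.
Qed.

Lemma sqclosureZ c f : sqclosure f -> sqclosure (fun x => c * f x).
Proof.
move=> [sf Hf]; split=> [|e e0]; first exact: sqintZ.
have c0 : 0 < c ^+ 2 + 1 by rewrite ltr_wpDl ?sqr_ge0.
have [p [Sp fp]] := Hf (e / (c ^+ 2 + 1)) (divr_gt0 e0 c0).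
exists (fun x => c * p x); split; first exact: SZ.
have [_ I] := sqintB mD sf (S_sqint Sp).
under eq_Rintegral do rewrite -mulrBr exprMn.
rewrite RintegralZl//.
rewrite ltr_pdivlMr// in fp; apply: le_lt_trans fp.
rewrite mulrC ler_wpM2l ?lerDl//.
by apply: Rintegral_ge0 => x _; exact: sqr_ge0.
Qed.

Lemma sqclosureD f g : sqclosure f -> sqclosure g ->
  sqclosure (fun x => f x + g x).
Proof.
move=> [sf Hf] [sg Hg]; split=> [|e e0]; first exact: sqintD.
have e4 : 0 < e / 4 by rewrite divr_gt0.
have [p [Sp fp]] := Hf _ e4; have [q [Sq gq]] := Hg _ e4.
exists (fun x => p x + q x); split; first exact: SD.
have sp := S_sqint Sp; have sq := S_sqint Sq.
apply: (le_lt_trans (sqint_dist_le (sqintD mD sf sg) (sqintD mD sp sg)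
  (sqintD mD sp sq))).
rewrite [X in 2 * (X + _)](_ : _ = \int[mu]_(x in D) ((f x - p x) ^+ 2)); last first.
  by apply: eq_Rintegral => x _; congr (_ ^+ 2); ring.
rewrite [X in 2 * (_ + X)](_ : _ = \int[mu]_(x in D) ((g x - q x) ^+ 2)).
  lra.
by apply: eq_Rintegral => x _; congr (_ ^+ 2); ring.
Qed.

(** The distance from [f] to [f_ n] is at most [2 |h|] pointwise, so [4 h^2] dominates its square
    and the convergence holds in L^2. *)
Lemma sqclosure_dominated (f_ : nat -> T -> R) (f h : T -> R) :
  (forall n, sqclosure (f_ n)) -> measurable_fun D f -> sqint mu D h ->
  (forall n x, D x -> `|f_ n x| <= `|h x|) ->
  (forall x, D x -> `|f x| <= `|h x|) ->
  {ae mu, forall x, D x -> f_ n x @[n --> \oo] --> f x} -> sqclosure f.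
Proof.
move=> Kf mf sh fh_ fh f_f; have sf := le_sqint mD sh mf fh.
apply: sqclosure_closed => // e e0.
have sd n : sqint mu D (fun x => f x - f_ n x) by apply: sqintB => //; case: (Kf n).
pose g n x := ((f x - f_ n x) ^+ 2)%:E.
have mg n : measurable_fun D (g n).
  by apply/measurable_EFinP; apply: measurable_funX; case: (sd n).
have cg : {ae mu, forall x, D x -> g n x @[n --> \oo] --> 0%E}.
  apply: filterS f_f => x fx Dx; apply: cvg_EFin; first exact: nearW.
  have -> : fine \o (fun n => g n x) = fun n => (f x - f_ n x) * (f x - f_ n x).
    by apply/funext => n; rewrite /= expr2.
  rewrite -[X in _ --> X](mulr0 (0:R)) -[X in X * _](subrr (f x)).
  rewrite -[X in _ * X](subrr (f x)).
  by apply: cvgM; (apply: cvgB; [exact: cvg_cst|exact: fx]).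
have Ih := integrableZl mD 4 (sh.2).
have gh : {ae mu, forall x n, D x -> (`|g n x| <= 4%:E * (h x ^+ 2)%:E)%E}.
  apply: aeW => x n Dx; rewrite /g lee_fin ger0_norm ?sqr_ge0//.
  have := fh _ Dx; have := fh_ n _ Dx.
  rewrite -(real_normK (num_real (h x))) => h1 h2.
  have := ler_normB (f x) (f_ n x) => h3.
  rewrite -(real_normK (num_real (f x - f_ n x))).
  have := normr_ge0 (f x - f_ n x); nra.
have [_ _] := dominated_convergence mD mg (measurable_cst 0%E) cg Ih gh.
rewrite integral0 => /fine_cvgP[_] /cvgrPdist_lt /(_ _ e0)[N _ HN].
exists (f_ N); split => //.
have := HN N (leqnn _); rewrite /= sub0r normrN /Rintegral.
exact: le_lt_trans (ler_norm _).
Qed.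

(** Such functions form an algebra stable under uniformly bounded almost everywhere limits. From one
    suitable function, indicators of its level sets are thus reached through explicit
    polynomials. *)
Definition multiplier (q : T -> R) : Prop :=
  [/\ measurable_fun D q, exists M, forall x, D x -> `|q x| <= M &
    forall f, sqclosure f -> sqclosure (fun x => q x * f x)].

Lemma eq_multiplier q r : (forall x, D x -> q x = r x) ->
  multiplier q -> multiplier r.
Proof.
move=> qr [mq [M qM] Kq]; split.
- by apply: eq_measurable_fun mq => x /set_mem; exact: qr.
- by exists M => x Dx; rewrite -qr//; exact: qM.
- by move=> f /Kq; apply: eq_sqclosure => x Dx; rewrite qr.
Qed.

Lemma multiplier_cst c : multiplier (cst c).
Proof. by split => //; [exists `|c| | move=> f; exact: sqclosureZ]. Qed.

Lemma multiplierD q r : multiplier q -> multiplier r ->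
  multiplier (fun x => q x + r x).
Proof.
move=> [mq [M qM] Kq] [mr [N rN] Kr]; split; first exact: measurable_funD.
  exists (M + N) => x Dx; apply: le_trans (ler_normD _ _) _.
  by rewrite lerD ?qM ?rN.
move=> f Kf; apply: (eq_sqclosure _ (sqclosureD (Kq _ Kf) (Kr _ Kf))) => x _.
by rewrite mulrDl.
Qed.

Lemma multiplierM q r : multiplier q -> multiplier r ->
  multiplier (fun x => q x * r x).
Proof.
move=> [mq [M qM] Kq] [mr [N rN] Kr]; split; first exact: measurable_funM.
  by exists (M * N) => x Dx; rewrite normrM ler_pM ?qM ?rN.
by move=> f Kf; apply: eq_sqclosure (Kq _ (Kr _ Kf)) => x _; rewrite mulrA.
Qed.

Lemma multiplierX q n : multiplier q -> multiplier (fun x => q x ^+ n).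
Proof.
move=> Mq; elim: n => [|n IH].
  by apply: eq_multiplier (multiplier_cst 1) => x _; rewrite expr0.
by apply: eq_multiplier (multiplierM Mq IH) => x _; rewrite exprS.
Qed.

Lemma multiplier_sum (I : Type) (s : seq I) (q : I -> T -> R) :
  (forall i, multiplier (q i)) -> multiplier (fun x => \sum_(i <- s) q i x).
Proof.
move=> Mq; elim: s => [|i s IH].
  by apply: eq_multiplier (multiplier_cst 0) => x _; rewrite big_nil.
by apply: eq_multiplier (multiplierD (Mq i) IH) => x _; rewrite big_cons.
Qed.

Lemma multiplier_lim (q_ : nat -> T -> R) (q : T -> R) M :
  (forall n, multiplier (q_ n)) -> measurable_fun D q ->
  (forall n x, D x -> `|q_ n x| <= M) -> (forall x, D x -> `|q x| <= M) ->
  {ae mu, forall x, D x -> q_ n x @[n --> \oo] --> q x} -> multiplier q.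
Proof.
move=> Mq mq qM_ qM q_q; split; [by []|by exists M|move=> f Kf].
have [[mf _] _] := Kf.
apply: (@sqclosure_dominated (fun n x => q_ n x * f x) _ (fun x => M * f x)).
- by move=> n; have [_ _] := Mq n; exact.
- exact: measurable_funM.
- by apply: sqintZ => //; case: Kf.
- move=> n x Dx; rewrite !normrM ler_wpM2r//.
  by rewrite (le_trans (qM_ n x Dx))// ler_norm.
- move=> x Dx; rewrite !normrM ler_wpM2r//.
  by rewrite (le_trans (qM x Dx))// ler_norm.
- by apply: filterS q_q => x H Dx; apply: cvgMl; exact: H.
Qed.

(* The polynomials (1 - x ^ n) ^ (2 ^ n) are bounded on [0, 1] and converge to
   the indicator of [x < 1/2] off the point 1/2. *)
Lemma cvg_step_polynomial (x : R) : 0 <= x <= 1 -> x != 2^-1 ->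
  (1 - x ^+ n) ^+ (2 ^ n) @[n --> \oo] --> ((x < 2^-1)%R%:R : R).
Proof.
move=> /andP[x0 x1] xh.
have xn0 n : 0 <= x ^+ n by rewrite exprn_ge0.
have xn1 n : x ^+ n <= 1 by rewrite exprn_ile1.
(* Bernoulli's inequality serves on both sides of 1/2: with [y = - x^n] it bounds the power below by
   [1 - (2 x)^n]; with [y = x^n] it gives [(1 + x^n)^(2^n) >= (2 x)^n], while the product of the two
   powers is at most 1. *)
have bern (y : R) m : -1 <= y -> 1 + m%:R * y <= (1 + y) ^+ m.
  move=> y1; elim: m => [|m IH]; first by rewrite mul0r addr0 expr0.
  rewrite exprS; have : (1 + y) * (1 + m%:R * y) <= (1 + y) * (1 + y) ^+ m.
    by rewrite ler_wpM2l//; lra.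
  apply: le_trans; rewrite -natr1.
  have : 0 <= m%:R * y ^+ 2 by rewrite mulr_ge0 ?sqr_ge0.
  nra.
have [xlt|xge] := ltP x 2^-1.
  apply: (@squeeze_cvgr _ _ _ _ (fun n => 1 - (2 * x) ^+ n) (cst 1)).
  - apply: nearW => n; apply/andP; split; last first.
      by rewrite exprn_ile1 ?subr_ge0// gerBl.
    apply: le_trans (bern (- x ^+ n) _ _); last by rewrite lerN2.
    by rewrite natrX exprMn mulrN.
  - rewrite -[X in _ --> X]subr0; apply: cvgB; first exact: cvg_cst.
    by apply: cvg_expr; rewrite ger0_norm ?mulr_ge0//; lra.
  - exact: cvg_cst.
have xgt : 2^-1 < x by rewrite lt_neqAle eq_sym xh.
have x20 : 0 < 2 * x by lra.
apply: (@squeeze_cvgr _ _ _ _ (cst 0) (fun n => ((2 * x)^-1) ^+ n)).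
- apply: nearW => n; apply/andP; split; first by rewrite exprn_ge0// subr_ge0.
  rewrite exprVn -[leRHS]mul1r ler_pdivlMr ?exprn_gt0//.
  have h0 : 0 <= (1 - x ^+ n) ^+ (2 ^ n) by rewrite exprn_ge0// subr_ge0.
  apply: (@le_trans _ _ ((1 - x ^+ n) ^+ (2 ^ n) * (1 + x ^+ n) ^+ (2 ^ n))).
    rewrite ler_wpM2l//; apply: le_trans (bern (x ^+ n) _ _).
      by rewrite natrX exprMn lerDr.
    by rewrite (le_trans _ (xn0 n))// oppr_le0.
  rewrite -exprMn; have -> : (1 - x ^+ n) * (1 + x ^+ n) = 1 - (x ^+ n) ^+ 2 by ring.
  by rewrite exprn_ile1 ?gerBl ?sqr_ge0// subr_ge0 expr_le1.
- exact: cvg_cst.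
- apply: cvg_expr; rewrite ger0_norm ?invr_ge0 ?(ltW x20)//.
  by rewrite invf_lt1//; lra.
Qed.

(** The step polynomials applied to [q] are multipliers bounded by 1, and they converge to the
    indicator of the set where [q < 1/2] wherever [q] differs from 1/2. *)
Lemma multiplier_half q A : multiplier q -> (forall x, D x -> 0 <= q x <= 1) ->
  measurable A -> {ae mu, forall x, D x -> q x != 2^-1} ->
  (forall x, D x -> q x != 2^-1 -> A x <-> q x < 2^-1) ->
  multiplier (\1_A).
Proof.
move=> Mq q01 mA qh Aq; have [mq _ _] := Mq.
apply: (@multiplier_lim (fun n x => (1 - q x ^+ n) ^+ (2 ^ n)) _ 1).
- move=> n; apply: multiplierX.
  apply: (@eq_multiplier (fun x => 1 + (-1) * q x ^+ n)).
    by move=> x _; rewrite mulN1r.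
  by apply: multiplierD (multiplier_cst 1) (multiplierM (multiplier_cst _) _);
    exact: multiplierX.
- exact: measurable_indic.
- move=> n x /q01/andP[q0 q1]; have qn0 : 0 <= q x ^+ n by rewrite exprn_ge0.
  have qn1 : q x ^+ n <= 1 by rewrite exprn_ile1.
  by rewrite normrX ger0_norm ?subr_ge0// exprn_ile1 ?subr_ge0 ?gerBl.
- by move=> x _; rewrite indicE; case: (_ \in _); rewrite /= ?normr1 ?normr0.
- apply: filterS qh => x qx Dx.
  have xA : (x \in A) = (q x < 2^-1).
    by apply/idP/idP => [/set_mem|qlt];
      [move/(Aq _ Dx (qx Dx))|apply/mem_set/(Aq _ Dx (qx Dx))].
  rewrite indicE xA.
  by apply: cvg_step_polynomial; [exact: q01|exact: qx].
Qed.

Lemma multiplier_indicC A : measurable A -> multiplier (\1_A) ->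
  multiplier (\1_(~` A)).
Proof.
move=> mA MA.
apply: (@eq_multiplier (fun x => 1 + (-1) * \1_A x)).
  by move=> x _; rewrite !indicE in_setC; case: (_ \in _); rewrite /=; ring.
by apply: multiplierD (multiplier_cst 1) (multiplierM (multiplier_cst _) MA).
Qed.

Lemma multiplier_indicI A B : multiplier (\1_A) -> multiplier (\1_B) ->
  multiplier (\1_(A `&` B)).
Proof.
move=> MA MB; apply: (eq_multiplier _ (multiplierM MA MB)) => x _.
by rewrite !indicE in_setI; case: (x \in A); case: (x \in B); rewrite /=; ring.
Qed.

Lemma multiplier_indic_bigcup (F : nat -> set T) :
  (forall n, measurable (F n)) -> (forall n, multiplier (\1_(F n))) ->
  multiplier (\1_(\bigcup_n F n)).
Proof.
move=> mF MF.
pose B n := \big[setU/set0]_(k < n) F k.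
have mB n : measurable (B n) by exact: bigsetU_measurable.
have MB n : multiplier (\1_(B n)).
  elim: n => [|n IH].
    by apply: eq_multiplier (multiplier_cst 0) => x _; rewrite /B big_ord0 indic0.
  rewrite /B big_ord_recr/= -/(B n) -(setCK (B n `|` F n)) setCU.
  apply: multiplier_indicC; first by apply: measurableI; exact: measurableC.
  by apply: multiplier_indicI; exact: multiplier_indicC.
apply: (@multiplier_lim (fun n => \1_(B n)) _ 1) => //.
- by apply: measurable_indic; exact: bigcup_measurable.
- by move=> n x _; rewrite indicE; case: (_ \in _); rewrite /= ?normr1 ?normr0.
- by move=> x _; rewrite indicE; case: (_ \in _); rewrite /= ?normr1 ?normr0.
apply: aeW => x _.
have [[k _ Fkx]|nF] := pselect ((\bigcup_n F n) x).
  apply: cvg_near_cst; exists k.+1 => // n /= kn.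
  rewrite !indicE !mem_set//; first by exists k.
  by rewrite /B -bigcup_mkord; exists k.
apply: cvg_near_cst; apply: nearW => n.
rewrite !indicE !memNset// => Bx; apply: nF.
by move: Bx; rewrite /B -bigcup_mkord => -[k _ Fkx]; exists k.
Qed.

(** Sets whose indicator is a multiplier are stable under complements and countable unions, so
    Dynkin's theorem needs only a generating family stable under intersection. *)
Lemma multiplier_sfun (G : set (set T)) : @measurable _ T = <<s G >> ->
  setI_closed G -> (forall A, G A -> multiplier (\1_A)) ->
  forall A, measurable A -> multiplier (\1_A).
Proof.
move=> GE GI MG A; rewrite GE.
apply: (dynkin_induction (G := G) (P := fun A => multiplier (\1_A))) => //.
- by apply: eq_multiplier (multiplier_cst 1) => x _; rewrite indicT.
- by move=> B mB; exact: multiplier_indicC.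
- by move=> F mF _; exact: multiplier_indic_bigcup.
Qed.

Import HBSimple HBNNSimple.

(** For [h >= 0], simple functions [s_n] increase to [h / w]; each [s_n w] lies in the closure
    because simple functions are multipliers, and [s_n w] tends to [h] below [h]. Positive and
    negative parts give the general case. *)
Lemma sqclosure_full (w f : T -> R) :
  (forall A, measurable A -> multiplier (\1_A)) ->
  sqclosure w -> (forall x, D x -> 0 < w x) -> sqint mu D f -> sqclosure f.
Proof.
move=> MA Kw w0.
have Msf (g : {nnsfun T >-> R}) : multiplier g.
  apply: (eq_multiplier _ (multiplier_sum _ _)) => [x _|i].
    by rewrite fimfunEord.
  by apply: multiplierM (multiplier_cst _) (MA _ _).
have Kge0 h : sqint mu D h -> (forall x, D x -> 0 <= h x) -> sqclosure h.
  move=> sh h0; have [mh _] := sh.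
  have mw : measurable_fun D w by case: Kw => -[].
  have mq : measurable_fun D (fun x => (h x / w x)%:E).
    apply/measurable_EFinP; apply: measurable_funM => //.
    apply: (eq_measurable_fun (fun x => w x `^ (-1))).
      by move=> x /set_mem Dx; rewrite powR_inv1// ltW// w0.
    exact: (measurableT_comp (measurable_powR _) mw).
  have q0 x : D x -> (0 <= (h x / w x)%:E)%E.
    by move=> Dx; rewrite lee_fin divr_ge0 ?h0// ltW ?w0.
  have le_q n x : D x -> nnsfun_approx mD mq n x * w x <= h x.
    move=> Dx; rewrite -ler_pdivlMr ?w0// -lee_fin nnsfun_approxE.
    exact: le_approx.
  apply: (@sqclosure_dominated (fun n x => nnsfun_approx mD mq n x * w x) _ h) => //.
  - by move=> n; have [_ _] := Msf (nnsfun_approx mD mq n); exact.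
  - move=> n x Dx; rewrite !ger0_norm ?h0 ?le_q//.
    by rewrite mulr_ge0 ?(ltW (w0 _ Dx))// fun_ge0.
  - apply: aeW => x Dx; have := cvg_nnsfun_approx mD mq q0 Dx.
    move/fine_cvgP => [_ cq].
    rewrite -[X in _ --> X](divfK (lt0r_neq0 (w0 _ Dx))).
    exact: cvgMl cq.
move=> sf; have [mf _] := sf.
have mp : measurable_fun D (fun x => Num.max (f x) 0) by exact: measurable_maxr.
have mn : measurable_fun D (fun x => Num.max (- f x) 0).
  by apply: measurable_maxr => //; exact: measurableT_comp mf.
have Kp : sqclosure (fun x => Num.max (f x) 0).
  apply: Kge0 => [|x _]; last by rewrite le_max lexx orbT.
  apply: le_sqint sf mp _ => // x _.
  by rewrite /Num.max; case: ltP => h; rewrite ?normr0.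
have Kn : sqclosure (fun x => Num.max (- f x) 0).
  apply: Kge0 => [|x _]; last by rewrite le_max lexx orbT.
  apply: le_sqint sf mn _ => // x _.
  by rewrite /Num.max; case: ltP => h; rewrite ?normr0 ?normrN.
apply: (eq_sqclosure _ (sqclosureD Kp (sqclosureZ (-1) Kn))) => x _.
have [h|h] := leP (f x) 0.
  by rewrite max_l ?oppr_ge0// mulrN mulN1r opprK add0r.
by rewrite max_r ?oppr_le0 ?ltW// mulr0 addr0.
Qed.

End SquareClosure.

(** * Density of sine polynomials in L^2(0,l) *)

Section SineCompleteness.
Context {R : realType} (l : R).
Hypothesis l0 : 0 < l.

Local Notation mu := (@lebesgue_measure R).
Local Notation Omega := (`]0, l[%classic : set R).

Lemma measurable_Omega : @measurable _ (measurableTypeR R) Omega.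
Proof. exact: measurable_itv. Qed.

(** A pair [(n, a)] carries the frequency [n + 1], as in [eigfun]. Repeated frequencies are allowed,
    so adding two sums is concatenating two lists. *)
Definition sine_sum (r : seq (nat * R)) (x : R) : R :=
  \sum_(i <- r) i.2 * sin (i.1.+1%:R * pi * x / l).

Definition sine_span (f : R -> R) : Prop := exists r, f = sine_sum r.

Lemma measurable_sin_scaled (c : R) : measurable_fun Omega (fun x => sin (c * x / l)).
Proof.
apply: (measurableT_comp (f := @sin R)).
  exact: continuous_measurable_fun (@continuous_sin R).
exact: measurable_funM.
Qed.

Lemma measurable_cos_scaled (c : R) : measurable_fun Omega (fun x => cos (c * x / l)).
Proof.
apply: (measurableT_comp (f := @cos R)).
  exact: continuous_measurable_fun (@continuous_cos R).
exact: measurable_funM.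
Qed.

Lemma sine_span_sqint f : sine_span f -> sqint mu Omega f.
Proof.
move=> [r ->]; elim: r => [|[n a] r IH].
  have -> : sine_sum [::] = cst 0.
    by apply/funext => x; rewrite /sine_sum big_nil.
  apply: (@bounded_sqint _ _ _ _ _ _ _ 0) => //.
    exact: measure_Omega_lty.
  by move=> x _; rewrite normr0.
have -> : sine_sum ((n, a) :: r) =
    fun x => a * sin (n.+1%:R * pi * x / l) + sine_sum r x.
  by apply/funext => x; rewrite /sine_sum big_cons.
apply: sqintD => //; apply: sqintZ => //.
apply: (@bounded_sqint _ _ _ _ _ _ _ 1) => //.
- exact: measure_Omega_lty.
- exact: measurable_sin_scaled.
- by move=> x _; exact: sin_max.
Qed.

Lemma sine_spanD f g : sine_span f -> sine_span g -> sine_span (fun x => f x + g x).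
Proof.
move=> [r ->] [s ->]; exists (r ++ s).
by apply/funext => x; rewrite /sine_sum big_cat.
Qed.

Lemma sine_spanZ c f : sine_span f -> sine_span (fun x => c * f x).
Proof.
move=> [r ->]; exists [seq (i.1, c * i.2) | i <- r].
apply/funext => x; rewrite /sine_sum big_map mulr_sumr.
by apply: eq_bigr => i _; rewrite mulrA.
Qed.

Lemma sine_span_sin n : sine_span (fun x => sin (n.+1%:R * pi * x / l)).
Proof.
by exists [:: (n, 1)]; apply/funext => x; rewrite /sine_sum big_seq1 mul1r.
Qed.

Lemma sin_cosM (a b : R) : cos b * sin a = 2^-1 * (sin (a + b) + sin (a - b)).
Proof. by rewrite sinD sinB; field. Qed.

(** By the product formula, multiplication by the cosine averages the two neighbouring frequencies.
    At the lowest frequency the lower neighbour is [sin 0 = 0], so the span is preserved. *)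
Lemma sine_span_cosM f : sine_span f -> sine_span (fun x => cos (pi * x / l) * f x).
Proof.
move=> [r ->]; elim: r => [|[n a] r IH].
  by exists [::]; apply/funext => x; rewrite /sine_sum big_nil mulr0.
have -> : (fun x => cos (pi * x / l) * sine_sum ((n, a) :: r) x) =
  (fun x => a * (cos (pi * x / l) * sin (n.+1%:R * pi * x / l)) +
     cos (pi * x / l) * sine_sum r x).
  by apply/funext => x; rewrite /sine_sum big_cons /=; ring.
apply: sine_spanD => //; apply: sine_spanZ.
have -> : (fun x => cos (pi * x / l) * sin (n.+1%:R * pi * x / l)) =
  (fun x => 2^-1 * (sin (n.+2%:R * pi * x / l) + sin (n%:R * pi * x / l))).
  apply/funext => x; rewrite sin_cosM; congr (_ * (sin _ + sin _)).
    by rewrite -[n.+2%:R]natr1; ring.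
  by rewrite -[n.+1%:R]natr1; ring.
apply: sine_spanZ; apply: sine_spanD; first exact: sine_span_sin.
case: n => [|n]; last exact: sine_span_sin.
by exists [::]; apply/funext => x; rewrite /sine_sum big_nil !mul0r sin0.
Qed.

Local Notation K := (sqclosure mu Omega sine_span).
Local Notation mult := (multiplier mu Omega sine_span).

Lemma sqclosure_cosM f : K f -> K (fun x => cos (pi * x / l) * f x).
Proof.
have mc : measurable_fun Omega (fun x => cos (pi * x / l)).
  exact: measurable_cos_scaled.
have sc g : sqint mu Omega g -> sqint mu Omega (fun x => cos (pi * x / l) * g x).
  move=> sg; have [mg _] := sg; apply: (le_sqint _ sg) => //.
    exact: measurable_funM.
  by move=> x _; rewrite normrM ler_piMl// cos_max.
move=> [sf Hf]; split=> [|e /Hf[p [Sp fp]]]; first exact: sc.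
exists (fun x => cos (pi * x / l) * p x); split; first exact: sine_span_cosM.
apply: le_lt_trans fp; have sp := sine_span_sqint Sp.
apply: le_Rintegral => //.
- by have [_] := sqintB measurable_Omega (sc _ sf) (sc _ sp); exact.
- by have [_] := sqintB measurable_Omega sf sp; exact.
- move=> x _; rewrite -mulrBr exprMn ler_piMl ?sqr_ge0//.
Qed.

Lemma multiplier_cos : mult (fun x => cos (pi * x / l)).
Proof.
split; [exact: measurable_cos_scaled| |exact: sqclosure_cosM].
by exists 1 => x _; exact: cos_max.
Qed.

Lemma scaled_itv x : Omega x -> pi * x / l \in `[0, pi].
Proof.
rewrite /= in_itv/= => /andP[x0 xl]; rewrite in_itv/=.
rewrite divr_ge0 ?mulr_ge0 ?pi_ge0 ?ltW//=.
by rewrite ltr_pdivrMr// ltr_pM2l ?pi_gt0.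
Qed.

(** The cosine is strictly decreasing on [[0, pi]], so inside the interval the ray is a sublevel set
    of the multiplier [cos (pi x / l)]; for [a] outside the interval the indicator is constant
    there. *)
Lemma multiplier_ray a : mult (\1_(`]a, +oo[%classic : set R)).
Proof.
have mO := measurable_Omega.
have cstP c : mult (cst c).
  exact: (multiplier_cst mO sine_span_sqint sine_spanZ).
have DP := multiplierD mO sine_span_sqint sine_spanD.
have MP q r : mult q -> mult r -> mult (fun x => q x * r x).
  exact: (multiplierM mO).
have [a0|a0] := leP a 0.
  apply: (eq_multiplier mO _ (cstP 1)) => x.
  rewrite /= in_itv/= => /andP[x0 _].
  by rewrite indicE mem_set//= in_itv/= andbT (le_lt_trans a0).
have [al|al] := leP l a.
  apply: (eq_multiplier mO _ (cstP 0)) => x.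
  rewrite /= in_itv/= => /andP[x0 xl].
  rewrite indicE memNset//= in_itv/= andbT; apply/negP; rewrite -leNgt.
  by rewrite (le_trans _ al)// ltW.
have Oa : Omega a by rewrite /= in_itv/= a0 al.
have cE x : Omega x -> (cos (pi * x / l) < cos (pi * a / l)) = (a < x).
  move=> Ox; rewrite ltr_cos; [|exact: scaled_itv..].
  by rewrite ltr_pM2r ?invr_gt0// ltr_pM2l ?pi_gt0.
(* The difference of cosines lies in [[-2, 2]]; this affine change puts [q] in [[0, 1]] with the
   threshold 1/2 attained only at [a]. *)
pose q x := 2^-1 + 4^-1 * (cos (pi * x / l) + - cos (pi * a / l)).
have Mq : mult q by exact: (DP _ _ (cstP _) (MP _ _ (cstP _) (DP _ _ multiplier_cos (cstP _)))).
have qE x : Omega x -> (q x < 2^-1) = (a < x).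
  move=> Ox; rewrite -cE// /q; apply/idP/idP; lra.
apply: (multiplier_half mO sine_span_sqint sine_spanD sine_spanZ Mq).
- move=> x _; have := cos_le1 (pi * x / l); have := cos_geN1 (pi * x / l).
  have := cos_le1 (pi * a / l); have := cos_geN1 (pi * a / l).
  rewrite /q; move=> *; lra.
- exact: measurable_itv.
- exists [set a]; split; [exact: measurable_set1|exact: lebesgue_measure_set1|].
  move=> x /= nx; apply: contrapT => xa; apply: nx => Ox.
  apply: contra_not_neq xa => qx.
  have : cos (pi * x / l) = cos (pi * a / l) by move: qx; rewrite /q; lra.
  move/(cos_inj (scaled_itv Ox) (scaled_itv Oa)).
  move/(congr1 (fun y => y * l / pi)).
  have pi0 : pi != 0 :> R by rewrite gt_eqF ?pi_gt0.
  have l0' : l != 0 by rewrite gt_eqF.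
  have e y : pi * y / l * l / pi = y by rewrite divfK// mulrAC mulfV// mul1r.
  by rewrite !e.
- by move=> x Ox _; rewrite qE//= in_itv/= andbT.
Qed.

Lemma sine_dense f : sqint mu Omega f ->
  forall e : R, 0 < e -> exists r : seq (nat * R),
    \int[mu]_(x in Omega) ((f x - sine_sum r x) ^+ 2) < e.
Proof.
move=> sf; suff [_ H] : K f by move=> e /H[_ [[r ->] ?]]; exists r.
have mO := measurable_Omega.
apply: (sqclosure_full mO sine_span_sqint sine_spanD sine_spanZ
  (w := fun x => sin (1%:R * pi * x / l))) => //.
- move=> A mA.
  apply: (multiplier_sfun mO sine_span_sqint sine_spanD sine_spanZ
    (RGenOInfty.measurableE R)) => //.
  + move=> _ _ [a ->] [b ->]; exists (Num.max a b).
    apply/seteqP; split=> x /=; rewrite !in_itv/= !andbT gt_max.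
      by move=> [-> ->].
    by move=> /andP[].
  + by move=> _ [a ->]; exact: multiplier_ray.
- exact: (sub_sqclosure mO sine_span_sqint (sine_span_sin 0)).
- move=> x; rewrite /= in_itv/= => /andP[x0 xl].
  rewrite mul1r sin_gt0_pi//; apply/andP; split.
    by rewrite divr_gt0// mulr_gt0// pi_gt0.
  by rewrite ltr_pdivrMr// ltr_pM2l ?pi_gt0.
Qed.

End SineCompleteness.

(** * Smooth functions and cutoffs *)

Section Smooth.
Context {R : realType}.
Implicit Types (f g : R -> R).

Lemma is_derive1_fun f f' : (forall x : R, is_derive x (1 : R) f (f' x)) ->
  (forall x, derivable f x 1) /\ f^`() = f'.
Proof.
move=> ff'; split=> [x|]; first exact: ex_derive.
by apply/funext => x; rewrite derive1E; exact: derive_val.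
Qed.

Lemma derivable_is_derive1 f x : derivable f x 1 -> is_derive x (1 : R) f (f^`() x).
Proof. by move=> /derivableP; rewrite derive1E. Qed.

Inductive fspan (G : (R -> R) -> Prop) : (R -> R) -> Prop :=
| fspan_gen f : G f -> fspan G f
| fspanD f g : fspan G f -> fspan G g -> fspan G (fun x => f x + g x)
| fspanZ c f : fspan G f -> fspan G (fun x => c * f x).

(** Smoothness concerns all iterated derivatives, so the induction must run over a whole family: it
    suffices that differentiating a generator stays in the span of the generators. *)
Lemma fspan_smooth (G : (R -> R) -> Prop) :
  (forall f, G f -> (forall x, derivable f x 1) /\ fspan G f^`()) ->
  forall f, fspan G f -> smooth f.
Proof.
move=> GP.
have step f : fspan G f -> (forall x, derivable f x 1) /\ fspan G f^`().
  elim=> {f} [f /GP//|f g _ [df Gf] _ [dg Gg]|c f _ [df Gf]].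
    have [|dfg ->] := @is_derive1_fun (fun x => f x + g x) (fun x => f^`() x + g^`() x).
      by move=> x; apply: is_deriveD; exact: derivable_is_derive1.
    by split => //; exact: fspanD.
  have [|dcf ->] := @is_derive1_fun (fun x => c * f x) (fun x => c * f^`() x).
    by move=> x; apply: (@is_deriveZ _ _ _ _ c); exact: derivable_is_derive1.
  by split => //; exact: fspanZ.
move=> f Gf n x; suff /step[] : fspan G (derive1n n f) by [].
by elim: n => [//|n /step[_]].
Qed.

Lemma smooth_derivable f x : smooth f -> derivable f x 1.
Proof. by move=> /(_ 0%N). Qed.

Lemma smooth_derive1 f : smooth f -> smooth f^`().
Proof. by move=> sf n x; rewrite -derive1Sn; exact: sf. Qed.

Lemma smooth_is_derive f x : smooth f -> is_derive x (1 : R) f (f^`() x).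
Proof. by move=> sf; apply/derivable_is_derive1/smooth_derivable. Qed.

Lemma smooth_continuous f : smooth f -> continuous f.
Proof.
move=> sf x; apply/differentiable_continuous/derivable1_diffP.
exact: smooth_derivable.
Qed.

Lemma smooth_lin c f g : smooth f -> smooth g -> smooth (fun x => c * f x + g x).
Proof.
move=> sf sg; apply: (@fspan_smooth (@smooth R)).
  move=> h sh; split=> [x|]; first exact: smooth_derivable.
  by apply: fspan_gen; exact: smooth_derive1.
by apply: fspanD; [apply: fspanZ|]; exact: fspan_gen.
Qed.

Lemma derive1_lin c f g : smooth f -> smooth g ->
  (fun x => c * f x + g x)^`() = (fun x => c * f^`() x + g^`() x).
Proof.
move=> sf sg; apply: (is_derive1_fun _).2 => x.
apply: is_deriveD; last exact: smooth_is_derive.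
by apply: (@is_deriveZ _ _ _ _ c); exact: smooth_is_derive.
Qed.

Lemma is_derive1M f g x : smooth f -> smooth g ->
  is_derive x (1 : R) (fun x => f x * g x) (f^`() x * g x + f x * g^`() x).
Proof.
move=> sf sg.
apply: (is_derive_eq (is_deriveM (smooth_is_derive x sf) (smooth_is_derive x sg))).
by rewrite /GRing.scale/=; ring.
Qed.

(** By the product rule, the family of all products of two smooth functions has its derivatives in
    its own span. *)
Lemma smoothM f g : smooth f -> smooth g -> smooth (fun x => f x * g x).
Proof.
move=> sf sg.
pose G := fun h => exists f g, [/\ smooth f, smooth g & h = fun x => f x * g x].
apply: (@fspan_smooth G); last by apply: fspan_gen; exists f, g.
move=> _ [{sf}f [{sg}g [sf sg ->]]].
have [d ->] := is_derive1_fun (fun x => is_derive1M x sf sg).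
split => //; apply: fspanD; apply: fspan_gen.
  exact: (ex_intro _ _ (ex_intro _ _ (And3 (smooth_derive1 sf) sg erefl))).
exact: (ex_intro _ _ (ex_intro _ _ (And3 sf (smooth_derive1 sg) erefl))).
Qed.

Lemma derive1_smoothM f g : smooth f -> smooth g ->
  (fun x => f x * g x)^`() = (fun x => f^`() x * g x + f x * g^`() x).
Proof. by move=> sf sg; apply: (is_derive1_fun _).2 => x; exact: is_derive1M. Qed.

Lemma is_derive1_affine f a b x : smooth f ->
  is_derive x (1 : R) (fun x => f (a * x + b)) (a * f^`() (a * x + b)).
Proof.
move=> sf; have da : is_derive x (1 : R) (fun x => a * x + b) a.
  have dx := @is_deriveZ _ _ _ _ a _ _ _ (is_derive_id x (1 : R)).
  apply: (is_derive_eq (is_deriveD dx (is_derive_cst b x 1))).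
  by rewrite addr0 /GRing.scale/= mulr1.
rewrite mulrC; apply: is_derive1_comp da; exact: smooth_is_derive.
Qed.

Lemma smooth_affine f a b : smooth f -> smooth (fun x => f (a * x + b)).
Proof.
move=> sf.
pose G := fun h => exists f, smooth f /\ h = fun x => f (a * x + b).
apply: (@fspan_smooth G); last by apply: fspan_gen; exists f.
move=> _ [{sf}f [sf ->]].
have [d ->] := is_derive1_fun (fun x => is_derive1_affine a b x sf).
split => //; apply: fspanZ; apply: fspan_gen.
exact: (ex_intro _ _ (conj (smooth_derive1 sf) erefl)).
Qed.

Lemma derive1_affine f a b : smooth f ->
  (fun x => f (a * x + b))^`() = (fun x => a * f^`() (a * x + b)).
Proof. by move=> sf; apply: (is_derive1_fun _).2 => x; exact: is_derive1_affine. Qed.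

Lemma derive1_sin : (@sin R)^`() = @cos R.
Proof. exact: (is_derive1_fun (@is_derive_sin R)).2. Qed.

Lemma derive1_cos : (@cos R)^`() = (fun x => - sin x).
Proof. exact: (is_derive1_fun (@is_derive_cos R)).2. Qed.

Lemma smooth_trig : smooth (@sin R) /\ smooth (@cos R).
Proof.
pose G := fun h => h = @sin R \/ h = @cos R.
have H : forall f, fspan G f -> smooth f.
  apply: fspan_smooth => f [] ->.
    split=> [x|]; first exact: derivable_sin.
    by rewrite derive1_sin; apply: fspan_gen; right.
  split=> [x|]; first exact: derivable_cos.
  rewrite derive1_cos (_ : (fun x => - sin x) = fun x => (-1) * sin x); last first.
    by apply/funext => x; rewrite mulN1r.
  by apply: fspanZ; apply: fspan_gen; left.
by split; apply: H; apply: fspan_gen; [left|right].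
Qed.

Lemma smooth_cst (c : R) : smooth (cst c).
Proof.
apply: (@fspan_smooth (fun h => exists c, h = cst c)).
  move=> _ [{}c ->]; split=> [x|]; first exact: derivable_cst.
  apply: fspan_gen; exists 0.
  by apply/funext => x; rewrite derive1_cst.
by apply: fspan_gen; exists c.
Qed.

(** The classical function [exp (- 1 / x)] extended by 0, times [x^(-k)]. The powers are included so
    that the family is stable under differentiation. *)
Definition flat (k : nat) (x : R) : R :=
  if x <= 0 then 0 else x^-1 ^+ k * expR (- x^-1).

(** At [y = 1 / x], the term [y^(k+2) / (k+2)!] of the exponential series bounds [exp y] below.
    Quadratic vanishing at 0 is what differentiability there requires. *)
Lemma flat_le k x : `|flat k x| <= k.+2`!%:R * x ^+ 2.
Proof.
rewrite /flat; case: (leP x 0) => [_|x0]; first by rewrite normr0 mulr_ge0 ?sqr_ge0.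
have y0 : 0 < x^-1 by rewrite invr_gt0.
rewrite ger0_norm ?mulr_ge0 ?exprn_ge0 ?expR_ge0 ?(ltW y0)//.
rewrite expRN ler_pdivrMr ?expR_gt0//.
have := expR_ge1Dxn k.+1 (ltW y0).
set F := k.+2`!%:R; have F0 : 0 < F by rewrite ltr0n fact_gt0.
move=> h; apply: (@le_trans _ _ (F * x ^+ 2 * (x^-1 ^+ k.+2 / F))).
  rewrite !exprS; move: (x^-1 ^+ k) => z; rewrite le_eqVlt; apply/orP; left.
  by apply/eqP; field; rewrite !gt_eqF.
rewrite ler_pM2l ?mulr_gt0 ?exprn_gt0//; apply: le_trans h.
by rewrite lerDr.
Qed.

Lemma is_derive_flat k (x : R) :
  is_derive x (1 : R) (flat k) (- k%:R * flat k.+1 x + flat k.+2 x).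
Proof.
have [x0|x0|x0] := ltgtP x 0.
- rewrite /flat (ltW x0) mulr0 addr0.
  apply: (near_eq_is_derive (f := cst 0)) => //.
    near=> y; rewrite ifT//; apply/ltW; near: y.
    exact: lt_nbhsl.
- rewrite [in X in is_derive _ _ _ X]/flat leNgt x0/=.
  have xn0 : x != 0 by rewrite gt_eqF.
  have dV : is_derive x (1 : R) (fun x : R => x^-1) (- x ^- 2).
    apply: (is_derive_eq (is_deriveV xn0 (is_derive_id x (1 : R)))).
    by rewrite /GRing.scale/= mulr1.
  have dE : is_derive x (1 : R) (fun x : R => expR (- x^-1)) (expR (- x^-1) * x ^- 2).
    have dN : is_derive x (1 : R) (fun x => - x^-1) (x ^- 2).
      by rewrite -[X in is_derive _ _ _ X]opprK; exact: is_deriveN.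
    exact: (is_derive1_comp (is_derive_expR _) dN).
  have dX := @is_deriveX _ _ _ k _ _ _ dV.
  have H : is_derive x (1 : R) (fun x => x^-1 ^+ k * expR (- x^-1))
      (- k%:R * (x^-1 ^+ k.+1 * expR (- x^-1)) + x^-1 ^+ k.+2 * expR (- x^-1)).
    have dXE := is_derive_eq (is_deriveM dX dE).
    rewrite exprfctE in dXE; apply: dXE.
    rewrite /GRing.scale/=; case: k {dX} => [|k].
      by rewrite !expr0 !mul0r; field.
    by rewrite -pred_Sn !exprS -natr1; field.
  apply: near_eq_is_derive H.
  near=> y; rewrite /flat leNgt ifF//; apply/negbF; near: y.
  exact: lt_nbhsr.
- subst x; rewrite /flat lexx mulr0 addr0.
  have d0 : h^-1 *: (flat k (h *: 1 + 0) - flat k 0) @[h --> 0^'] --> (0 : R).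
    apply/cvgr0Pnorm_lt => e e0.
    have F0 : 0 < k.+2`!%:R :> R by rewrite ltr0n fact_gt0.
    near=> h; have hn0 : h != 0 by near: h; exact: nbhs_dnbhs_neq.
    rewrite {2}/flat lexx subr0 addr0 /GRing.scale/= mulr1 normrM normfV.
    rewrite mulrC ltr_pdivrMr ?normr_gt0//.
    apply: le_lt_trans (flat_le k h) _.
    rewrite -(real_normK (num_real h)) expr2 mulrA ltr_pM2r ?normr_gt0//.
    rewrite mulrC -ltr_pdivlMr//.
    near: h; apply: dnbhs0_lt; exact: divr_gt0.
  apply: DeriveDef; first by apply/cvg_ex; exists 0; exact: d0.
  by apply: cvg_lim => //; exact: d0.
Unshelve. all: by end_near. Qed.

Lemma smooth_flat k : smooth (flat k).
Proof.
apply: (@fspan_smooth (fun h => exists k, h = flat k)); last first.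
  by apply: fspan_gen; exists k.
move=> _ [{}k ->]; have [d ->] := is_derive1_fun (is_derive_flat k).
split => //; apply: fspanD; last by apply: fspan_gen; exists k.+2.
by apply: fspanZ; apply: fspan_gen; exists k.+1.
Qed.

Lemma derive1_flat0 : (flat 0)^`() = flat 2.
Proof.
rewrite (is_derive1_fun (is_derive_flat 0)).2; apply/funext => x.
by rewrite oppr0 mul0r add0r.
Qed.

Lemma flat0_itv x : 0 <= flat 0 x <= 1.
Proof.
rewrite /flat; case: (leP x 0) => [_|x0]; first by rewrite lexx ler01.
by rewrite expr0 mul1r expR_ge0 expR_le1 oppr_le0 invr_ge0 ltW.
Qed.

(** With [x = m t - 1], this bounds [t] times the derivative of the cutoff [flat 0 (m t - 1)]
    uniformly in [m]: the slope of size [m] is compensated by the distance [t] to the endpoint. *)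
Lemma flat2_bound x : 0 <= (x + 1) * flat 2 x <= 3.
Proof.
rewrite /flat; case: (leP x 0) => [_|x0]; first by rewrite mulr0 lexx ler0n.
have y0 : 0 < x^-1 by rewrite invr_gt0.
have e0 := expR_gt0 x^-1.
rewrite expRN; apply/andP; split.
  by rewrite !mulr_ge0 ?exprn_ge0 ?invr_ge0 ?ltW// ltr_wpDr.
rewrite mulrA ler_pdivrMr//.
have -> : (x + 1) * x^-1 ^+ 2 = x^-1 + x^-1 ^+ 2 by field; rewrite gt_eqF.
have h1 := expR_ge1Dx x^-1; have := expR_ge1Dxn 1 (ltW y0).
rewrite (_ : 2`!%:R = 2)//; lra.
Qed.

Lemma cvgV_affine (a : R) : 0 < a -> (n%:R * a - 1)^-1 @[n --> \oo] --> (0 : R).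
Proof.
move=> a0; apply/cvgrPdist_lt => e e0; near=> n.
have n0 : e^-1 < n%:R * a - 1.
  rewrite ltrBrDr -ltr_pdivrMr//; near: n.
  exact: (cvgryPgt _).1 cvgr_idn _.
have p0 : 0 < n%:R * a - 1 by rewrite (lt_trans _ n0)// invr_gt0.
by rewrite sub0r normrN gtr0_norm ?invr_gt0// -[ltRHS]invrK ltf_pV2 ?posrE ?invr_gt0.
Unshelve. all: by end_near. Qed.

Lemma flat0_cvg1 (a : R) : 0 < a -> flat 0 (n%:R * a - 1) @[n --> \oo] --> (1 : R).
Proof.
move=> a0; apply: (@squeeze_cvgr _ _ _ _ (fun n => 1 - (n%:R * a - 1)^-1) (cst 1)).
- near=> n; have n0 : 0 < n%:R * a - 1.
    rewrite subr_gt0 -ltr_pdivrMr//; near: n.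
    exact: (cvgryPgt _).1 cvgr_idn _.
  have /andP[_ ->] := flat0_itv (n%:R * a - 1).
  by rewrite andbT /flat (leNgt _ 0) n0/= expr0 mul1r expR_ge1Dx.
- rewrite -[X in _ --> X]subr0; apply: cvgB; first exact: cvg_cst.
  exact: cvgV_affine.
- exact: cvg_cst.
Unshelve. all: by end_near. Qed.

Lemma flat2_cvg0 (a : R) : 0 < a ->
  (n%:R * a) * flat 2 (n%:R * a - 1) @[n --> \oo] --> (0 : R).
Proof.
move=> a0.
apply: (@squeeze_cvgr _ _ _ _ (cst 0)
  (fun n => (n%:R * a - 1)^-1 + (n%:R * a - 1)^-1 * (n%:R * a - 1)^-1)).
- near=> n; have n0 : 0 < n%:R * a - 1.
    rewrite subr_gt0 -ltr_pdivrMr//; near: n.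
    exact: (cvgryPgt _).1 cvgr_idn _.
  rewrite -[X in X * flat _ _](subrK 1); have /andP[-> _] := flat2_bound (n%:R * a - 1).
  move: (n%:R * a - 1) n0 => y y0; rewrite /flat (leNgt _ 0) y0/= mulrA.
  have -> : (y + 1) * y^-1 ^+ 2 = y^-1 + y^-1 * y^-1 by field; rewrite gt_eqF.
  rewrite ler_piMr ?addr_ge0 ?mulr_ge0 ?invr_ge0 ?(ltW y0)//.
  by rewrite expR_le1 oppr_le0 invr_ge0 ltW.
- exact: cvg_cst.
- rewrite -[X in _ --> X](addr0 0) -[X in _ + X](mulr0 0).
  by apply: cvgD; [|apply: cvgM]; exact: cvgV_affine.
Unshelve. all: by end_near. Qed.

End Smooth.

(** * Smooth functions on the interval and integration by parts *)

Section TestFunctions.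
Context {R : realType} (l : R).
Hypothesis l0 : 0 < l.

Local Notation mu := (@lebesgue_measure R).
Local Notation Omega := (`]0, l[%classic : set R).
Local Notation cfun := (@cfun R).
Local Notation L2 := (@L2 R l).
Local Notation norm2 := (@norm2 R l).
Local Notation rip := (@real_inner R l).

Lemma continuous_integrable_cc (f : R -> R) : continuous f ->
  mu.-integrable `[0, l] (fun x => (f x)%:E).
Proof.
move=> cf; apply: continuous_compact_integrable; first exact: segment_compact.
exact: continuous_subspaceT.
Qed.

Lemma continuous_integrable_oo (f : R -> R) : continuous f ->
  mu.-integrable Omega (fun x => (f x)%:E).
Proof.
move=> /continuous_integrable_cc; apply: integrableS.
- exact: measurable_itv.
- exact: measurable_itv.
- exact: subset_itvW.
Qed.

Lemma smooth_sqint (f : R -> R) : smooth f -> sqint mu Omega f.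
Proof.
move=> sf; split.
  apply: measurable_funS (continuous_measurable_fun (smooth_continuous sf)) => //.
exact: (continuous_integrable_oo (smooth_continuous (smoothM sf sf))).
Qed.

Lemma Rintegral_oo_cc (f : R -> R) : continuous f ->
  \int[mu]_(x in Omega) f x = \int[mu]_(x in `[0, l]) f x.
Proof.
move=> cf; have Icc := continuous_integrable_cc cf.
have m1 : @measurable _ (measurableTypeR R) `]0, l]%classic by exact: measurable_itv.
have m2 : @measurable _ (measurableTypeR R) `[0, l]%classic by exact: measurable_itv.
rewrite Rintegral_itv_bndo_bndc; last exact: continuous_integrable_oo.
rewrite Rintegral_itv_obnd_cbnd//.
by apply: (integrableS m2 m1 _ Icc); exact: subset_itv_oc_cc.
Qed.

Lemma smooth_integral_by_parts (f g : R -> R) : smooth f -> smooth g ->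
  f 0 * g 0 = 0 -> f l * g l = 0 ->
  \int[mu]_(x in Omega) (f^`() x * g x) = - \int[mu]_(x in Omega) (f x * g^`() x).
Proof.
move=> sf sg e0 el.
have sf' := smooth_derive1 sf; have sg' := smooth_derive1 sg.
rewrite !Rintegral_oo_cc; last 2 first.
- by apply: smooth_continuous; exact: smoothM.
- by apply: smooth_continuous; exact: smoothM.
have LR h : smooth h -> derivable_oo_LRcontinuous h 0 l.
  move=> sh; split=> [x _||]; first exact: smooth_derivable.
  - by apply: cvg_at_right_filter; exact: smooth_continuous.
  - by apply: cvg_at_left_filter; exact: smooth_continuous.
rewrite (@Rintegration_by_parts _ f g f^`() g^`() 0 l)//.
- by rewrite e0 el subrr sub0r opprK.
- exact/continuous_subspaceT/smooth_continuous.
- exact: LR.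
- exact/continuous_subspaceT/smooth_continuous.
- exact: LR.
Qed.

Definition csmooth (f : cfun) : Prop := smooth (reP f) /\ smooth (imP f).

Lemma csmooth_L2 f : csmooth f -> L2 f.
Proof. by move=> [sr si]; apply/L2P; split; exact: smooth_sqint. Qed.

Lemma csmooth_cderive f : csmooth f -> csmooth (cderive f).
Proof. by move=> [sr si]; split; exact: smooth_derive1. Qed.

Lemma reP_lin (c : R[i]) (f g : cfun) : reP (c *: f + g) =
  fun x => complex.Re c * reP f x + (- complex.Im c * imP f x + reP g x).
Proof. by apply/funext => x; rewrite /reP reD reM addrA mulNr. Qed.

Lemma imP_lin (c : R[i]) (f g : cfun) : imP (c *: f + g) =
  fun x => complex.Re c * imP f x + (complex.Im c * reP f x + imP g x).
Proof. by apply/funext => x; rewrite /imP imD imM addrA. Qed.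

Lemma csmooth_lin (c : R[i]) f g : csmooth f -> csmooth g -> csmooth (c *: f + g).
Proof.
move=> [fr fi] [gr gi]; split.
  rewrite reP_lin; exact: (smooth_lin fr (smooth_lin fi gr)).
rewrite imP_lin; exact: (smooth_lin fi (smooth_lin fr gi)).
Qed.

Lemma cderive_lin (c : R[i]) f g : csmooth f -> csmooth g ->
  cderive (c *: f + g) = c *: cderive f + cderive g.
Proof.
move=> [fr fi] [gr gi]; apply/funext => x; apply: complex_eqP.
  rewrite reD reM [LHS]/= reP_lin.
  rewrite (derive1_lin _ fr (smooth_lin fi gr)) (derive1_lin _ fi gr) /=.
  by rewrite mulNr addrA.
rewrite imD imM [LHS]/= imP_lin.
rewrite (derive1_lin _ fi (smooth_lin fr gi)) (derive1_lin _ fr gi) /=.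
by rewrite addrA.
Qed.

Lemma test_csmooth f : test_function l f -> csmooth f.
Proof. by case. Qed.

Lemma test_function_lin (c : R[i]) f g :
  test_function l f -> test_function l g -> test_function l (c *: f + g).
Proof.
move=> [fr fi [a [b [a0 bl f0]]]] [gr gi [a' [b' [a'0 b'l g0]]]].
have [sr si] := csmooth_lin c (conj fr fi) (conj gr gi).
split => //; exists (Num.min a a'), (Num.max b b'); split.
- by rewrite lt_min a0.
- by rewrite gt_max bl.
- move=> x H.
  have -> : (c *: f + g) x = c * f x + g x by [].
  rewrite f0 ?g0 ?mulr0 ?addr0//.
    by case: H; rewrite ?lt_min ?gt_max => /andP[]; [left|right].
  by case: H; rewrite ?lt_min ?gt_max => /andP[]; [left|right].
Qed.

Lemma test_function0 : test_function l (0 : cfun).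
Proof.
split; [exact: smooth_cst|exact: smooth_cst|exists (l / 2), (l / 2)].
by split=> //; [rewrite divr_gt0|rewrite ltr_pdivrMr// mulr_natr mulr2n ltrDl].
Qed.

Lemma rip_cderive f g : csmooth f -> test_function l g ->
  rip (cderive f) g = - rip f (cderive g).
Proof.
move=> [fr fi] [gr gi [a [b [a0 bl g0]]]].
have z0 : g 0 = 0 by apply: g0; left.
have zl : g l = 0 by apply: g0; right.
have s1 := smooth_derive1 fr; have s2 := smooth_derive1 fi.
have s3 := smooth_derive1 gr; have s4 := smooth_derive1 gi.
have IM h k : smooth h -> smooth k -> mu.-integrable Omega (EFin \o (fun x => h x * k x)).
  by move=> sh sk; apply/continuous_integrable_oo/smooth_continuous; exact: smoothM.
have mO := @measurable_Omega _ l.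
have e1 : rip (cderive f) g = \int[mu]_(x in Omega) ((reP f)^`() x * reP g x) +
  \int[mu]_(x in Omega) ((imP f)^`() x * imP g x).
  exact: (RintegralD mO (IM _ _ s1 gr) (IM _ _ s2 gi)).
have e2 : rip f (cderive g) = \int[mu]_(x in Omega) (reP f x * (reP g)^`() x) +
  \int[mu]_(x in Omega) (imP f x * (imP g)^`() x).
  exact: (RintegralD mO (IM _ _ fr s3) (IM _ _ fi s4)).
have [r0 rl] : reP g 0 = 0 /\ reP g l = 0 by rewrite /reP z0 zl.
have [i0 il] : imP g 0 = 0 /\ imP g l = 0 by rewrite /imP z0 zl.
rewrite e1 e2 (smooth_integral_by_parts fr gr); last 2 first.
- by rewrite r0 mulr0.
- by rewrite rl mulr0.
rewrite (smooth_integral_by_parts fi gi) ?opprD//.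
- by rewrite i0 mulr0.
- by rewrite il mulr0.
Qed.

(** The compact support of the approximations of [f] kills all boundary terms, so [h] may be nonzero
    at the endpoints. This freedom is used with [h] the derivative of an eigenfunction, a cosine. *)
Lemma H10_derivative_rip f g h : H10_derivative l f g -> csmooth h ->
  rip g h = - rip f (cderive h).
Proof.
move=> [Lf Lg H] sh; have Lh := csmooth_L2 sh.
have Lh' := csmooth_L2 (csmooth_cderive sh).
apply/eqP; rewrite -subr_eq0 opprK -normr_eq0 eq_le normr_ge0 andbT.
apply/ler_addgt0Pl => e e0; rewrite addr0.
set M := norm2 h + norm2 (cderive h) + 1.
have M0 : 0 < M by rewrite ltr_wpDl// addr_ge0// norm2_ge0.
have [eta [teta fe ge]] := H _ (divr_gt0 e0 M0).
have Le := csmooth_L2 (test_csmooth teta).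
have Le' := csmooth_L2 (csmooth_cderive (test_csmooth teta)).
have ibp : rip (cderive eta) h + rip eta (cderive h) = 0.
  by rewrite (ripC _ eta) (rip_cderive sh teta) (ripC _ h) subrr.
have -> : rip g h + rip f (cderive h) =
    rip (g - cderive eta) h + rip (f - eta) (cderive h).
  rewrite !ripBl//; lra.
apply: le_trans (ler_normD _ _) _.
have h1 := normr_rip_le (L2B Lg Le') Lh.
have h2 := normr_rip_le (L2B Lf Le) Lh'.
have n1 := norm2_ge0 l h; have n2 := norm2_ge0 l (cderive h).
have eM : e / M * M = e by rewrite divfK ?gt_eqF.
have h3 : norm2 (g - cderive eta) * norm2 h <= e / M * norm2 h.
  by rewrite ler_wpM2r// ltW.
have h4 : norm2 (f - eta) * norm2 (cderive h) <= e / M * norm2 (cderive h).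
  by rewrite ler_wpM2r// ltW.
have : 0 < e / M by exact: divr_gt0.
rewrite /M in eM *; nra.
Qed.

End TestFunctions.

Lemma smooth_lipschitz (R : realType) (f : R -> R) M x y :
  smooth f -> (forall z, `|f^`() z| <= M) -> `|f y - f x| <= M * `|y - x|.
Proof.
move=> sf fM; wlog xy : x y / x <= y => [H|].
  have [/H//|/ltW/H] := leP x y.
  by rewrite distrC [X in _ -> _ <= _ * X]distrC.
have [||c _ ->] := @MVT_segment _ f f^`() x y xy.
- by move=> z _; exact: smooth_is_derive.
- exact/continuous_subspaceT/smooth_continuous.
- by rewrite normrM ler_wpM2r.
Qed.

Lemma sin_natpi (R : realType) n : sin (n%:R * pi) = 0 :> R.
Proof.
elim: n => [|n IH]; first by rewrite mul0r sin0.
by rewrite -natr1 mulrDl mul1r sinDpi IH oppr0.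
Qed.

(** * The eigenfunctions belong to H^1_0(0,l) *)

Section EigenfunctionH10.
Context {R : realType} (l : R).
Hypothesis l0 : 0 < l.

Local Notation mu := (@lebesgue_measure R).
Local Notation Omega := (`]0, l[%classic : set R).
Local Notation cfun := (@cfun R).
Local Notation norm2 := (@norm2 R l).

Lemma bounded_cvg_sqr (D_ : nat -> R -> R) M :
  (forall m, measurable_fun Omega (D_ m)) ->
  (forall m x, Omega x -> `|D_ m x| <= M) ->
  (forall x, Omega x -> `|D_ m x| @[m --> \oo] --> (0 : R)) ->
  \int[mu]_(x in Omega) (D_ m x ^+ 2) @[m --> \oo] --> (0 : R).
Proof.
move=> mD DM D0.
have mO := @measurable_Omega _ l.
have mg m : measurable_fun Omega (fun x => (D_ m x ^+ 2)%:E).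
  by apply/measurable_EFinP; apply: measurable_funX.
have cg : {ae mu, forall x, Omega x -> (D_ m x ^+ 2)%:E @[m --> \oo] --> 0%E}.
  apply: aeW => x Ox; apply: cvg_EFin; first exact: nearW.
  have -> : fine \o (fun m => (D_ m x ^+ 2)%:E) = fun m => `|D_ m x| * `|D_ m x|.
    by apply/funext => m; rewrite /= -expr2 real_normK// num_real.
  by rewrite -[X in _ --> X](mulr0 (0:R)); apply: cvgM; exact: D0.
have sM : sqint mu Omega (cst M).
  apply: (@bounded_sqint _ _ _ _ _ mO _ `|M|) => //.
  exact: measure_Omega_lty.
have gh : {ae mu, forall x m, Omega x -> (`|(D_ m x ^+ 2)%:E| <= (M ^+ 2)%:E)%E}.
  apply: aeW => x m Ox; rewrite lee_fin normrX.
  by rewrite lerXn2r ?nnegrE ?DM// (le_trans _ (DM m x Ox)).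
have [_ _] := dominated_convergence mO mg (measurable_cst 0%E) cg sM.2 gh.
by rewrite integral0 => /fine_cvgP[].
Qed.

Lemma reP_real (f : R -> R) : reP (fun x => (f x)%:C) = f.
Proof. by []. Qed.

Lemma norm2_real (F : cfun) : (forall x, imP F x = 0) ->
  norm2 F = Num.sqrt (\int[mu]_(x in Omega) (reP F x ^+ 2)).
Proof.
move=> F0; congr Num.sqrt; apply: eq_Rintegral => x _.
by rewrite /sqmod -[complex.Im _]/(imP F x) F0 expr0n addr0.
Qed.

Variable n : nat.
Let C := n.+1%:R * pi / l.
Let a := Num.sqrt (2 / l).
(** The summand 0 gives the argument the affine shape of the lemmas on composition. *)
Let s x := a * sin (C * x + 0).
Let s' x := a * (C * cos (C * x + 0)).

Let C0 : 0 < C. Proof. by rewrite /C divr_gt0// mulr_gt0// pi_gt0. Qed.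
Let a0 : 0 <= a. Proof. exact: sqrtr_ge0. Qed.

Lemma eigfunE : eigfun l n = fun x => (s x)%:C.
Proof.
apply/funext => x; congr (_ * sin _)%:C.
by rewrite addr0 /C mulrAC.
Qed.

Let smooth_s : smooth s.
Proof.
have := smooth_lin (c := a) (smooth_affine (a := C) (b := 0) (smooth_trig (R := R)).1) (smooth_cst (c := 0)).
by rewrite (_ : (fun x => _) = s)//; apply/funext => x; rewrite addr0.
Qed.

Let derive1_s : s^`() = s'.
Proof.
have := derive1_lin a (smooth_affine (a := C) (b := 0) (smooth_trig (R := R)).1) (smooth_cst (c := 0)).
rewrite (_ : (fun x => _) = s); last by apply/funext => x; rewrite addr0.
move=> ->; apply/funext => x; rewrite derive1_cst addr0.
by rewrite (derive1_affine _ _ (smooth_trig (R := R)).1) derive1_sin.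
Qed.

Lemma csmooth_eigfun : csmooth (eigfun l n).
Proof. by rewrite eigfunE; split; [exact: smooth_s|exact: (smooth_cst (c := 0))]. Qed.

Lemma cderive_eigfun : cderive (eigfun l n) = fun x => (s' x)%:C.
Proof.
rewrite eigfunE; apply/funext => x; apply: complex_eqP => /=.
  by rewrite reP_real derive1_s.
by rewrite [X in derive1 X](_ : _ = cst 0) ?derive1_cst.
Qed.

Let s'_bound x : `|s' x| <= a * C.
Proof.
rewrite /s' normrM (ger0_norm a0) ler_wpM2l// normrM (gtr0_norm C0).
by rewrite ler_piMr ?(ltW C0)// cos_max.
Qed.

(** [s] vanishes at both ends and is Lipschitz with constant [a C]; the linear decay will compensate
    the steep slopes of the cutoffs. *)
Let s_bound x : Omega x -> `|s x| <= a * C * x /\ `|s x| <= a * C * (l - x).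
Proof.
rewrite /= in_itv/= => /andP[x0 xl].
have s'b z : `|s^`() z| <= a * C by rewrite derive1_s s'_bound.
have s0 : s 0 = 0 by rewrite /s mulr0 addr0 sin0 mulr0.
have sl : s l = 0.
  by rewrite /s addr0 /C divfK ?gt_eqF// sin_natpi mulr0.
split.
  have := smooth_lipschitz 0 x smooth_s s'b.
  by rewrite s0 !subr0 (gtr0_norm x0).
have := smooth_lipschitz l x smooth_s s'b.
by rewrite sl subr0 (distrC x l) (gtr0_norm (x := l - x)) ?subr_gt0.
Qed.

(** [A m] vanishes to the left of [1 / m] and its mirror image [B m] to the right of [l - 1 / m];
    both tend to 1 inside the interval. [A'] and [B'] are their derivatives. *)
Let A (m : nat) (x : R) := flat 0 (m%:R * x + (-1)).
Let B (m : nat) (x : R) := flat 0 (- m%:R * x + (m%:R * l - 1)).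
Let A' (m : nat) (x : R) := m%:R * flat 2 (m%:R * x + (-1)).
Let B' (m : nat) (x : R) := - m%:R * flat 2 (- m%:R * x + (m%:R * l - 1)).
Let eta m x := s x * (A m x * B m x).
Let eta' m x := s' x * (A m x * B m x) + s x * (A' m x * B m x + A m x * B' m x).

Let smooth_eta m : smooth (eta m).
Proof.
apply: (smoothM smooth_s); apply: smoothM.
  exact: (smooth_affine (@smooth_flat R 0)).
exact: (smooth_affine (@smooth_flat R 0)).
Qed.

Let derive1_eta m : (eta m)^`() = eta' m.
Proof.
have sA : smooth (A m) by exact: (smooth_affine (@smooth_flat R 0)).
have sB : smooth (B m) by exact: (smooth_affine (@smooth_flat R 0)).
rewrite (derive1_smoothM smooth_s (smoothM sA sB)) derive1_s.
rewrite (derive1_smoothM sA sB) (derive1_affine _ _ (@smooth_flat R 0)).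
by rewrite (derive1_affine _ _ (@smooth_flat R 0)) derive1_flat0.
Qed.

Let BE m x : - m%:R * x + (m%:R * l - 1) = m%:R * (l - x) - 1 :> R.
Proof. by ring. Qed.

Let eta_test m : (0 < m)%N -> test_function l (fun x => (eta m x)%:C).
Proof.
move=> m0; have m0' : 0 < m%:R :> R by rewrite ltr0n.
split; [exact: smooth_eta|exact: (smooth_cst (c := 0))|].
exists (m%:R^-1), (l - m%:R^-1); split.
- by rewrite invr_gt0.
- by rewrite ltrBlDr ltrDl invr_gt0.
- move=> x H; suff -> : eta m x = 0 by [].
  rewrite /eta; case: H => H.
    have : m%:R * x + -1 <= 0.
      rewrite subr_le0 -ler_pdivlMl// mulr1; exact: ltW.
    by rewrite /A /flat => ->; rewrite mul0r mulr0.
  have : - m%:R * x + (m%:R * l - 1) <= 0.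
    rewrite BE subr_le0 -ler_pdivlMl// mulr1 lerBlDl -lerBlDr; exact: ltW.
  by rewrite /B /flat => ->; rewrite !mulr0.
Qed.

Let AB01 m x : 0 <= A m x * B m x <= 1.
Proof.
have /andP[A0 A1] := flat0_itv (m%:R * x + (-1)).
have /andP[B0 B1] := flat0_itv (- m%:R * x + (m%:R * l - 1)).
by rewrite mulr_ge0//= -[leRHS]mulr1 ler_pM.
Qed.

Let xA' m x : 0 <= x * A' m x <= 3.
Proof.
have := flat2_bound (m%:R * x + (-1)).
by rewrite subrK /A' mulrCA mulrA.
Qed.

Let xB' m x : 0 <= (l - x) * - B' m x <= 3.
Proof.
have := flat2_bound (m%:R * (l - x) - 1).
by rewrite subrK /B' BE mulNr opprK mulrCA mulrA.
Qed.

Let sA'_le m x : Omega x -> `|s x * A' m x| <= a * C * (x * A' m x).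
Proof.
move=> Ox; have [h _] := s_bound Ox.
have x0 : 0 < x by move: Ox; rewrite /= in_itv => /andP[].
have A'0 : 0 <= A' m x.
  by have /andP[] := xA' m x; rewrite pmulr_rge0.
by rewrite normrM (ger0_norm A'0) (mulrA (a * C)) ler_wpM2r.
Qed.

Let sB'_le m x : Omega x -> `|s x * B' m x| <= a * C * ((l - x) * - B' m x).
Proof.
move=> Ox; have [_ h] := s_bound Ox.
have x0 : 0 < l - x by move: Ox; rewrite /= in_itv => /andP[_]; rewrite subr_gt0.
have B'0 : 0 <= - B' m x.
  by have /andP[] := xB' m x; rewrite pmulr_rge0.
by rewrite normrM -(normrN (B' _ _)) (ger0_norm B'0) (mulrA (a * C)) ler_wpM2r.
Qed.

Let AB_cvg x : Omega x -> A m x * B m x @[m --> \oo] --> (1 : R).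
Proof.
rewrite /= in_itv/= => /andP[x0 xl].
rewrite -[X in _ --> X](mulr1 1); apply: cvgM; first exact: flat0_cvg1.
rewrite (_ : (fun m => B m x) = fun m => flat 0 (m%:R * (l - x) - 1)).
  by apply: flat0_cvg1; rewrite subr_gt0.
by apply/funext => m; rewrite /B BE.
Qed.

Let xA'_cvg x : Omega x -> x * A' m x @[m --> \oo] --> (0 : R).
Proof.
rewrite /= in_itv/= => /andP[x0 xl].
rewrite (_ : (fun m => x * A' m x) = fun m => m%:R * x * flat 2 (m%:R * x - 1)).
  exact: flat2_cvg0.
by apply/funext => m; rewrite /A' mulrCA mulrA.
Qed.

Let xB'_cvg x : Omega x -> (l - x) * - B' m x @[m --> \oo] --> (0 : R).
Proof.
rewrite /= in_itv/= => /andP[x0 xl].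
rewrite (_ : (fun m => (l - x) * - B' m x) =
    fun m => m%:R * (l - x) * flat 2 (m%:R * (l - x) - 1)).
  by apply: flat2_cvg0; rewrite subr_gt0.
by apply/funext => m; rewrite /B' BE mulNr opprK mulrCA mulrA.
Qed.

Let E m x := a * C * (1 - A m x * B m x) +
  (a * C * (x * A' m x) + a * C * ((l - x) * - B' m x)).

Let diff_eta_le m x : Omega x -> `|s x - eta m x| <= a * (1 - A m x * B m x).
Proof.
move=> Ox; have /andP[h0 h1] := AB01 m x.
rewrite /eta -[X in X - _]mulr1 -mulrBr normrM (ger0_norm (x := 1 - _)) ?subr_ge0//.
rewrite ler_wpM2r ?subr_ge0// /s normrM (ger0_norm a0).
by rewrite ler_piMr// sin_max.
Qed.

Let diff_eta'_le m x : Omega x -> `|s' x - eta' m x| <= E m x.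
Proof.
move=> Ox; have /andP[h0 h1] := AB01 m x.
have -> : s' x - eta' m x = s' x * (1 - A m x * B m x) -
    (s x * A' m x * B m x + A m x * (s x * B' m x)) by rewrite /eta'; ring.
have /andP[A0 A1] : 0 <= A m x <= 1 := flat0_itv _.
have /andP[B0 B1] : 0 <= B m x <= 1 := flat0_itv _.
apply: le_trans (ler_normB _ _) _; apply: lerD.
  by rewrite normrM (ger0_norm (x := 1 - _)) ?subr_ge0// ler_wpM2r ?subr_ge0.
apply: le_trans (ler_normD _ _) _; apply: lerD.
  apply: le_trans (sA'_le m Ox); rewrite normrM (ger0_norm B0).
  by rewrite ler_piMr.
apply: le_trans (sB'_le m Ox); rewrite normrM (ger0_norm A0).
by rewrite ler_piMl.
Qed.

(** The truncations [eta m] are test functions. Where the cutoff is differentiated, the factor [s]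
    is bounded by a multiple of the distance to the endpoint, so the extra terms are bounded and
    tend to 0 pointwise; dominated convergence gives both L^2 limits. *)
Lemma H10_eigfun : H10_derivative l (eigfun l n) (cderive (eigfun l n)).
Proof.
have sL := csmooth_L2 l csmooth_eigfun.
split => //; first exact: (csmooth_L2 l (csmooth_cderive csmooth_eigfun)).
move=> e e0.
have mfs f : smooth f -> measurable_fun Omega f by move=> /(smooth_sqint l) [].
have c1 : \int[mu]_(x in Omega) ((s x - eta m x) ^+ 2) @[m --> \oo] --> (0 : R).
  apply: (@bounded_cvg_sqr _ a).
  - by move=> m; apply: measurable_funB; apply: mfs.
  - move=> m x Ox; apply: le_trans (diff_eta_le m Ox) _.
    by have /andP[h0 h1] := AB01 m x; rewrite ler_piMr// gerBl.
  - move=> x Ox.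
    apply: (@squeeze_cvgr _ _ _ _ (cst 0) (fun m => a * (1 - A m x * B m x))).
    + by apply: nearW => m; rewrite normr_ge0 diff_eta_le.
    + exact: cvg_cst.
    + rewrite -[X in _ --> X](mulr0 a) -[X in _ * X](subrr 1).
      by apply: cvgMr; apply: cvgB; [exact: cvg_cst|exact: AB_cvg].
have c2 : \int[mu]_(x in Omega) ((s' x - eta' m x) ^+ 2) @[m --> \oo] --> (0 : R).
  (* The bound of the envelope [E m]: one term from the truncation of [s'], and one factor 3 from
     the slope of each cutoff. *)
  apply: (@bounded_cvg_sqr _ (a * C + (a * C * 3 + a * C * 3))).
  - move=> m; apply: measurable_funB; apply: mfs.
      by rewrite -derive1_s; exact: smooth_derive1.
    by rewrite -derive1_eta; exact: smooth_derive1.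
  - move=> m x Ox; apply: le_trans (diff_eta'_le m Ox) _.
    have aC : 0 <= a * C by rewrite mulr_ge0// ltW.
    have /andP[h0 h1] := AB01 m x; apply: lerD.
      by rewrite ler_piMr// gerBl.
    apply: lerD; rewrite ler_wpM2l//.
      by have /andP[] := xA' m x.
    by have /andP[] := xB' m x.
  - move=> x Ox.
    apply: (@squeeze_cvgr _ _ _ _ (cst 0) (fun m => E m x)).
    + by apply: nearW => m; rewrite normr_ge0 diff_eta'_le.
    + exact: cvg_cst.
    + rewrite (_ : 0 = a * C * (1 - 1) + (a * C * 0 + a * C * 0)); last by ring.
      apply: cvgD; first by apply: cvgMr; apply: cvgB; [exact: cvg_cst|exact: AB_cvg].
      by apply: cvgD; apply: cvgMr; [exact: xA'_cvg|exact: xB'_cvg].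
have e2 : 0 < e ^+ 2 by rewrite exprn_gt0.
near \oo => m.
exists (fun x => (eta m x)%:C); split.
- by apply: eta_test; near: m; exact: nbhs_infty_gt.
- rewrite norm2_real; last by move=> x; rewrite eigfunE /imP imD /= subrr.
  rewrite -[ltRHS](gtr0_norm e0) -sqrtr_sqr ltr_sqrt//.
  rewrite [ltLHS](_ : _ = \int[mu]_(x in Omega) ((s x - eta m x) ^+ 2)); last first.
    by apply: eq_Rintegral => x _; rewrite eigfunE /reP reD.
  near: m; exact: cvgr_lt c1 _ e2.
- rewrite norm2_real; last first.
    move=> x; rewrite cderive_eigfun /imP imD /=.
    by rewrite [X in derive1 X](_ : _ = cst 0) ?derive1_cst ?subrr.
  rewrite -[ltRHS](gtr0_norm e0) -sqrtr_sqr ltr_sqrt//.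
  rewrite [ltLHS](_ : _ = \int[mu]_(x in Omega) ((s' x - eta' m x) ^+ 2)); last first.
    by apply: eq_Rintegral => x _; rewrite cderive_eigfun /reP reD /= reP_real derive1_eta.
  near: m; exact: cvgr_lt c2 _ e2.
Unshelve. all: by end_near. Qed.

End EigenfunctionH10.

(** * Parseval identities and fractional powers *)

Lemma reN (R : realType) (z : R[i]) : complex.Re (- z) = - complex.Re z.
Proof. by case: z. Qed.

Lemma imN (R : realType) (z : R[i]) : complex.Im (- z) = - complex.Im z.
Proof. by case: z. Qed.

Section Parseval.
Context {R : realType} (l : R).
Hypothesis l0 : 0 < l.

Local Notation cfun := (@cfun R).
Local Notation L2 := (@L2 R l).
Local Notation norm2 := (@norm2 R l).
Local Notation rip := (@real_inner R l).
Local Notation e_ := (@eigfun R l).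
Local Notation lam := (@eigval R l).

Definition imul (f : cfun) : cfun := 'i%C *: f.

Lemma L2_imul f : L2 f -> L2 (imul f).
Proof. exact: L2Z. Qed.

Lemma reP_imul f x : reP (imul f) x = - imP f x.
Proof. by rewrite /reP reM /= mul0r mul1r sub0r. Qed.

Lemma imP_imul f x : imP (imul f) x = reP f x.
Proof. by rewrite /imP imM /= mul0r mul1r add0r. Qed.

Lemma rip_imul_imul f g : rip (imul f) (imul g) = rip f g.
Proof.
apply: eq_Rintegral => x _; rewrite !reP_imul !imP_imul; ring.
Qed.

Lemma rip_imull f g : L2 f -> L2 g -> rip (imul f) g = - rip f (imul g).
Proof.
move=> Lf Lg; rewrite -ripNr//; last exact: L2_imul.
apply: eq_Rintegral => x _.
have -> : reP (- imul g) x = - reP (imul g) x by apply: (reN (imul g x)).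
have -> : imP (- imul g) x = - imP (imul g) x by apply: (imN (imul g x)).
rewrite !reP_imul !imP_imul; ring.
Qed.

Lemma rip_Zl (c : R[i]) f g : L2 f -> L2 g ->
  rip (c *: f) g = complex.Re c * rip f g + complex.Im c * rip (imul f) g.
Proof.
move=> Lf Lg; have Lif := L2_imul Lf.
rewrite -!ripZl// -ripDl//; [|exact: L2Z..].
congr (real_inner _ _ _); rewrite /imul scalerA -scalerDl; congr (_ *: _).
by apply: complex_eqP; rewrite ?reD ?imD ?reM ?imM /=; ring.
Qed.

Lemma eigval_gt0 n : 0 < lam n.
Proof. by rewrite exprn_gt0// divr_gt0// mulr_gt0// pi_gt0. Qed.

Lemma eigval_le n : lam 0 <= lam n.
Proof.
rewrite /eigval lerXn2r ?nnegrE ?divr_ge0 ?mulr_ge0 ?pi_ge0 ?(ltW l0)//.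
by rewrite !ler_wpM2r ?invr_ge0 ?pi_ge0 ?(ltW l0)// ler_nat.
Qed.

Lemma eigval_inj n m : lam n = lam m -> n = m.
Proof.
move=> /eqP; rewrite /eigval eqrXn2//; try by
  rewrite divr_ge0 ?mulr_ge0 ?pi_ge0 ?(ltW l0).
move=> /eqP /(congr1 (fun y => y * l / pi)).
rewrite !divfK ?gt_eqF// !mulfK ?gt_eqF ?pi_gt0// => /eqP.
by rewrite eqr_nat => /eqP [].
Qed.

Let C n : R := n.+1%:R * pi / l.

Lemma csmooth_e n : csmooth (e_ n). Proof. exact: csmooth_eigfun. Qed.
Lemma L2_e n : L2 (e_ n). Proof. exact: csmooth_L2 (csmooth_e n). Qed.
Lemma L2_de n : L2 (cderive (e_ n)).
Proof. exact: csmooth_L2 (csmooth_cderive (csmooth_e n)). Qed.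

Lemma cderive2_eigfun n : cderive (cderive (e_ n)) = (- lam n)%:C *: e_ n.
Proof.
rewrite cderive_eigfun eigfunE; apply/funext => x; apply: complex_eqP => /=.
  have sc : smooth (fun y => cos (C n * y + 0)).
    exact: (smooth_affine (smooth_trig (R := R)).2).
  have s0 := @smooth_cst R 0.
  have := derive1_lin (C n) sc s0.
  have := derive1_lin (Num.sqrt (2 / l)) (smooth_lin (c := C n) sc s0) s0.
  rewrite reP_real [X in derive1 X = _](_ : _ = (fun x => Num.sqrt (2 / l) *
      (C n * cos (C n * x + 0)))); last by apply/funext => y; rewrite !addr0.
  move=> -> ->; rewrite !derive1_cst.
  rewrite (derive1_affine _ _ (smooth_trig (R := R)).2) derive1_cos.
  by rewrite /eigval /C; ring.
rewrite mulr0 mul0r addr0.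
by rewrite [X in derive1 X](_ : _ = cst 0) ?derive1_cst.
Qed.

End Parseval.

(** * Calculus in H^1_0 and orthonormality of the eigenfunctions *)

Section H10.
Context {R : realType} (l : R).
Hypothesis l0 : 0 < l.

Local Notation cfun := (@cfun R).
Local Notation L2 := (@L2 R l).
Local Notation norm2 := (@norm2 R l).
Local Notation rip := (@real_inner R l).
Local Notation e_ := (@eigfun R l).
Local Notation lam := (@eigval R l).

Lemma norm2_lin (c : R[i]) f g : L2 f -> L2 g ->
  norm2 (c *: f + g) <= (`|complex.Re c| + `|complex.Im c|) * norm2 f + norm2 g.
Proof.
move=> Lf Lg; have Lif := L2_imul Lf.
have -> : c *: f = (complex.Re c)%:C *: f + (complex.Im c)%:C *: imul f.
  rewrite /imul scalerA -scalerDl; congr (_ *: _).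
  by apply: complex_eqP; rewrite ?reD ?imD ?reM ?imM /=; ring.
have n1 : norm2 (imul f) = norm2 f by rewrite !norm2E rip_imul_imul.
apply: le_trans (norm2D _ Lg) _; first by apply: L2D; exact: L2Z.
rewrite lerD2r; apply: le_trans (norm2D (L2Z _ Lf) (L2Z _ Lif)) _.
by rewrite !norm2Z// n1 mulrDl.
Qed.

Lemma H10_derivative_L2 f g : H10_derivative l f g -> L2 f /\ L2 g.
Proof. by case. Qed.

Lemma H10_L2 f : H10 l f -> L2 f.
Proof. by move=> [g] []. Qed.

Lemma test_H10 f : test_function l f -> H10_derivative l f (cderive f).
Proof.
move=> tf; have sf := test_csmooth tf.
split; [exact: csmooth_L2|exact: csmooth_L2 (csmooth_cderive sf)|].
have n0 : norm2 0 = 0 by rewrite norm2E rip0l sqrtr0.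
by move=> e e0; exists f; split => //; rewrite subrr n0.
Qed.

Lemma H10_derivative_lin (c : R[i]) f f' g g' :
  H10_derivative l f f' -> H10_derivative l g g' ->
  H10_derivative l (c *: f + g) (c *: f' + g').
Proof.
move=> [Lf Lf' Hf] [Lg Lg' Hg]; split; [by apply: L2D => //; exact: L2Z..|].
move=> e e0; set M := `|complex.Re c| + `|complex.Im c| + 1.
have M1 : 0 < M by rewrite ltr_wpDl// addr_ge0.
have [eta [te h1 h2]] := Hf _ (divr_gt0 (divr_gt0 e0 (ltr0Sn R 1)) M1).
have [zet [tz k1 k2]] := Hg _ (divr_gt0 e0 (ltr0Sn R 1)).
have se := test_csmooth te; have sz := test_csmooth tz.
have Le := csmooth_L2 l se; have Lz := csmooth_L2 l sz.
have Le' := csmooth_L2 l (csmooth_cderive se).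
have Lz' := csmooth_L2 l (csmooth_cderive sz).
have key u v u' v' : L2 u -> L2 v -> L2 u' -> L2 v' ->
    norm2 (u - u') < e / 2 / M -> norm2 (v - v') < e / 2 ->
    norm2 (c *: u + v - (c *: u' + v')) < e.
  move=> Lu Lv Lu' Lv' H1 H2.
  rewrite opprD addrACA -scalerBr.
  apply: le_lt_trans (norm2_lin _ (L2B Lu Lu') (L2B Lv Lv')) _.
  rewrite ltr_pdivlMr// in H1; have n1 := norm2_ge0 l (u - u').
  rewrite [e]splitr; apply: ltrD H2; apply: le_lt_trans H1.
  by rewrite mulrC ler_wpM2l// lerDl.
exists (c *: eta + zet); split; first exact: test_function_lin.
  exact: key.
by rewrite cderive_lin//; exact: key.
Qed.

Lemma H10_derivative0 : H10_derivative l 0 0.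
Proof.
have := test_H10 (test_function0 l0); congr (H10_derivative l _ _).
apply/funext => x; apply: complex_eqP => /=.
  by rewrite [X in derive1 X](_ : _ = cst 0) ?derive1_cst.
by rewrite [X in derive1 X](_ : _ = cst 0) ?derive1_cst.
Qed.

Lemma H10_derivative_sum (I : Type) (r : seq I) (c : I -> R[i]) (f f' : I -> cfun) :
  (forall i, H10_derivative l (f i) (f' i)) ->
  H10_derivative l (\sum_(i <- r) c i *: f i) (\sum_(i <- r) c i *: f' i).
Proof.
move=> H; elim: r => [|i r IH]; first by rewrite !big_nil; exact: H10_derivative0.
by rewrite !big_cons; exact: H10_derivative_lin.
Qed.

Lemma H10_derivativeB f f' g g' :
  H10_derivative l f f' -> H10_derivative l g g' ->
  H10_derivative l (f - g) (f' - g').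
Proof.
move=> Hf Hg; have := H10_derivative_lin (-1) Hg Hf.
by rewrite !scaleN1r addrC [X in H10_derivative _ _ X]addrC.
Qed.

Lemma dxP f : H10 l f -> H10_derivative l f (dx l f).
Proof. by move=> [g fg]; rewrite /dx; case: xgetP => [y -> //|/(_ g)]. Qed.

Lemma L2_dx f : H10 l f -> L2 (dx l f).
Proof. by move=> /dxP[]. Qed.

(** Both sides are continuous in [(h, h')] for the norm in which test functions approximate it. This
    turns weak identities into identities on all of H^1_0. *)
Lemma H10_density a b : L2 a -> L2 b ->
  (forall eta, test_function l eta -> rip a (cderive eta) = rip b eta) ->
  forall h h', H10_derivative l h h' -> rip a h' = rip b h.
Proof.
move=> La Lb ab h h' [Lh Lh' Hh].
apply/eqP; rewrite -subr_eq0 -normr_eq0 eq_le normr_ge0 andbT.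
apply/ler_addgt0Pl => e e0; rewrite addr0.
set M := norm2 a + norm2 b + 1.
have M0 : 0 < M by rewrite ltr_wpDl// addr_ge0// norm2_ge0.
have [eta [teta he he']] := Hh _ (divr_gt0 e0 M0).
have Le := csmooth_L2 l (test_csmooth teta).
have Le' := csmooth_L2 l (csmooth_cderive (test_csmooth teta)).
have -> : rip a h' - rip b h = rip a (h' - cderive eta) - rip b (h - eta).
  by rewrite !ripBr// ab//; ring.
apply: le_trans (ler_normB _ _) _.
have h1 := normr_rip_le La (L2B Lh' Le').
have h2 := normr_rip_le Lb (L2B Lh Le).
have n1 := norm2_ge0 l a; have n2 := norm2_ge0 l b.
have eM : e / M * M = e by rewrite divfK ?gt_eqF.
have h3 : norm2 a * norm2 (h' - cderive eta) <= norm2 a * (e / M).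
  by rewrite ler_wpM2l// ltW.
have h4 : norm2 b * norm2 (h - eta) <= norm2 b * (e / M).
  by rewrite ler_wpM2l// ltW.
have : 0 < e / M by exact: divr_gt0.
rewrite /M in eM *; nra.
Qed.

Lemma H10_skew f f' g g' : H10_derivative l f f' -> H10_derivative l g g' ->
  rip f g' = - rip f' g.
Proof.
move=> Hf Hg; have [Lf Lf'] := H10_derivative_L2 Hf.
have [Lg _] := H10_derivative_L2 Hg.
rewrite -ripNl//; apply: (@H10_density f (- f') Lf (L2N Lf') _ _ _ Hg) => eta te.
have se := test_csmooth te; have Le := csmooth_L2 l se.
by rewrite ripNl// (H10_derivative_rip l0 Hf se) opprK.
Qed.

Lemma laplacian_rip f g h h' : laplacian l f g -> H10_derivative l h h' ->
  rip g h = rip (dx l f) h'.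
Proof.
move=> [Hf [Ldf LNg wd]] Hh.
have Lg : L2 g by rewrite -(opprK g); exact: L2N.
apply/esym; apply: (H10_density Ldf Lg _ Hh) => eta te.
have := wd _ te; rewrite !innerE => -[+ _].
have Le := csmooth_L2 l (test_csmooth te).
by rewrite ripNl// opprK.
Qed.

Lemma laplacian_H10 f g : laplacian l f g -> [/\ H10 l f, L2 f & L2 g].
Proof.
by move=> [Hf [_ /L2N]]; rewrite opprK => Lg _; split => //; exact: H10_L2.
Qed.

Lemma H10_e n : H10_derivative l (e_ n) (cderive (e_ n)).
Proof. exact: H10_eigfun. Qed.

Lemma csmooth_e_rip f f' n : H10_derivative l f f' ->
  rip f' (cderive (e_ n)) = lam n * rip f (e_ n).
Proof.
move=> Hf; have [Lf Lf'] := H10_derivative_L2 Hf.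
rewrite (H10_derivative_rip l0 Hf (csmooth_cderive (csmooth_e l n))).
by rewrite cderive2_eigfun ripZr ?mulNr ?opprK//; exact: L2_e.
Qed.

Lemma rip_de_de n m : rip (cderive (e_ n)) (cderive (e_ m)) = lam m * rip (e_ n) (e_ m).
Proof. exact: csmooth_e_rip (H10_e n). Qed.

Lemma rip_e n m : rip (e_ n) (e_ m) = (n == m)%:R.
Proof.
have [->|nm] := eqVneq n m; last first.
  (* The product of the derivatives is symmetric, hence so is [lam m <e_n, e_m>]; distinct
     eigenvalues force orthogonality. *)
  have h1 := rip_de_de n m; have h2 := rip_de_de m n.
  rewrite ripC h2 (ripC _ (e_ m)) in h1.
  have : (lam n - lam m) * rip (e_ n) (e_ m) = 0 by rewrite mulrBl h1 subrr.
  move/eqP; rewrite mulf_eq0 subr_eq0 => /orP[/eqP/(eigval_inj l0)/eqP|/eqP//].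
  by rewrite (negbTE nm).
have mO := @measurable_Omega R l.
have := rip_integrable (L2_de l m) (L2_de l m).
have := rip_integrable (L2_e l m) (L2_e l m).
have lm := eigval_gt0 l0 m.
(* The two summands are equal, and the sum of their integrands is constant because cos^2 + sin^2 =
   1; no antiderivative of sin^2 has to be computed. *)
suff : lam m * rip (e_ m) (e_ m) + rip (cderive (e_ m)) (cderive (e_ m)) = 2 * lam m.
  rewrite rip_de_de /= => h _ _; apply: (mulfI (lt0r_neq0 lm)); rewrite mulr1; lra.
rewrite -ripZl; [|exact: L2_e..].
have I1 := rip_integrable (L2Z (lam m)%:C (L2_e l m)) (L2_e l m).
have I2 := rip_integrable (L2_de l m) (L2_de l m).
rewrite -(RintegralD mO I1 I2).
rewrite (_ : \int[_]_(x in _) _ = \int[lebesgue_measure]_(x in `]0, l[%classic) (2 * lam m / l)).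
  rewrite Rintegral_cst//.
  have muO : lebesgue_measure (`]0, l[%classic : set R) = l%:E.
    by rewrite lebesgue_measure_itv/= lte_fin l0 sube0.
  rewrite [X in fine X](_ : _ = l%:E); last exact: muO.
  by rewrite /= divfK// gt_eqF.
apply: eq_Rintegral => x _; rewrite cderive_eigfun eigfunE /reP /imP reM imM /=.
set t := _ + 0; rewrite /eigval -/(m.+1%:R * pi / l).
set c := m.+1%:R * pi / l; have := cos2Dsin2 t.
have : Num.sqrt (2 / l) ^+ 2 = 2 / l by rewrite sqr_sqrtr// divr_ge0// ltW.
set a := Num.sqrt _ => ha hcs.
have -> : 2 * c ^+ 2 / l = c ^+ 2 * a ^+ 2 * (cos t ^+ 2 + sin t ^+ 2).
  by rewrite hcs ha; ring.
ring.
Qed.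

End H10.

Lemma series_lim_le (R : realType) (u v : R^nat) a b : (forall n, u n <= v n) ->
  series u @ \oo --> a -> series v @ \oo --> b -> a <= b.
Proof.
move=> uv ua vb; apply: (ler_cvg_to ua vb); apply: nearW => n.
by apply: ler_sum => i _; exact: uv.
Qed.

Lemma cvg_seriesZ (R : realType) (u : R^nat) a c : series u @ \oo --> a ->
  series (fun n => c * u n) @ \oo --> c * a.
Proof.
move=> ua; rewrite (_ : series _ = fun n => c * series u n); last first.
  by apply/funext => n; rewrite /series /= mulr_sumr.
exact: cvgMr.
Qed.

Lemma cvg_seriesD (R : realType) (u v : R^nat) a b : series u @ \oo --> a ->
  series v @ \oo --> b -> series (fun n => u n + v n) @ \oo --> a + b.
Proof.
move=> ua vb; rewrite (_ : series _ = fun n => series u n + series v n).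
  exact: cvgD.
by apply/funext => n; rewrite /series /= big_split.
Qed.

(** * Fourier coefficients and Parseval's identity *)

Section Coefficients.
Context {R : realType} (l : R).
Hypothesis l0 : 0 < l.

Local Notation mu := (@lebesgue_measure R).
Local Notation Omega := (`]0, l[%classic : set R).
Local Notation cfun := (@cfun R).
Local Notation L2 := (@L2 R l).
Local Notation norm2 := (@norm2 R l).
Local Notation rip := (@real_inner R l).
Local Notation e_ := (@eigfun R l).

Definition re_coef (f : cfun) n : R := rip f (e_ n).
Definition im_coef (f : cfun) n : R := rip f (imul (e_ n)).
Local Notation cr := re_coef.
Local Notation ci := im_coef.
(** The real part of [coef f n] times the conjugate of [coef g n], that is the n-th term of the
    Parseval series of [real_inner]. *)
Definition coef_dot (f g : cfun) n : R := cr f n * cr g n + ci f n * ci g n.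
Local Notation pr := coef_dot.

Lemma coefE f n : coef l f n = cr f n +i* ci f n.
Proof. exact: innerE. Qed.

Lemma coef_dotC f g n : pr f g n = pr g f n.
Proof. by rewrite /pr mulrC [X in _ + X]mulrC. Qed.

Lemma coef_dot_ge0 f n : 0 <= pr f f n.
Proof. by rewrite /pr -!expr2 addr_ge0 ?sqr_ge0. Qed.

Lemma sqmod_coef f n : sqmod (coef l f n) = pr f f n.
Proof. by rewrite coefE /sqmod /= !expr2. Qed.

Lemma coef_dot_young f g n t : 0 < t -> `|pr f g n| <= t / 2 * pr f f n + (2 * t)^-1 * pr g g n.
Proof.
move=> t0; rewrite ler_norml.
have -> : t / 2 * pr f f n + (2 * t)^-1 * pr g g n =
  (2 * t)^-1 * ((t * cr f n) ^+ 2 + (t * ci f n) ^+ 2 + cr g n ^+ 2 + ci g n ^+ 2).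
  by rewrite /pr; field; rewrite gt_eqF.
rewrite lerNl -!ler_pdivrMl ?invr_gt0 ?mulr_gt0// !invrK /pr.
apply/andP; split.
  have := sqr_ge0 (t * cr f n + cr g n); have := sqr_ge0 (t * ci f n + ci g n); nra.
have := sqr_ge0 (t * cr f n - cr g n); have := sqr_ge0 (t * ci f n - ci g n); nra.
Qed.

Lemma re_coefB f g n : L2 f -> L2 g -> cr (f - g) n = cr f n - cr g n.
Proof. by move=> Lf Lg; rewrite /cr ripBl//; exact: L2_e. Qed.

Lemma im_coefB f g n : L2 f -> L2 g -> ci (f - g) n = ci f n - ci g n.
Proof. by move=> Lf Lg; rewrite /ci ripBl//; exact/L2_imul/L2_e. Qed.

Lemma coefB f g n : L2 f -> L2 g -> coef l (f - g) n = coef l f n - coef l g n.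
Proof. by move=> Lf Lg; rewrite !coefE re_coefB// im_coefB. Qed.

Lemma rip_e_imul n m : rip (e_ n) (imul (e_ m)) = 0.
Proof.
rewrite /real_inner [LHS](_ : _ = \int[mu]_(x in Omega) (0 : R)).
  by rewrite Rintegral_cst// mul0r.
apply: eq_Rintegral => x _; rewrite reP_imul imP_imul !eigfunE.
by rewrite /imP /= oppr0 mulr0 mul0r addr0.
Qed.

Lemma re_coef_eigfun c n m : cr (c *: e_ n) m = complex.Re c * (n == m)%:R.
Proof.
rewrite /cr rip_Zl; [|exact: L2_e..].
rewrite rip_e// rip_imull; [|exact: L2_e..].
by rewrite rip_e_imul oppr0 mulr0 addr0.
Qed.

Lemma im_coef_eigfun c n m : ci (c *: e_ n) m = complex.Im c * (n == m)%:R.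
Proof.
rewrite /ci rip_Zl; [|exact: L2_e|exact/L2_imul/L2_e].
by rewrite rip_imul_imul rip_e// rip_e_imul mulr0 add0r.
Qed.

Definition proj N (f : cfun) : cfun := \sum_(i < N) coef l f i *: e_ i.

Lemma L2_proj N f : L2 (proj N f).
Proof. by apply: L2_sum => i; apply: L2Z; exact: L2_e. Qed.

Lemma rip_proj N f g : L2 g -> rip (proj N f) g = \sum_(i < N) pr f g i.
Proof.
move=> Lg; rewrite rip_suml//; last by move=> i; apply: L2Z; exact: L2_e.
apply: eq_bigr => i _; rewrite rip_Zl//; last exact: L2_e.
rewrite coefE /pr /cr /ci /= (ripC _ g); congr (_ + _ * _).
by rewrite ripC.
Qed.

Lemma re_coef_proj N f n : cr (proj N f) n = if (n < N)%N then cr f n else 0.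
Proof.
rewrite /cr rip_suml; [|by move=> i; apply: L2Z; exact: L2_e|exact: L2_e].
under eq_bigr do rewrite -/(cr _ _) re_coef_eigfun coefE /=.
case: ifP => nN; last first.
  apply: big1 => i _; case: eqP => [iE|]; last by rewrite mulr0.
  by rewrite -iE ltn_ord in nN.
rewrite (bigD1 (Ordinal nN))//= eqxx mulr1 big1 ?addr0// => i ni.
by case: eqP => [iE|]; [move/eqP: ni; case; exact: val_inj|rewrite mulr0].
Qed.

Lemma im_coef_proj N f n : ci (proj N f) n = if (n < N)%N then ci f n else 0.
Proof.
rewrite /ci rip_suml; [|by move=> i; apply: L2Z; exact: L2_e|exact/L2_imul/L2_e].
under eq_bigr do rewrite -/(ci _ _) im_coef_eigfun coefE /=.
case: ifP => nN; last first.
  apply: big1 => i _; case: eqP => [iE|]; last by rewrite mulr0.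
  by rewrite -iE ltn_ord in nN.
rewrite (bigD1 (Ordinal nN))//= eqxx mulr1 big1 ?addr0// => i ni.
by case: eqP => [iE|]; [move/eqP: ni; case; exact: val_inj|rewrite mulr0].
Qed.

(** Real and imaginary parts are approximated separately, each within [e^2 / 2] for the squared
    norm; dividing by [sqrt (2 / l)] converts sines into normalized eigenfunctions. *)
Lemma eigfun_dense f : L2 f -> forall e : R, 0 < e ->
  exists r : seq (nat * R[i]), norm2 (f - \sum_(i <- r) i.2 *: e_ i.1) < e.
Proof.
move=> Lf e e0; have /L2P[sr si] := Lf.
have e2 : 0 < e ^+ 2 / 2 by rewrite divr_gt0// exprn_gt0.
have [r1 h1] := sine_dense l0 sr e2; have [r2 h2] := sine_dense l0 si e2.
pose a := Num.sqrt (2 / l); have a0 : a != 0 by rewrite gt_eqF// sqrtr_gt0 divr_gt0.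
pose r := [seq (i.1, (i.2 / a)%:C) | i <- r1] ++ [seq (i.1, (0 +i* (i.2 / a))) | i <- r2].
exists r; set p := \sum_(i <- r) _.
have pE x : p x = (sine_sum l r1 x +i* sine_sum l r2 x).
  rewrite /p fct_sumE /r big_cat !big_map /=.
  have -> : \sum_(i <- r1) ((i.2 / a)%:C *: e_ i.1) x = (sine_sum l r1 x)%:C.
    rewrite /sine_sum; elim: r1 {h1 r p} => [|i s IH]; first by rewrite !big_nil.
    rewrite !big_cons IH; apply: complex_eqP.
      rewrite reD /= mul0r subr0 mulrA; congr (_ * _ + _).
      by rewrite divfK.
    by rewrite imD /= mulr0 mul0r !addr0.
  have -> : \sum_(i <- r2) ((0 +i* (i.2 / a)) *: e_ i.1) x = 0 +i* sine_sum l r2 x.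
    rewrite /sine_sum; elim: r2 {h2 r p} => [|i s IH]; first by rewrite !big_nil.
    rewrite !big_cons IH; apply: complex_eqP.
      by rewrite reD /= mulr0 mul0r subr0 addr0.
    rewrite imD /= mul0r add0r mulrA; congr (_ * _ + _).
    by rewrite divfK.
  by apply: complex_eqP; rewrite ?reD ?imD /= ?addr0 ?add0r.
rewrite norm2E -[ltRHS](gtr0_norm e0) -sqrtr_sqr ltr_sqrt ?exprn_gt0//.
have mO := @measurable_Omega R l.
have s1 := @sine_span_sqint R l _ (ex_intro _ r1 erefl).
have s2 := @sine_span_sqint R l _ (ex_intro _ r2 erefl).
have [_ I1] := sqintB mO sr s1; have [_ I2] := sqintB mO si s2.
rewrite (_ : rip _ _ = \int[mu]_(x in Omega) ((reP f x - sine_sum l r1 x) ^+ 2 +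
  (imP f x - sine_sum l r2 x) ^+ 2)); last first.
  apply: eq_Rintegral => x _; rewrite /reP /imP !expr2.
  have -> : (f - p) x = f x - p x by [].
  by rewrite reD imD reN imN pE.
rewrite (RintegralD mO I1 I2); lra.
Qed.

(** The residue [f - proj N f] is orthogonal to every combination of the first [N] eigenfunctions,
    so its squared norm is its product with [f - p], and Cauchy-Schwarz concludes. *)
Lemma proj_best N f (r : seq (nat * R[i])) : L2 f -> all (fun i => (i.1 < N)%N) r ->
  norm2 (f - proj N f) <= norm2 (f - \sum_(i <- r) i.2 *: e_ i.1).
Proof.
move=> Lf rN; set p := \sum_(i <- r) _.
have Lp : L2 p by apply: L2_sum => i; apply: L2Z; exact: L2_e.
have LP := L2_proj N f.
have orth n : (n < N)%N -> rip (f - proj N f) (e_ n) = 0 /\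
    rip (f - proj N f) (imul (e_ n)) = 0.
  move=> nN; split.
    by rewrite -/(cr _ _) re_coefB// re_coef_proj nN subrr.
  by rewrite -/(ci _ _) im_coefB// im_coef_proj nN subrr.
have orthp : rip (f - proj N f) p = 0.
  rewrite ripC rip_suml; [|by move=> i; apply: L2Z; exact: L2_e|exact: L2B].
  rewrite big_seq big1// => i ir; rewrite rip_Zl; [|exact: L2_e|exact: L2B].
  have [h1 h2] := orth _ (allP rN _ ir).
  by rewrite ripC h1 ripC h2 !mulr0 addr0.
have orthP : rip (f - proj N f) (proj N f) = 0.
  rewrite ripC rip_proj; last exact: L2B.
  rewrite big1// => i _; have [h1 h2] := orth _ (ltn_ord i).
  by rewrite /pr /cr /ci h1 h2 !mulr0 addr0.
have [->|n0] := eqVneq (norm2 (f - proj N f)) 0; first exact: norm2_ge0.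
have n1 : 0 < norm2 (f - proj N f) by rewrite lt_neqAle eq_sym n0 norm2_ge0.
rewrite -(ler_pM2l n1) -expr2 norm2_sqr.
rewrite (_ : rip _ _ = rip (f - proj N f) (f - p)).
  by apply: rip_le; exact: L2B.
by rewrite !(ripBr (f := f - proj N f))// ?orthp ?orthP//; exact: L2B.
Qed.

Lemma proj_cvg f : L2 f -> norm2 (f - proj N f) @[N --> \oo] --> (0 : R).
Proof.
move=> Lf; apply/cvgrPdist_lt => e e0.
have [r re] := eigfun_dense Lf e0.
(* This sum exceeds every index occurring in [r]. *)
exists (\sum_(i <- r) i.1.+1)%N => // N /= rN.
rewrite sub0r normrN ger0_norm ?norm2_ge0//; apply: le_lt_trans re.
apply: proj_best => //; apply/allP => i ir; apply: leq_trans rN.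
by rewrite (big_rem _ ir)/= leq_addr.
Qed.

Theorem parseval f g : L2 f -> L2 g -> series (pr f g) @ \oo --> rip f g.
Proof.
move=> Lf Lg; rewrite -[X in _ --> X]subr0.
rewrite (_ : series _ = fun N => rip f g - rip (f - proj N f) g); last first.
  apply/funext => N; rewrite ripBl//; last exact: L2_proj.
  by rewrite subKr rip_proj// /series /= big_mkord.
apply: cvgB; first exact: cvg_cst.
apply/norm_cvg0P; apply: (@squeeze_cvgr _ _ _ _ (cst 0)
  (fun N => norm2 (f - proj N f) * norm2 g)).
- apply: nearW => N; rewrite normr_ge0/= normr_rip_le//.
  by apply: L2B => //; exact: L2_proj.
- exact: cvg_cst.
- by rewrite -[X in _ --> X](mul0r (norm2 g)); apply: cvgMl; exact: proj_cvg.
Qed.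

End Coefficients.

(** * Sine series in H^1_0, fractional powers and the inverse of A *)

Section Dirichlet.
Context {R : realType} (l : R).
Hypothesis l0 : 0 < l.

Local Notation cfun := (@cfun R).
Local Notation L2 := (@L2 R l).
Local Notation norm2 := (@norm2 R l).
Local Notation rip := (@real_inner R l).
Local Notation e_ := (@eigfun R l).
Local Notation lam := (@eigval R l).
Local Notation cr := (@re_coef R l).
Local Notation ci := (@im_coef R l).
Local Notation pr := (@coef_dot R l).

Lemma H10_imul f f' : H10_derivative l f f' -> H10_derivative l (imul f) (imul f').
Proof.
move=> H; have := H10_derivative_lin 'i%C H (H10_derivative0 l0).
by rewrite !addr0.
Qed.

Lemma rip_de f f' n : H10_derivative l f f' ->
  rip f' (cderive (e_ n)) = lam n * cr f n /\
  rip f' (imul (cderive (e_ n))) = lam n * ci f n.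
Proof.
move=> Hf; have [Lf Lf'] := H10_derivative_L2 Hf.
split; first exact: csmooth_e_rip.
have Le := L2_e l n; have Le' := L2_de l n.
have := csmooth_e_rip l0 n (H10_imul Hf); rewrite !rip_imull// /im_coef.
by rewrite mulrN => /oppr_inj.
Qed.

Lemma laplacian_coef f g n : laplacian l f g ->
  cr g n = lam n * cr f n /\ ci g n = lam n * ci f n.
Proof.
move=> lfg; have [Hf _] := lfg; have [h1 h2] := rip_de n (dxP Hf).
split.
  by rewrite -h1; exact: laplacian_rip lfg (H10_e l0 n).
by rewrite -h2; exact: laplacian_rip lfg (H10_imul (H10_e l0 n)).
Qed.

Lemma laplacian_coef_dot f g h n : laplacian l f g -> pr g h n = lam n * pr f h n.
Proof. by move=> /(laplacian_coef n)[h1 h2]; rewrite /coef_dot h1 h2; ring. Qed.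

Definition dproj N (f : cfun) : cfun := \sum_(i < N) coef l f i *: cderive (e_ i).

Lemma H10_proj N f : H10_derivative l (proj l N f) (dproj N f).
Proof. by apply: H10_derivative_sum => // i; exact: H10_e. Qed.

Lemma rip_dproj N f g g' : H10_derivative l g g' ->
  rip (dproj N f) g' = \sum_(i < N) lam i * pr f g i.
Proof.
move=> Hg; have [Lg Lg'] := H10_derivative_L2 Hg.
rewrite rip_suml//; last by move=> i; apply: L2Z; exact: L2_de.
apply: eq_bigr => i _; have Le' := L2_de l i; have [h1 h2] := rip_de i Hg.
rewrite rip_Zl// coefE /= ripC h1 ripC h2 /coef_dot; ring.
Qed.

(** The functions [e_n'] are orthogonal with squared norms [lam n], and [dproj N f] is the
    orthogonal projection of [f'] on the first [N] of them. In particular, forming the residue is a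
    contraction. *)
Lemma norm2_dproj N f f' : H10_derivative l f f' ->
  norm2 (f' - dproj N f) ^+ 2 = rip f' f' - \sum_(i < N) lam i * pr f f i.
Proof.
move=> Hf; have [Lf Lf'] := H10_derivative_L2 Hf.
have [_ LP] := H10_derivative_L2 (H10_proj N f).
rewrite norm2_sqr ripBl ?ripBr//; try exact: L2B.
rewrite (ripC _ f') (rip_dproj _ _ Hf) (rip_dproj _ _ (H10_proj N f)).
rewrite (_ : \sum_(i < N) lam i * pr f (proj l N f) i = \sum_(i < N) lam i * pr f f i).
  by ring.
by apply: eq_bigr => i _; rewrite /coef_dot re_coef_proj// im_coef_proj// ltn_ord.
Qed.

(** Equality as seen by scalar products, which is all that the forms use; unlike pointwise equality
    it can be verified on coefficients. *)
Definition eqL2 (f g : cfun) := forall h, L2 h -> rip f h = rip g h.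

Lemma eqL2_coef f g : L2 f -> L2 g ->
  (forall n, cr f n = cr g n /\ ci f n = ci g n) -> eqL2 f g.
Proof.
move=> Lf Lg fg h Lh; have := parseval l0 Lf Lh; have := parseval l0 Lg Lh.
rewrite (_ : pr f h = pr g h).
  by move=> a b; apply: (cvg_unique _ b a).
by apply/funext => n; have [h1 h2] := fg n; rewrite /coef_dot h1 h2.
Qed.

(** Skew-symmetry of the derivative expresses the coefficients of [f'] through products of [f] with
    [e_n']. *)
Lemma H10_derivative_unique f f' g g' :
  H10_derivative l f f' -> H10_derivative l g g' -> eqL2 f g -> eqL2 f' g'.
Proof.
move=> Hf Hg fg.
have [Lf Lf'] := H10_derivative_L2 Hf; have [Lg Lg'] := H10_derivative_L2 Hg.
have Ld n := csmooth_L2 l (csmooth_cderive (csmooth_e l n)).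
apply: eqL2_coef => // n; rewrite /re_coef /im_coef.
rewrite -[rip f' _]opprK -(H10_skew l0 Hf (H10_e l0 n)) fg//.
rewrite (H10_skew l0 Hg (H10_e l0 n)) opprK; split => //.
have Hi := H10_imul (H10_e l0 n); have [_ Li] := H10_derivative_L2 Hi.
rewrite -[LHS]opprK -(H10_skew l0 Hf Hi) fg//.
by rewrite (H10_skew l0 Hg Hi) opprK.
Qed.

Lemma dx_unique f f' : H10_derivative l f f' -> eqL2 (dx l f) f'.
Proof.
move=> Hf; apply: (H10_derivative_unique (dxP (ex_intro _ _ Hf)) Hf).
by move=> h.
Qed.

(** The real identity applied to [eta] and to [i eta] yields the complex identity that the
    definition of the weak derivative asks for. *)
Lemma laplacianP f f' g : H10_derivative l f f' -> L2 g ->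
  (forall eta, test_function l eta -> rip f' (cderive eta) = rip g eta) ->
  laplacian l f g.
Proof.
move=> Hf Lg H; have [Lf Lf'] := H10_derivative_L2 Hf.
have Hx := dx_unique Hf; have HH : H10 l f by exists f'.
have Ldx := L2_dx HH.
split => //; split => //; first exact: L2N.
move=> eta te; have Le := csmooth_L2 l (test_csmooth te).
have Ld := csmooth_L2 l (csmooth_cderive (test_csmooth te)).
have ti : test_function l (imul eta).
  by have := test_function_lin 'i%C te (test_function0 l0); rewrite addr0.
have di : cderive (imul eta) = imul (cderive eta).
  have := cderive_lin 'i%C (test_csmooth te) (test_csmooth (test_function0 l0)).
  rewrite addr0 => ->; rewrite [X in _ + X](_ : _ = 0) ?addr0//.
  apply/funext => x; apply: complex_eqP => /=;
    by rewrite [X in derive1 X](_ : _ = cst 0) ?derive1_cst.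
rewrite !innerE Hx// H// Hx; last exact: L2_imul.
rewrite -/(imul (cderive eta)) -di H// !ripNl//; last exact: L2_imul.
by apply: complex_eqP; rewrite /= opprK.
Qed.

Lemma test_laplacian eta : test_function l eta ->
  laplacian l eta (- cderive (cderive eta)).
Proof.
move=> te; have se := test_csmooth te.
have Ldd := csmooth_L2 l (csmooth_cderive (csmooth_cderive se)).
apply: (laplacianP (test_H10 te)) => [|zeta tz]; first exact: L2N.
have Lz := csmooth_L2 l (test_csmooth tz).
by rewrite ripNl// (rip_cderive l0 (csmooth_cderive se) tz) opprK.
Qed.

Lemma eigfun_laplacian n : laplacian l (e_ n) ((lam n)%:C *: e_ n).
Proof.
have Le := L2_e l n; have sd := csmooth_cderive (csmooth_e l n).
apply: (laplacianP (H10_e l0 n)) => [|zeta tz]; first exact: L2Z.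
have Lz := csmooth_L2 l (test_csmooth tz).
rewrite -[LHS]opprK -(rip_cderive l0 sd tz) cderive2_eigfun !ripZl//; lra.
Qed.

(** Completeness of the cosines is not invoked: for a test function [eta] the series is the Parseval
    series of <- eta'', eta>, whose sum is ||eta'||^2. The contraction property of the residues then
    transfers the convergence to the H^1_0 closure. *)
Theorem dirichlet_parseval f f' : H10_derivative l f f' ->
  series (fun n => lam n * pr f f n) @ \oo --> rip f' f'.
Proof.
move=> Hf; have [Lf Lf'] := H10_derivative_L2 Hf.
have serE g g' : H10_derivative l g g' -> forall N,
    series (fun n => lam n * pr g g n) N = rip g' g' - norm2 (g' - dproj N g) ^+ 2.
  by move=> Hg N; rewrite norm2_dproj// subKr /series /= big_mkord.
rewrite (_ : series _ = fun N => rip f' f' -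
    norm2 (f' - dproj N f) * norm2 (f' - dproj N f)); last first.
  by apply/funext => N; rewrite (serE _ _ Hf) expr2.
rewrite -[X in _ --> X]subr0 -[X in _ - X](mulr0 0).
suff H : norm2 (f' - dproj N f) @[N --> \oo] --> (0 : R).
  by apply: cvgB; [exact: cvg_cst|exact: cvgM].
apply/cvgrPdist_lt => e e0; have e2 : 0 < e / 2 by rewrite divr_gt0.
have [_ _ Hd] := Hf; have [eta [te _ fe]] := Hd _ e2.
have He := test_H10 te; have [Le Le'] := H10_derivative_L2 He.
have ce : norm2 (cderive eta - dproj N eta) ^+ 2 @[N --> \oo] --> (0 : R).
  rewrite (_ : (fun N => _) = fun N => rip (cderive eta) (cderive eta) -
      series (fun n => lam n * pr eta eta n) N); last first.
    by apply/funext => N; rewrite (serE _ _ He) subKr.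
  rewrite -[X in _ --> X](subrr (rip (cderive eta) (cderive eta))).
  apply: cvgB; first exact: cvg_cst.
  have tl := test_laplacian te; have [_ _ Ldd] := laplacian_H10 tl.
  rewrite (_ : (fun n => lam n * _) = pr (- cderive (cderive eta)) eta).
    rewrite (_ : rip (cderive eta) _ = rip (- cderive (cderive eta)) eta).
      exact: parseval.
    have sd := csmooth_cderive (test_csmooth te).
    by rewrite ripNl ?(rip_cderive l0 sd te) ?opprK//; exact: csmooth_L2 (csmooth_cderive sd).
  by apply/funext => n; rewrite (laplacian_coef_dot _ _ tl).
near=> N; rewrite sub0r normrN ger0_norm ?norm2_ge0//.
have Lp g : L2 (dproj N g) by apply: L2_sum => i; apply: L2Z; exact: L2_de.
have HB := H10_derivativeB Hf He; have [LB LB'] := H10_derivative_L2 HB.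
(* The first residue is at most [||f' - eta'||] for every [N]; the second tends to 0 because [eta]
   is a test function. *)
have -> : f' - dproj N f = (f' - cderive eta - dproj N (f - eta)) +
    (cderive eta - dproj N eta).
  have -> : dproj N (f - eta) = dproj N f - dproj N eta.
    rewrite /dproj -sumrB; apply: eq_bigr => i _.
    by rewrite coefB// scalerBl.
  by rewrite opprB ; apply/funext => x; rewrite !fctE; ring.
apply: le_lt_trans (norm2D (L2B LB' (Lp _)) (L2B Le' (Lp _))) _.
rewrite [ltRHS](splitr e); apply: ltrD.
  apply: le_lt_trans fe; rewrite -ler_sqr ?nnegrE ?norm2_ge0//.
  rewrite norm2_dproj// norm2_sqr gerBl sumr_ge0// => i _.
  by rewrite mulr_ge0 ?coef_dot_ge0// ltW// eigval_gt0.
rewrite -ltr_sqr ?nnegrE ?norm2_ge0 ?(ltW e2)//.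
near: N; apply: (cvgr_lt _ ce); exact: exprn_gt0.
Unshelve. all: by end_near. Qed.

Lemma sqnorm_frac_cvg s f a :
  series (fun n => lam n `^ (2 * s) * pr f f n) @ \oo --> a ->
  sqnorm_frac l s f = a%:E.
Proof.
move=> H; apply: cvg_lim => //.
rewrite (_ : (fun n => _) = EFin \o series (fun n => lam n `^ (2 * s) * pr f f n)).
  by apply: cvg_EFin; [exact: nearW|exact: H].
apply/funext => n; rewrite /series /= -sumEFin.
by apply: eq_bigr => i _; rewrite sqmod_coef.
Qed.

Lemma norm_frac_half f : H10 l f -> norm_frac l 2^-1 f ^+ 2 = rip (dx l f) (dx l f).
Proof.
move=> /dxP Hf; rewrite /norm_frac (@sqnorm_frac_cvg _ _ (rip (dx l f) (dx l f))).
  by rewrite sqr_sqrtr// rip_ge0.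
rewrite (_ : (fun n => _) = (fun n => lam n * pr f f n)).
  exact: dirichlet_parseval.
by apply/funext => n; rewrite mulfV// powRr1// ltW// eigval_gt0.
Qed.

Lemma poincare f f' : H10_derivative l f f' -> rip f f <= (lam 0)^-1 * rip f' f'.
Proof.
move=> Hf; have [Lf _] := H10_derivative_L2 Hf.
apply: (series_lim_le _ (parseval l0 Lf Lf) (cvg_seriesZ (c := (lam 0)^-1) (dirichlet_parseval Hf))).
move=> n; rewrite mulrA ler_peMl ?coef_dot_ge0// mulrC ler_pdivlMr ?eigval_gt0//.
by rewrite mul1r eigval_le.
Qed.

(** The exponent [s - t] is nonpositive, so [lam n ^ (s - t)] is largest at the smallest
    eigenvalue. *)
Lemma powR_eigval_le (s t : R) n : s <= t ->
  lam n `^ s <= lam 0 `^ (s - t) * lam n `^ t.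
Proof.
move=> st; have l1 := eigval_gt0 l0 0; have l2 := eigval_gt0 l0 n.
have -> : lam n `^ s = lam n `^ (s - t) * lam n `^ t.
  by rewrite -powRD ?subrK//; apply/implyP => _; rewrite gt_eqF.
rewrite ler_wpM2r ?powR_ge0// -opprB !powRN lef_pV2 ?posrE ?powR_gt0//.
by apply: ge0_ler_powR; rewrite ?subr_ge0 ?nnegrE ?(ltW l1) ?(ltW l2)// eigval_le.
Qed.

Lemma powR_eigval_ge (s : R) n : 0 <= s -> lam 0 `^ s <= lam n `^ s.
Proof.
move=> s0; have l1 := eigval_gt0 l0 0; have l2 := eigval_gt0 l0 n.
by apply: ge0_ler_powR; rewrite ?nnegrE ?(ltW l1) ?(ltW l2)// eigval_le.
Qed.

Lemma frac_power_coef_dot s f g h n : frac_power l s f g ->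
  pr g h n = lam n `^ s * pr f h n.
Proof.
move=> [_ _ /(_ n)]; rewrite !coefE => /(congr1 (fun z : R[i] => (complex.Re z, complex.Im z))).
rewrite /= !mul0r subr0 addr0 => -[h1 h2].
by rewrite /coef_dot h1 h2; ring.
Qed.

(** Coercivity of the damping: whatever its order in [[0, 1]], it controls the plain norm of the
    damped velocity. *)
Lemma frac_power_ge s f g : 0 <= s -> frac_power l s f g ->
  lam 0 `^ s * rip f f <= rip g f.
Proof.
move=> s0 fg; have [Lf Lg _] := fg.
apply: (series_lim_le _ (cvg_seriesZ (parseval l0 Lf Lf)) (parseval l0 Lg Lf)) => n.
by rewrite (frac_power_coef_dot _ _ fg) ler_wpM2r ?coef_dot_ge0// powR_eigval_ge.
Qed.

Lemma series_young f g (c : nat -> R) (t a b : R) : 0 < t -> (forall n, 0 <= c n) ->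
  series (fun n => c n * pr f f n) @ \oo --> a ->
  series (fun n => c n * pr g g n) @ \oo --> b ->
  forall d, series (fun n => c n * pr f g n) @ \oo --> d ->
  `|d| <= t / 2 * a + (2 * t)^-1 * b.
Proof.
move=> t0 c0 ha hb d hd.
have hab := cvg_seriesD (cvg_seriesZ (c := (t / 2)) ha) (cvg_seriesZ (c := (2 * t)^-1) hb).
have young n : `|c n * pr f g n| <=
    t / 2 * (c n * pr f f n) + (2 * t)^-1 * (c n * pr g g n).
  rewrite normrM (ger0_norm (c0 n)) !(mulrCA _ (c n)) -mulrDr ler_wpM2l//.
  exact: coef_dot_young.
rewrite ler_norml; apply/andP; split; last first.
  by apply: (series_lim_le _ hd hab) => n; rewrite (le_trans (ler_norm _)).
rewrite lerNl -mulN1r.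
apply: (series_lim_le _ (cvg_seriesZ (c := (-1)) hd) hab) => n.
by rewrite mulN1r (le_trans (ler_norm _))// normrN.
Qed.

Lemma series_dominated (u v : R^nat) (a : R) : (forall n, `|u n| <= v n) ->
  series v @ \oo --> a -> cvgn (series u).
Proof.
move=> uv va; apply: normed_cvg.
apply: (series_le_cvg (v_ := v)) => [n|n|n|]; [exact: normr_ge0| |exact: uv|].
  exact: le_trans (normr_ge0 _) (uv n).
by apply/cvg_ex; exists a.
Qed.

(** Young's inequality is applied to each coefficient with weight [lam n ^ s], and the half
    concerning [h] is raised to the weight [lam n] since [s <= 1]. Thus [h] need only belong to
    H^1_0; [A^s h] itself is never formed. *)
Lemma frac_power_young s f g h h' t : 0 < t -> s <= 1 ->
  frac_power l s f g -> H10_derivative l h h' ->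
  `|rip g h| <= t / 2 * rip g f + (2 * t)^-1 * (lam 0 `^ (s - 1) * rip h' h').
Proof.
move=> t0 s1 fg Hh; have [Lf Lg _] := fg; have [Lh Lh'] := H10_derivative_L2 Hh.
have c0 n : 0 <= lam n `^ s by exact: powR_ge0.
have le n : lam n `^ s * pr h h n <= lam 0 `^ (s - 1) * (lam n * pr h h n).
  rewrite mulrA ler_wpM2r ?coef_dot_ge0//.
  by have := powR_eigval_le n s1; rewrite (powRr1 (ltW (eigval_gt0 l0 n))).
have hh := cvg_seriesZ (c := (lam 0 `^ (s - 1))) (dirichlet_parseval Hh).
have /cvg_ex[b hb] : cvgn (series (fun n => lam n `^ s * pr h h n)).
  apply: (series_dominated _ hh) => n; rewrite ger0_norm//.
  by rewrite mulr_ge0 ?coef_dot_ge0.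
have hf : series (fun n => lam n `^ s * pr f f n) @ \oo --> rip g f.
  rewrite (_ : (fun n => _) = pr g f); first exact: parseval.
  by apply/funext => n; rewrite (frac_power_coef_dot _ _ fg).
have hfh : series (fun n => lam n `^ s * pr f h n) @ \oo --> rip g h.
  rewrite (_ : (fun n => _) = pr g h); first exact: parseval.
  by apply/funext => n; rewrite (frac_power_coef_dot _ _ fg).
apply: le_trans (series_young t0 c0 hf hb hfh) _.
rewrite lerD2l ler_wpM2l ?invr_ge0 ?mulr_ge0 ?(ltW t0)//.
exact: (series_lim_le le hb hh).
Qed.

(* The real part of <A^-1 f, g>. *)
Definition invrip (f g : cfun) : R := limn (series (fun n => (lam n)^-1 * pr f g n)).

Lemma cvg_invrip f g : L2 f -> L2 g ->
  series (fun n => (lam n)^-1 * pr f g n) @ \oo --> invrip f g.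
Proof.
move=> Lf Lg; apply: (series_dominated _ (cvg_seriesZ (c := (lam 0)^-1)
  (cvg_seriesD (cvg_seriesZ (c := (1 / 2)) (parseval l0 Lf Lf))
     (cvg_seriesZ (c := (2 * 1)^-1) (parseval l0 Lg Lg))))) => n.
rewrite normrM ler_pM// ?coef_dot_young//.
by rewrite gtr0_norm ?invr_gt0 ?eigval_gt0// lef_pV2 ?posrE ?eigval_gt0// eigval_le.
Qed.

Lemma invrip_unique f g d :
  series (fun n => (lam n)^-1 * pr f g n) @ \oo --> d -> invrip f g = d.
Proof. exact: cvg_lim. Qed.

Lemma invripC f g : invrip f g = invrip g f.
Proof. by congr (limn (series _)); apply/funext => n; rewrite coef_dotC. Qed.

Lemma invripDl f g h : L2 f -> L2 g -> L2 h ->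
  invrip (f + g) h = invrip f h + invrip g h.
Proof.
move=> Lf Lg Lh; apply: invrip_unique.
rewrite (_ : (fun n => _) = fun n => (lam n)^-1 * pr f h n + (lam n)^-1 * pr g h n).
  by apply: cvg_seriesD; exact: cvg_invrip.
apply/funext => n; have Le := L2_e l n; have Li := L2_imul Le.
by rewrite /coef_dot /re_coef /im_coef !(ripDl Lf Lg)//; ring.
Qed.

Lemma invripZl (c : R) f h : L2 f -> L2 h -> invrip (c%:C *: f) h = c * invrip f h.
Proof.
move=> Lf Lh; apply: invrip_unique.
rewrite (_ : (fun n => _) = fun n => c * ((lam n)^-1 * pr f h n)).
  by apply: cvg_seriesZ; exact: cvg_invrip.
apply/funext => n; have Le := L2_e l n; have Li := L2_imul Le.
by rewrite /coef_dot /re_coef /im_coef !(ripZl _ Lf)//; ring.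
Qed.

Lemma invrip_young f g t : 0 < t -> L2 f -> L2 g ->
  `|invrip f g| <= (lam 0)^-1 * (t / 2 * rip f f + (2 * t)^-1 * rip g g).
Proof.
move=> t0 Lf Lg; have l1 := eigval_gt0 l0 0.
have le k : L2 k -> invrip k k <= (lam 0)^-1 * rip k k.
  move=> Lk; apply: (series_lim_le _ (cvg_invrip Lk Lk)
    (cvg_seriesZ (parseval l0 Lk Lk))) => n.
  by rewrite ler_wpM2r ?coef_dot_ge0// lef_pV2 ?posrE ?eigval_gt0// eigval_le.
have c0 n : 0 <= (lam n)^-1 by rewrite invr_ge0 ltW// eigval_gt0.
apply: le_trans (series_young t0 c0 (cvg_invrip Lf Lf) (cvg_invrip Lg Lg)
  (cvg_invrip Lf Lg)) _.
rewrite mulrDr !(mulrCA (lam 0)^-1); apply: lerD; rewrite ler_wpM2l ?le//.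
  by rewrite divr_ge0// ltW.
by rewrite invr_ge0 mulr_ge0// ltW.
Qed.

(** The factor [1 / lam n] cancels the eigenvalue produced by [A]. This is how the compensating
    product lowers each second-order term to order zero. *)
Lemma laplacian_invrip f g h : laplacian l f g -> L2 h -> invrip g h = rip f h.
Proof.
move=> lfg Lh; have [_ Lf _] := laplacian_H10 lfg; apply: invrip_unique.
rewrite (_ : (fun n => _) = pr f h); first exact: parseval.
apply/funext => n; rewrite (laplacian_coef_dot _ _ lfg) mulKf// gt_eqF//.
exact: eigval_gt0.
Qed.

Lemma invrip_eqL2 f g h : eqL2 f g -> invrip f h = invrip g h.
Proof.
move=> fg; congr (limn (series _)); apply/funext => n.
have Le := L2_e l n; have Li := L2_imul Le.
by rewrite /coef_dot /re_coef /im_coef !fg.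
Qed.

End Dirichlet.

(** * The energy and the cross form *)

Section L2Forms.
Context {R : realType} (l : R).
Hypothesis l0 : 0 < l.
Local Notation cfun := (@cfun R).
Local Notation L2 := (@L2 R l).
Local Notation rip := (@real_inner R l).

Lemma L2_lin (c : R) (f g : cfun) : L2 f -> L2 g -> L2 (c%:C *: f + g).
Proof. by move=> Lf Lg; apply: L2D => //; exact: L2Z. Qed.

Lemma symform_rip : symform L2 rip.
Proof.
by split=> *; [exact: ripDl|exact: ripZl|exact: ripC].
Qed.

Lemma symform_invrip : symform L2 (invrip l).
Proof.
by split=> *; [exact: invripDl|exact: invripZl|exact: invripC].
Qed.

Lemma rip_young f g t : 0 < t -> L2 f -> L2 g ->
  `|rip f g| <= t / 2 * rip f f + (2 * t)^-1 * rip g g.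
Proof.
move=> t0 Lf Lg; apply: le_trans (normr_rip_le Lf Lg) _.
rewrite -!norm2_sqr; have := sqr_ge0 (t * norm2 l f - norm2 l g).
have -> : t / 2 * norm2 l f ^+ 2 + (2 * t)^-1 * norm2 l g ^+ 2 =
  (2 * t)^-1 * ((t * norm2 l f) ^+ 2 + norm2 l g ^+ 2) by field; rewrite gt_eqF.
rewrite (mulrC (2 * t)^-1) ler_pdivlMr ?mulr_gt0//; nra.
Qed.

Lemma dx_lin (c : R) f g : H10 l f -> H10 l g ->
  eqL2 l (dx l (c%:C *: f + g)) (c%:C *: dx l f + dx l g).
Proof. by move=> /dxP Hf /dxP Hg; apply: dx_unique => //; exact: H10_derivative_lin. Qed.

Lemma H10_lin (c : R) f g : H10 l f -> H10 l g -> H10 l (c%:C *: f + g).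
Proof. by move=> [f' Hf] [g' Hg]; eexists; exact: H10_derivative_lin Hf Hg. Qed.

End L2Forms.

(** * Symmetric forms built from coordinates of the phase space *)

Section PhaseForms.
Context {R : realType} (l : R) {V : lmodType R[i]} (H : set V).
Hypothesis l0 : 0 < l.
Hypothesis Hlin : forall (c : R) U W, H U -> H W -> H (c%:C *: U + W).
Local Notation cfun := (@cfun R).
Local Notation L2 := (@L2 R l).

(* Elements of L^2 that are equal almost everywhere are distinct functions, so the
   coordinates of a vector are only linear up to [eqL2]. *)
Definition coordinate (L : V -> cfun) : Prop :=
  (forall U, H U -> L2 (L U)) /\
  forall (c : R) U W, H U -> H W ->
    eqL2 l (L (c%:C *: U + W)) (c%:C *: L U + L W).

Lemma coordinateB L L' : coordinate L -> coordinate L' ->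
  coordinate (fun U => L U - L' U).
Proof.
move=> [HL linL] [HL' linL']; split=> [U HU|c U W HU HW h Lh].
  by apply: L2B; [exact: HL|exact: HL'].
have HUW := Hlin c HU HW.
have LU := HL _ HU; have LW := HL _ HW; have L'U := HL' _ HU; have L'W := HL' _ HW.
have LUW := HL _ HUW; have L'UW := HL' _ HUW.
have E x y : c%:C *: (x - y) = c%:C *: x - c%:C *: y :> cfun by exact: scalerBr.
rewrite E ripBl// linL// linL'//.
have Z f : L2 f -> L2 (c%:C *: f) by exact: L2Z.
rewrite !(@ripDl _ l (c%:C *: L U))//; [|exact: Z..].
rewrite (@ripDl _ l (c%:C *: L' U))//; last exact: Z.
rewrite (@ripDl _ l (c%:C *: L U - _))//; [|by apply: L2B; exact: Z|exact: L2B].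
rewrite !ripBl//; [|exact: Z..].
ring.
Qed.

(** Blindness to [eqL2] is what makes forms in the coordinate [dx] genuinely bilinear although [dx]
    itself is linear only up to [eqL2]. *)
Definition invariant_form (F : cfun -> cfun -> R) : Prop :=
  symform L2 F /\ forall f g h, L2 f -> L2 g -> L2 h -> eqL2 l f g -> F f h = F g h.

Lemma invariant_rip : invariant_form (@real_inner R l).
Proof. by split=> [|f g h _ _ Lh fg]; [exact: symform_rip|exact: fg]. Qed.

Lemma invariant_invrip : invariant_form (invrip l).
Proof. by split=> [|f g h _ _ _ fg]; [exact: symform_invrip|exact: invrip_eqL2]. Qed.

Lemma symform_cross F L L' : invariant_form F -> coordinate L -> coordinate L' ->
  symform H (fun U W => F (L U) (L' W) + F (L' U) (L W)).
Proof.
move=> [FS Finv] [HL linL] [HL' linL'].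
have lin M Z c U W : coordinate M -> H U -> H W -> L2 Z ->
    F (M (c%:C *: U + W)) Z = c * F (M U) Z + F (M W) Z.
  move=> [HM linM] HU HW LZ; have MU := HM _ HU; have MW := HM _ HW.
  have HUW := Hlin c HU HW.
  rewrite (Finv _ _ _ (HM _ HUW) (L2_lin c MU MW) LZ (linM c U W HU HW)).
  by rewrite (symformD FS)// ?(symformZ FS)//; exact: L2Z.
have cL : coordinate L by []; have cL' : coordinate L' by [].
split.
- move=> U W Z HU HW HZ; have := lin _ (L' Z) 1 U W cL HU HW (HL' _ HZ).
  have := lin _ (L Z) 1 U W cL' HU HW (HL _ HZ).
  by rewrite scale1r !mul1r => -> ->; ring.
- move=> c U Z HU HZ; have H0 := stable0 Hlin HU.
  have := lin _ (L' Z) c U 0 cL HU H0 (HL' _ HZ).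
  have := lin _ (L Z) c U 0 cL' HU H0 (HL _ HZ).
  (* [L 0] need not be the zero function; additivity at 0 gives [F (L 0) _ = 2 F (L 0) _], so the
     value vanishes. *)
  have := lin _ (L' Z) 1 0 0 cL H0 H0 (HL' _ HZ).
  have := lin _ (L Z) 1 0 0 cL' H0 H0 (HL _ HZ).
  rewrite scale1r !addr0 !mul1r => z1 z2 -> ->; nra.
- move=> U W HU HW.
  rewrite (symformC FS (HL _ HU) (HL' _ HW)) (symformC FS (HL' _ HU) (HL _ HW)).
  by rewrite addrC.
Qed.

Lemma symform_add (b b' : V -> V -> R) c : symform H b -> symform H b' ->
  symform H (fun U W => b U W + c * b' U W).
Proof.
move=> [bD bZ bC] [bD' bZ' bC']; split=> [U W Z HU HW HZ|d U Z HU HZ|U W HU HW].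
- by rewrite bD// bD'//; ring.
- by rewrite bZ// bZ'//; ring.
- by rewrite bC// bC'.
Qed.

Lemma symform_scale (b : V -> V -> R) c : symform H b ->
  symform H (fun U W => c * b U W).
Proof.
move=> [bD bZ bC]; split=> [U W Z HU HW HZ|d U Z HU HZ|U W HU HW].
- by rewrite bD//; ring.
- by rewrite bZ//; ring.
- by rewrite bC.
Qed.

Lemma symform_square L : coordinate L -> symform H (fun U W => real_inner l (L U) (L W)).
Proof.
move=> cL; have := symform_scale 2^-1 (symform_cross invariant_rip cL cL).
congr (symform H _); apply/funext => U; apply/funext => W.
by field.
Qed.

End PhaseForms.

Section FormCombinations.
Context {R : realType} (l : R).
Local Notation cfun := (@cfun R).
Local Notation L2 := (@L2 R l).
Variable F : cfun -> cfun -> R.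
Hypothesis FI : invariant_form l F.

Lemma aeeq_eqL2 (f g : cfun) : L2 f -> L2 g -> aeeq l f g -> eqL2 l f g.
Proof. by move=> Lf Lg fg h Lh; exact: rip_aeeq. Qed.

Lemma form_comb2 (g f1 f2 h : cfun) (a1 a2 : R) :
  L2 g -> L2 f1 -> L2 f2 -> L2 h ->
  aeeq l g (a1%:C *: f1 + a2%:C *: f2) -> F g h = a1 * F f1 h + a2 * F f2 h.
Proof.
move=> Lg L1 L2' Lh ae; have [FS Finv] := FI.
have M1 := L2Z a1%:C L1; have M2 := L2Z a2%:C L2'; have S2 := L2D M1 M2.
rewrite (Finv _ _ _ Lg S2 Lh (aeeq_eqL2 Lg S2 ae)).
by rewrite (symformD FS)// !(symformZ FS).
Qed.

Lemma form_comb3 (g f1 f2 f3 h : cfun) (a1 a2 a3 : R) :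
  L2 g -> L2 f1 -> L2 f2 -> L2 f3 -> L2 h ->
  aeeq l g (a1%:C *: f1 + a2%:C *: f2 + a3%:C *: f3) ->
  F g h = a1 * F f1 h + a2 * F f2 h + a3 * F f3 h.
Proof.
move=> Lg L1 L2' L3 Lh ae; have [FS Finv] := FI.
have M1 := L2Z a1%:C L1; have M2 := L2Z a2%:C L2'; have M3 := L2Z a3%:C L3.
have S2 := L2D M1 M2; have S3 := L2D S2 M3.
rewrite (Finv _ _ _ Lg S3 Lh (aeeq_eqL2 Lg S3 ae)).
by rewrite !(symformD FS)// !(symformZ FS).
Qed.

Lemma form_comb4 (g f1 f2 f3 f4 h : cfun) (a1 a2 a3 a4 : R) :
  L2 g -> L2 f1 -> L2 f2 -> L2 f3 -> L2 f4 -> L2 h ->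
  aeeq l g (a1%:C *: f1 + a2%:C *: f2 + a3%:C *: f3 + a4%:C *: f4) ->
  F g h = a1 * F f1 h + a2 * F f2 h + a3 * F f3 h + a4 * F f4 h.
Proof.
move=> Lg L1 L2' L3 L4 Lh ae; have [FS Finv] := FI.
have M1 := L2Z a1%:C L1; have M2 := L2Z a2%:C L2'; have M3 := L2Z a3%:C L3.
have M4 := L2Z a4%:C L4.
have S2 := L2D M1 M2; have S3 := L2D S2 M3; have S4 := L2D S3 M4.
rewrite (Finv _ _ _ Lg S4 Lh (aeeq_eqL2 Lg S4 ae)).
by rewrite !(symformD FS)// !(symformZ FS).
Qed.

End FormCombinations.

Section EnergyForms.
Context {R : realType} (p : constants R).
Hypothesis hp : positive_constants p.
Local Notation l := (len p).
Local Notation cfun := (@cfun R).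
Local Notation L2 := (@L2 R l).
Local Notation rip := (@real_inner R l).
Local Notation H := (H2 p).
Local Notation dx := (@dx R l).

Definition cphi (U : phase R) : cfun := let: (f, _, _, _, _, _, _, _, _) := U in f.
Definition cu (U : phase R) : cfun := let: (_, f, _, _, _, _, _, _, _) := U in f.
Definition cpsi (U : phase R) : cfun := let: (_, _, f, _, _, _, _, _, _) := U in f.
Definition cv (U : phase R) : cfun := let: (_, _, _, f, _, _, _, _, _) := U in f.
Definition cy (U : phase R) : cfun := let: (_, _, _, _, f, _, _, _, _) := U in f.
Definition cs (U : phase R) : cfun := let: (_, _, _, _, _, f, _, _, _) := U in f.
Definition cz (U : phase R) : cfun := let: (_, _, _, _, _, _, f, _, _) := U in f.
Definition cw (U : phase R) : cfun := let: (_, _, _, _, _, _, _, f, _) := U in f.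
Definition ctheta (U : phase R) : cfun := let: (_, _, _, _, _, _, _, _, f) := U in f.

Let l0 : 0 < l. Proof. by case: hp. Qed.

Lemma H2P U : H U <-> [/\ H10 l (cphi U), H10 l (cpsi U), H10 l (cy U) & H10 l (cz U)] /\
  [/\ L2 (cu U), L2 (cv U), L2 (cs U), L2 (cw U) & L2 (ctheta U)].
Proof. by case: U => [[[[[[[[? ?] ?] ?] ?] ?] ?] ?] ?]. Qed.

Lemma phase_lin (c : R[i]) (f1 f2 f3 f4 f5 f6 f7 f8 f9 g1 g2 g3 g4 g5 g6 g7 g8 g9 : cfun) :
  c *: ((f1, f2, f3, f4, f5, f6, f7, f8, f9) : phase R) +
    (g1, g2, g3, g4, g5, g6, g7, g8, g9) =
  (c *: f1 + g1, c *: f2 + g2, c *: f3 + g3, c *: f4 + g4, c *: f5 + g5,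
   c *: f6 + g6, c *: f7 + g7, c *: f8 + g8, c *: f9 + g9).
Proof. by []. Qed.

Lemma H2_lin (c : R) U W : H U -> H W -> H (c%:C *: U + W).
Proof.
move: U W => [[[[[[[[f1 f2] f3] f4] f5] f6] f7] f8] f9]
  [[[[[[[[g1 g2] g3] g4] g5] g6] g7] g8] g9].
move=> [[? ? ? ?] [? ? ? ? ?]] [[? ? ? ?] [? ? ? ? ?]]; rewrite phase_lin.
by split; split; first [apply: H10_lin | apply: L2_lin].
Qed.

Lemma coordinate_L2 (L : phase R -> cfun) : (forall U, H U -> L2 (L U)) ->
  (forall (c : R) U W, L (c%:C *: U + W) = c%:C *: L U + L W) -> coordinate l H L.
Proof. by move=> HL lin; split=> // c U W _ _ h _; rewrite lin. Qed.

Lemma coordinate_dx (L : phase R -> cfun) : (forall U, H U -> H10 l (L U)) ->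
  (forall (c : R) U W, L (c%:C *: U + W) = c%:C *: L U + L W) ->
  coordinate l H (fun U => dx (L U)).
Proof.
move=> HL lin; split=> [U HU|c U W HU HW]; first exact: L2_dx (HL _ HU).
by rewrite lin; apply: dx_lin => //; exact: HL.
Qed.

Lemma H2_L2 U : H U ->
  [/\ L2 (cphi U), L2 (cpsi U), L2 (cy U) & L2 (cz U)] /\
  [/\ L2 (cu U), L2 (cv U), L2 (cs U), L2 (cw U) & L2 (ctheta U)].
Proof. by move=> /H2P[[? ? ? ?] ?]; split; [split; exact: H10_L2|]. Qed.

Ltac coord := (by apply: coordinate_L2;
  [move=> ? /H2_L2[[? ? ? ?] [? ? ? ? ?]]
  |move=> ? [[[[[[[[? ?] ?] ?] ?] ?] ?] ?] ?] [[[[[[[[? ?] ?] ?] ?] ?] ?] ?] ?];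
   rewrite phase_lin]).

Ltac coord_dx := (by apply: coordinate_dx;
  [move=> ? /H2P[[? ? ? ?] ?]
  |move=> ? [[[[[[[[? ?] ?] ?] ?] ?] ?] ?] ?] [[[[[[[[? ?] ?] ?] ?] ?] ?] ?] ?];
   rewrite phase_lin]).

Lemma coord_phi : coordinate l H cphi. Proof. coord. Qed.
Lemma coord_u : coordinate l H cu. Proof. coord. Qed.
Lemma coord_psi : coordinate l H cpsi. Proof. coord. Qed.
Lemma coord_v : coordinate l H cv. Proof. coord. Qed.
Lemma coord_y : coordinate l H cy. Proof. coord. Qed.
Lemma coord_s : coordinate l H cs. Proof. coord. Qed.
Lemma coord_z : coordinate l H cz. Proof. coord. Qed.
Lemma coord_w : coordinate l H cw. Proof. coord. Qed.
Lemma coord_theta : coordinate l H ctheta.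
Proof. coord. Qed.

Lemma coord_dphi : coordinate l H (fun U => dx (cphi U)).
Proof. coord_dx. Qed.
Lemma coord_dpsi : coordinate l H (fun U => dx (cpsi U)).
Proof. coord_dx. Qed.
Lemma coord_dy : coordinate l H (fun U => dx (cy U)).
Proof. coord_dx. Qed.
Lemma coord_dz : coordinate l H (fun U => dx (cz U)).
Proof. coord_dx. Qed.

(** The terms in [A^(1/2) psi] and [A^(1/2) z] of the phase norm are expressed by first derivatives,
    on which integration by parts acts; the two versions agree by [norm_frac_half]. *)
Definition energy (U W : phase R) : R :=
  rho1 p * rip (cu U) (cu W) + rho2 p * rip (cv U) (cv W)
  + rho3 p * rip (cs U) (cs W) + rho4 p * rip (cw U) (cw W)
  + b1 p * rip (dx (cpsi U)) (dx (cpsi W)) + b2 p * rip (dx (cz U)) (dx (cz W))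
  + kappa1 p * rip (dx (cphi U) - cpsi U) (dx (cphi W) - cpsi W)
  + kappa2 p * rip (dx (cy U) - cz U) (dx (cy W) - cz W)
  + jj p * rip (cy U - cphi U) (cy W - cphi W) + rho5 p * rip (ctheta U) (ctheta W).

Lemma symform_energy : symform H energy.
Proof.
have HL := H2_lin; have D := coordinateB (l := l) HL.
have sq := symform_square (l := l) HL.
have A := symform_scale (rho1 p) (sq _ coord_u).
have {}A := symform_add (rho2 p) A (sq _ coord_v).
have {}A := symform_add (rho3 p) A (sq _ coord_s).
have {}A := symform_add (rho4 p) A (sq _ coord_w).
have {}A := symform_add (b1 p) A (sq _ coord_dpsi).
have {}A := symform_add (b2 p) A (sq _ coord_dz).
have {}A := symform_add (kappa1 p) A (sq _ (D _ _ coord_dphi coord_psi)).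
have {}A := symform_add (kappa2 p) A (sq _ (D _ _ coord_dy coord_z)).
have {}A := symform_add (jj p) A (sq _ (D _ _ coord_y coord_phi)).
have {}A := symform_add (rho5 p) A (sq _ coord_theta).
exact: A.
Qed.

Lemma energy_ge0 U : 0 <= energy U U.
Proof.
have [_ [[? ? ? ? ?] [[? ? ? ? ?] _]]] := hp.
by rewrite /energy !addr_ge0// mulr_ge0 ?rip_ge0// ltW.
Qed.

Lemma normH2E U : H U -> normH2 p U = formnorm energy U.
Proof.
move: U => [[[[[[[[phi u] psi] v] y] s] z] w] theta] [[_ Hpsi _ Hz] _].
have Epsi := norm_frac_half l0 Hpsi; have Ez := norm_frac_half l0 Hz.
rewrite /formnorm /normH2; move: (norm_frac l _ psi) (norm_frac l _ z) Epsi Ez.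
by move=> a b -> ->; rewrite !(norm2_sqr l).
Qed.

(* The first group is [rho <velocity, position>]; the last term compensates the
   missing damping of [v] through the coupling [delta A v] of the heat equation. *)
Definition crossform (m : R) (U W : phase R) : R :=
  rho1 p * (rip (cu U) (cphi W) + rip (cphi U) (cu W))
  + rho2 p * (rip (cv U) (cpsi W) + rip (cpsi U) (cv W))
  + rho3 p * (rip (cs U) (cy W) + rip (cy U) (cs W))
  + rho4 p * (rip (cw U) (cz W) + rip (cz U) (cw W))
  + m * rho5 p * (invrip l (ctheta U) (cv W) + invrip l (cv U) (ctheta W)).

Lemma symform_crossform m : symform H (crossform m).
Proof.
have HL := H2_lin; have cross := symform_cross (l := l) HL.
have ir := invariant_rip l; have ii := invariant_invrip l0.
have A := symform_scale (rho1 p) (cross _ _ _ ir coord_u coord_phi).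
have {}A := symform_add (rho2 p) A (cross _ _ _ ir coord_v coord_psi).
have {}A := symform_add (rho3 p) A (cross _ _ _ ir coord_s coord_y).
have {}A := symform_add (rho4 p) A (cross _ _ _ ir coord_w coord_z).
have {}A := symform_add (m * rho5 p) A (cross _ _ _ ii coord_theta coord_v).
exact: A.
Qed.

End EnergyForms.

(** * The energy balance and the derivative of the cross form *)

Section Identities.
#[local] Opaque real_inner Defs.dx invrip Defs.L2 Defs.H10.
Context {R : realType} (p : constants R).
Hypothesis hp : positive_constants p.
Local Notation l := (len p).
Local Notation cfun := (@cfun R).
Local Notation L2 := (@L2 R l).
Local Notation rip := (@real_inner R l).
Local Notation H := (H2 p).
Local Notation dx := (@dx R l).
Variables beta1 beta2 beta3 : R.
Let l0 : 0 < l. Proof. by case: hp. Qed.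

Definition dissipation (Pu Ps Pw : cfun) (U : phase R) : R :=
  gamma1 p * rip Pu (cu U) + gamma2 p * rip Ps (cs U) + gamma3 p * rip Pw (cw U)
  + KK p * rip (dx (ctheta U)) (dx (ctheta U)).

(** In the energy every conservative term cancels: shear against position equations, and the two
    thermal couplings [delta A theta], [delta A v] against each other. In the cross form the
    potential energy appears with a minus sign and the kinetic one with a plus sign. *)
Lemma B2_identities m U G : B2 p beta1 beta2 beta3 U G ->
  exists Pu Ps Pw : cfun,
  [/\ frac_power l beta1 (cu U) Pu, frac_power l beta2 (cs U) Ps,
      frac_power l beta3 (cw U) Pw,
      [/\ H U, H G & H10 l (ctheta U)] &
      energy p G U = - dissipation Pu Ps Pw U /\
      crossform p m G U =
        rho1 p * rip (cu U) (cu U) + rho2 p * rip (cv U) (cv U)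
      + rho3 p * rip (cs U) (cs U) + rho4 p * rip (cw U) (cw U)
      - kappa1 p * rip (dx (cphi U) - cpsi U) (dx (cphi U) - cpsi U)
      - b1 p * rip (dx (cpsi U)) (dx (cpsi U))
      - kappa2 p * rip (dx (cy U) - cz U) (dx (cy U) - cz U)
      - b2 p * rip (dx (cz U)) (dx (cz U))
      - jj p * rip (cy U - cphi U) (cy U - cphi U)
      - gamma1 p * rip Pu (cphi U) - gamma2 p * rip Ps (cy U)
      - gamma3 p * rip Pw (cz U)
      + delta p * rip (dx (ctheta U)) (dx (cpsi U))
      + m * (- KK p * rip (ctheta U) (cv U) - delta p * rip (cv U) (cv U))
      + m * (rho5 p / rho2 p) *
          (- b1 p * rip (cpsi U) (ctheta U)
           + kappa1 p * invrip l (dx (cphi U) - cpsi U) (ctheta U)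
           + delta p * rip (ctheta U) (ctheta U))].
Proof.
have [_ [[r1 r2 r3 r4 r5] _]] := hp.
move: U G => [[[[[[[[phi u] psi] v] y] s] z] w] theta]
  [[[[[[[[g1 g2] g3] g4] g5] g6] g7] g8] g9].
move=> [[HU [[Hu Hv Hs Hw] [[At lapt] _ _ _ _]]] HG].
move=> [Aphi [Apsi [Ay [Az [Atheta [Av [Pu [Ps [Pw]]]]]]]]].
move=> [[lphi lpsi ly lz] [ltheta lv] [fu fs fw] [a1 a3 a5 a7] [a2 a4 a6 a8 a9]].
exists Pu, Ps, Pw; split => //; first by have [] := laplacian_H10 lapt.
have [[Hphi Hpsi Hy Hz] [Lu Lv Ls Lw Lt]] := HU.
have [[Hg1 Hg3 Hg5 Hg7] [Lg2 Lg4 Lg6 Lg8 Lg9]] := HG.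
have [Ht _ LAt] := laplacian_H10 ltheta; have [_ _ LAv] := laplacian_H10 lv.
have [_ Lphi LAphi] := laplacian_H10 lphi; have [_ Lpsi LApsi] := laplacian_H10 lpsi.
have [_ Ly LAy] := laplacian_H10 ly; have [_ Lz LAz] := laplacian_H10 lz.
have [_ LPu _] := fu; have [_ LPs _] := fs; have [_ LPw _] := fw.
have Lg1 := H10_L2 Hg1; have Lg3 := H10_L2 Hg3.
have Lg5 := H10_L2 Hg5; have Lg7 := H10_L2 Hg7.
have Ldphi := L2_dx Hphi; have Ldpsi := L2_dx Hpsi.
have Ldy := L2_dx Hy; have Ldz := L2_dx Hz; have Ldt := L2_dx Ht.
have Ldu := L2_dx Hu; have Ldv := L2_dx Hv; have Lds := L2_dx Hs; have Ldw := L2_dx Hw.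
have Ldg1 := L2_dx Hg1; have Ldg3 := L2_dx Hg3.
have Ldg5 := L2_dx Hg5; have Ldg7 := L2_dx Hg7.
have LD := L2B Ly Lphi; have LP1 := L2B Ldphi Lpsi; have LP2 := L2B Ldy Lz.
have e1 := aeeq_eqL2 Lg1 Lu a1; have e3 := aeeq_eqL2 Lg3 Lv a3.
have e5 := aeeq_eqL2 Lg5 Ls a5; have e7 := aeeq_eqL2 Lg7 Lw a7.
have de f g : H10 l f -> H10 l g -> eqL2 l f g -> eqL2 l (dx f) (dx g).
  by move=> /dxP Hf /dxP Hg; exact: H10_derivative_unique.
have d1 := de _ _ Hg1 Hu e1; have d3 := de _ _ Hg3 Hv e3.
have d5 := de _ _ Hg5 Hs e5; have d7 := de _ _ Hg7 Hw e7.
rewrite -!scaleNr -!real_scaleN in a2 a4 a6 a8 a9.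
have ir := invariant_rip l; have ii := invariant_invrip l0.
(* The evolution equations tested with [h]. Those for [v] and [theta] are kept for a general form
   [F], because they are paired both by the L^2 product and through the inverse of [A]. *)
have E2 h : L2 h -> rho1 p * rip g2 h = - kappa1 p * rip Aphi h
    - kappa1 p * rip (dx psi) h + jj p * rip (y - phi) h - gamma1 p * rip Pu h.
  move=> Lh; rewrite (form_comb4 ir Lg2 LAphi Ldpsi LD LPu Lh a2).
  by field; rewrite gt_eqF.
have E4 F h : invariant_form l F -> L2 h -> rho2 p * F g4 h = - b1 p * F Apsi h
    + kappa1 p * F (dx phi - psi) h + delta p * F Atheta h.
  move=> FI Lh; rewrite (form_comb3 FI Lg4 LApsi LP1 LAt Lh a4).
  by field; rewrite gt_eqF.
have E6 h : L2 h -> rho3 p * rip g6 h = - kappa2 p * rip Ay h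
    - kappa2 p * rip (dx z) h - jj p * rip (y - phi) h - gamma2 p * rip Ps h.
  move=> Lh; rewrite (form_comb4 ir Lg6 LAy Ldz LD LPs Lh a6).
  by field; rewrite gt_eqF.
have E8 h : L2 h -> rho4 p * rip g8 h = - b2 p * rip Az h
    + kappa2 p * rip (dx y - z) h - gamma3 p * rip Pw h.
  move=> Lh; rewrite (form_comb3 ir Lg8 LAz LP2 LPw Lh a8).
  by field; rewrite gt_eqF.
have E9 F h : invariant_form l F -> L2 h ->
    rho5 p * F g9 h = - KK p * F Atheta h - delta p * F Av h.
  move=> FI Lh; rewrite (form_comb2 FI Lg9 LAt LAv Lh a9).
  by field; rewrite gt_eqF.
have lap f Af h : laplacian l f Af -> H10 l h -> rip Af h = rip (dx f) (dx h).
  by move=> lf /dxP Hh; exact: laplacian_rip lf Hh.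
have skew f g : H10 l f -> H10 l g -> rip (dx f) g = - rip (dx g) f.
  by move=> /dxP Hf /dxP Hg; rewrite -[LHS]opprK -(H10_skew l0 Hf Hg) ripC.
have inv f Af h : laplacian l f Af -> L2 h -> invrip l Af h = rip f h.
  exact: laplacian_invrip.
have E4r h := E4 _ h ir; have E4i h := E4 _ h ii.
have E9r h := E9 _ h ir; have E9i h := E9 _ h ii.
have rC := @ripC R l; have rBl := @ripBl R l; have rBB := @ripBB R l.
rewrite /energy /crossform /dissipation.
cbv beta iota delta [cphi cu cpsi cv cy cs cz cw ctheta].
rewrite /eqL2 in e1 e3 e5 e7 d1 d3 d5 d7.
(* Generalizing over the scalar products keeps unification away from their definitions. *)
clear E4 E9 ir ii de.
move: (real_inner l) (Defs.dx l) (invrip l) E2 E4r E4i E6 E8 E9r E9i lap skew inv rC rBl rBB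
  e1 e3 e5 e7 d1 d3 d5 d7 Ldphi Ldpsi Ldy Ldz Ldt Ldu Ldv Lds Ldw Ldg1 Ldg3 Ldg5 Ldg7 LP1 LP2.
move=> r d iv E2 E4r E4i E6 E8 E9r E9i lap skew inv rC rBl rBB
  e1 e3 e5 e7 d1 d3 d5 d7 Ldphi Ldpsi Ldy Ldz Ldt Ldu Ldv Lds Ldw Ldg1 Ldg3 Ldg5 Ldg7 LP1 LP2.
have Dphi := lap _ _ _ lphi; have Dpsi := lap _ _ _ lpsi; have Dy := lap _ _ _ ly.
have Dz := lap _ _ _ lz; have Dt := lap _ _ _ ltheta; have Dv := lap _ _ _ lv.
split.
  have D3 : r (d g3) (d psi) = r (d psi) (d v) by rewrite d3.
  have D7 : r (d g7) (d z) = r (d z) (d w) by rewrite d7.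
  rewrite D3 D7 E2// E4r// E6// E8// E9r// !rBB// Dphi// Dpsi// Dy// Dz// !Dt// Dv//.
  rewrite !(rBl _ _ _ Ly Lphi)// !(rBl _ _ _ Ldphi Lpsi)// !(rBl _ _ _ Ldy Lz)//.
  rewrite !d1// !d5// !e1// !e3// !e5// !e7//.
  (* Moving the derivative onto the velocity makes the terms in [psi_x] and [z_x] cancel the mixed
     terms of the shear energies. *)
  rewrite (skew _ _ Hpsi Hu) (skew _ _ Hz Hs).
  rewrite (rC (d u) (d phi)) (rC v (d phi)) (rC v psi) (rC (d s) (d y)).
  rewrite (rC w (d y)) (rC w z) (rC s y) (rC s phi) (rC u y) (rC u phi) (rC (d v)).
  ring.
rewrite !mulrDr E2// E4r// E6// E8//.
rewrite -[m * rho5 p * iv g9 v]mulrA E9i//.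
(* The product is weighted by the heat capacity [rho5], whereas the equation for [v] gives [rho2]
   times its time derivative. *)
have -> : m * rho5 p * iv g4 theta = m * (rho5 p / rho2 p) * (rho2 p * iv g4 theta).
  by field; rewrite gt_eqF.
rewrite E4i// (inv _ _ _ ltheta)// (inv _ _ _ lv)// (inv _ _ _ lpsi)// (inv _ _ _ ltheta)//.
rewrite Dphi// Dpsi// Dy// Dz// Dt// !rBB//.
rewrite !(rBl _ _ _ Ly Lphi)// !(rBl _ _ _ Ldphi Lpsi)// !(rBl _ _ _ Ldy Lz)//.
rewrite !e1// !e3// !e5// !e7// (skew _ _ Hpsi Hphi) (skew _ _ Hz Hy).
rewrite (rC psi (d phi)) (rC z (d y)) (rC phi y).
ring.
Qed.

End Identities.

(** * The differential inequality *)

Ltac nonneg := repeat first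
  [by []|assumption|apply: ltW; assumption|apply: addr_ge0|apply: mulr_ge0|rewrite invr_ge0].

(** One constant below all weights lets the energy and the dissipation be compared with unweighted
    sums. *)
Lemma common_lower_bound (R : realType) (s : seq R) : all (fun x => 0 < x) s ->
  exists mu, 0 < mu /\ all (fun x => mu <= x) s.
Proof.
elim: s => [_|x s IH /= /andP[x0 /IH[mu [mu0 mus]]]]; first by exists 1.
exists (Num.min x mu); rewrite lt_min x0 mu0 ge_min lexx; split => //=.
by apply: sub_all mus => y; apply: le_trans; rewrite ge_min lexx orbT.
Qed.

Lemma ler_mem_sum (R : realType) (s : seq R) x :
  all (fun y => 0 <= y) s -> x \in s -> x <= \sum_(y <- s) y.
Proof.
move=> s0 xs; rewrite (big_rem x)//= lerDl big_seq sumr_ge0// => y /mem_rem ys.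
exact: (allP s0).
Qed.

(** Sorts a Young estimate into a dissipated share [D], which may have any coefficient, and an
    energy share [S], whose coefficient carries the small factor [q]. *)
Lemma weighted_young (R : realType) (c e T q x y k k' D S : R) :
  0 <= c -> 0 <= T -> 0 <= q -> e <= T / 2 * x + q * y -> x <= k * D -> y <= k' * S ->
  c * e <= c * (T / 2) * k * D + c * k' * (q * S).
Proof.
move=> c0 T0 q0 h hx hy.
have h1 : T / 2 * x <= T / 2 * (k * D) by rewrite ler_wpM2l// divr_ge0.
have h2 : q * y <= q * (k' * S) by rewrite ler_wpM2l.
have : c * e <= c * (T / 2 * (k * D) + q * (k' * S)) by rewrite ler_wpM2l//; lra.
by move/le_trans; apply; rewrite le_eqVlt; apply/orP; left; apply/eqP; ring.
Qed.

(* Here [X] is the energy, [x1, ..., x4] are the four dissipated quantities, and the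
   [e_i] are the terms of indefinite sign in the derivative [J] of the cross form. *)
Lemma lyapunov_arith (R : realType)
    (r1 r2 r3 r4 r5 k1 k2 B1 B2 j g1 g2 g3 dl K la c1 c2 c3 l1 l2 l3 : R) :
  all (fun x => 0 < x) [:: r1; r2; r3; r4; r5; k1; k2; B1; B2; j] ->
  all (fun x => 0 < x) [:: g1; g2; g3; K] -> 0 < dl ->
  all (fun x => 0 < x) [:: la; c1; c2; c3; l1; l2; l3] ->
  exists C, 0 <= C /\
  forall uu vv ss ww tt pp zz a1 a2 dd psi2 z2 dphi2 dy2
    x1 x2 x3 x4 e1 e2 e3 e4 e5 e6 e7 X m : R,
  all (fun x => 0 <= x) [:: uu; vv; ss; ww; pp; zz; a1; a2; dd; tt] ->
  psi2 <= la * pp -> z2 <= la * zz ->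
  dphi2 <= 2 * a1 + 2 * psi2 -> dy2 <= 2 * a2 + 2 * z2 ->
  l1 * uu <= x1 -> l2 * ss <= x2 -> l3 * ww <= x3 -> tt <= la * x4 ->
  (forall T, 0 < T -> `|e1| <= T / 2 * x1 + (2 * T)^-1 * (c1 * dphi2)) ->
  (forall T, 0 < T -> `|e2| <= T / 2 * x2 + (2 * T)^-1 * (c2 * dy2)) ->
  (forall T, 0 < T -> `|e3| <= T / 2 * x3 + (2 * T)^-1 * (c3 * zz)) ->
  (forall T, 0 < T -> `|e4| <= T / 2 * x4 + (2 * T)^-1 * pp) ->
  (forall T, 0 < T -> `|e5| <= T / 2 * tt + (2 * T)^-1 * vv) ->
  (forall T, 0 < T -> `|e6| <= T / 2 * tt + (2 * T)^-1 * psi2) ->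
  (forall T, 0 < T -> `|e7| <= la * (T / 2 * tt + (2 * T)^-1 * a1)) ->
  X = r1 * uu + r2 * vv + r3 * ss + r4 * ww + B1 * pp + B2 * zz + k1 * a1
    + k2 * a2 + j * dd + r5 * tt ->
  m = 2 * r2 / dl ->
  r1 * uu + r2 * vv + r3 * ss + r4 * ww - k1 * a1 - B1 * pp - k2 * a2 - B2 * zz
  - j * dd - g1 * e1 - g2 * e2 - g3 * e3 + dl * e4 + m * (- K * e5 - dl * vv)
  + m * (r5 / r2) * (- B1 * e6 + k1 * e7 + dl * tt)
  <= - (2^-1 * X) + C * (g1 * x1 + g2 * x2 + g3 * x3 + K * x4).
Proof.
move=> rpos gpos dl0 lpos.
have [mu [mu0 muP]] := common_lower_bound rpos.
have [ga [ga0 gaP]] := common_lower_bound gpos.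
case/and5P: rpos => r10 r20 r30 r40 /and5P[r50 k10 k20 B10] /and3P[B20 j0 _].
case/and5P: gpos => g10 g20 g30 K0 _.
case/and5P: lpos => la0 c10 c20 c30 /and4P[l10 l20 l30 _].
case/and5P: muP => mr1 mr2 mr3 mr4 /and5P[mr5 mk1 mk2 mB1] /and3P[mB2 mj _].
case/and5P: gaP => mg1 mg2 mg3 mK _.
pose m := 2 * r2 / dl; have m0 : 0 < m by rewrite divr_gt0// mulr_gt0.
pose n := m * (r5 / r2); have n0 : 0 < n by rewrite mulr_gt0// divr_gt0.
(* The total coefficient of [q S] over the seven Young estimates; [CA] below is the total
   coefficient of [D]. *)
pose CB := g1 * (c1 * (2 + 2 * la)) + g2 * (c2 * (2 + 2 * la)) + g3 * c3 + dl * 1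
  + m * K * 1 + n * B1 * la + n * k1 * la.
have q1 : 0 < 2 + 2 * la by rewrite addr_gt0// mulr_gt0.
have CB0 : 0 <= CB.
  by rewrite /CB; nonneg.
(* Large enough that [CB q <= mu / 2]: the energy shares then cost at most half of [X]. *)
pose T := CB / mu + 1; have T0 : 0 < T by rewrite ltr_wpDl// divr_ge0// ltW.
pose q := (2 * T)^-1; have q0 : 0 < q by rewrite invr_gt0 mulr_gt0.
pose CA := 2 * r1 / l1 + 2 * r3 / l2 + 2 * r4 / l3 + r5 * la + g1 * (T / 2) * 1
  + g2 * (T / 2) * 1 + g3 * (T / 2) * 1 + dl * (T / 2) * 1 + m * K * (T / 2) * la
  + n * B1 * (T / 2) * la + n * k1 * (T / 2) * (la * la) + n * dl * la.
have T20 : 0 < T / 2 by rewrite divr_gt0.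
have CA0 : 0 <= CA.
  by rewrite /CA; nonneg.
exists (CA / ga); split; first by rewrite divr_ge0// ltW.
move=> uu vv ss ww tt pp zz a1 a2 dd psi2 z2 dphi2 dy2 x1 x2 x3 x4 e1 e2 e3 e4 e5 e6 e7 X m'.
move=> all0; have := all0.
case/and5P => uu0 vv0 ss0 ww0 /and5P[pp0 zz0 a10 a20] /and3P[dd0 tt0 _].
move=> psiP zP dphiP dyP h1 h2 h3 h4 E1 E2 E3 E4 E5 E6 E7 XE ->.
rewrite -/m -/n.
have x10 : 0 <= x1 by apply: le_trans h1; rewrite mulr_ge0// ltW.
have x20 : 0 <= x2 by apply: le_trans h2; rewrite mulr_ge0// ltW.
have x30 : 0 <= x3 by apply: le_trans h3; rewrite mulr_ge0// ltW.
have x40 : 0 <= x4 by rewrite -(pmulr_rge0 _ la0) (le_trans tt0).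
pose D := x1 + x2 + x3 + x4; pose S := uu + vv + ss + ww + pp + zz + a1 + a2 + dd + tt.
have D_ge x : x \in [:: x1; x2; x3; x4] -> x <= D.
  have -> : D = \sum_(y <- [:: x1; x2; x3; x4]) y.
    by rewrite !big_cons big_nil addr0 !addrA.
  by apply: ler_mem_sum; rewrite /= x10 x20 x30 x40.
have S_ge x : x \in [:: uu; vv; ss; ww; pp; zz; a1; a2; dd; tt] -> x <= S.
  have -> : S = \sum_(y <- [:: uu; vv; ss; ww; pp; zz; a1; a2; dd; tt]) y.
    by rewrite !big_cons big_nil addr0 !addrA.
  by apply: ler_mem_sum.
have S0 : 0 <= S by apply: le_trans uu0 (S_ge _ _); rewrite !inE eqxx.
have laS x : x \in [:: uu; vv; ss; ww; pp; zz; a1; a2; dd; tt] -> la * x <= la * S.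
  by move=> xs; rewrite ler_wpM2l ?S_ge// ltW.
have SX : mu * S <= X.
  by rewrite XE /S !mulrDr; repeat (apply: lerD); rewrite ler_wpM2r.
have DD : ga * D <= g1 * x1 + g2 * x2 + g3 * x3 + K * x4.
  by rewrite /D !mulrDr; repeat (apply: lerD); rewrite ler_wpM2r.
have bd (c' y : R) : 0 < c' -> y <= (2 + 2 * la) * S -> c' * y <= c' * (2 + 2 * la) * S.
  by move=> c'0 yS; rewrite -mulrA ler_wpM2l// ltW.
have dphiS : dphi2 <= (2 + 2 * la) * S.
  rewrite mulrDl -mulrA; apply: le_trans dphiP _; apply: lerD; rewrite ler_wpM2l//.
    by apply: S_ge; rewrite !inE eqxx ?orbT.
  by apply: le_trans psiP _; apply: laS; rewrite !inE eqxx ?orbT.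
have dyS : dy2 <= (2 + 2 * la) * S.
  rewrite mulrDl -mulrA; apply: le_trans dyP _; apply: lerD; rewrite ler_wpM2l//.
    by apply: S_ge; rewrite !inE eqxx ?orbT.
  by apply: le_trans zP _; apply: laS; rewrite !inE eqxx ?orbT.
have n1 (e b : R) : `|e| <= b -> - e <= b /\ e <= b.
  by rewrite ler_norml lerNl => /andP[].
have [E1' _] := n1 _ _ (E1 _ T0); have [E2' _] := n1 _ _ (E2 _ T0).
have [E3' _] := n1 _ _ (E3 _ T0); have [_ E4'] := n1 _ _ (E4 _ T0).
have [E5' _] := n1 _ _ (E5 _ T0); have [E6' _] := n1 _ _ (E6 _ T0).
have [_ E7'] := n1 _ _ (E7 _ T0).
have q0' := ltW q0; have T0' := ltW T0.
have mK0 : 0 <= m * K by rewrite mulr_ge0// ltW.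
have nB0 : 0 <= n * B1 by rewrite mulr_ge0// ltW.
have nk0 : 0 <= n * k1 by rewrite mulr_ge0// ltW.
have ttD : tt <= la * D.
  apply: le_trans h4 _; rewrite ler_wpM2l ?(ltW la0)//.
  by apply: D_ge; rewrite !inE eqxx ?orbT.
have E7'' : e7 <= T / 2 * (la * tt) + q * (la * a1).
  by apply: le_trans E7' _; rewrite le_eqVlt; apply/orP; left; apply/eqP; rewrite /q; ring.
have D1 x : x \in [:: x1; x2; x3; x4] -> x <= 1 * D by rewrite mul1r; exact: D_ge.
have S1 x : x \in [:: uu; vv; ss; ww; pp; zz; a1; a2; dd; tt] -> x <= 1 * S.
  by rewrite mul1r; exact: S_ge.
have F1 : g1 * - e1 <= g1 * (T / 2) * 1 * D + g1 * (c1 * (2 + 2 * la)) * (q * S).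
  apply: (weighted_young _ _ _ E1'); [exact: ltW|by []|by []| |exact: bd].
  by apply: D1; rewrite !inE eqxx ?orbT.
have F2 : g2 * - e2 <= g2 * (T / 2) * 1 * D + g2 * (c2 * (2 + 2 * la)) * (q * S).
  apply: (weighted_young _ _ _ E2'); [exact: ltW|by []|by []| |exact: bd].
  by apply: D1; rewrite !inE eqxx ?orbT.
have F3 : g3 * - e3 <= g3 * (T / 2) * 1 * D + g3 * c3 * (q * S).
  apply: (weighted_young _ _ _ E3'); [exact: ltW|by []|by []| |].
    by apply: D1; rewrite !inE eqxx ?orbT.
  by rewrite ler_wpM2l ?(ltW c30)// S_ge// !inE eqxx ?orbT.
have F4 : dl * e4 <= dl * (T / 2) * 1 * D + dl * 1 * (q * S).
  apply: (weighted_young _ _ _ E4'); [exact: ltW|by []|by []| |].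
    by apply: D1; rewrite !inE eqxx ?orbT.
  by apply: S1; rewrite !inE eqxx ?orbT.
have F5 : m * K * - e5 <= m * K * (T / 2) * la * D + m * K * 1 * (q * S).
  apply: (weighted_young mK0 _ _ E5' ttD) => //.
  by apply: S1; rewrite !inE eqxx ?orbT.
have F6 : n * B1 * - e6 <= n * B1 * (T / 2) * la * D + n * B1 * la * (q * S).
  apply: (weighted_young nB0 _ _ E6' ttD) => //.
  by apply: le_trans psiP _; apply: laS; rewrite !inE eqxx ?orbT.
have F7 : n * k1 * e7 <= n * k1 * (T / 2) * (la * la) * D + n * k1 * la * (q * S).
  apply: (weighted_young nk0 _ _ E7'') => //.
    by rewrite -mulrA ler_wpM2l// ltW.
  by apply: laS; rewrite !inE eqxx ?orbT.
have F8 : n * dl * tt <= n * dl * (la * D) by rewrite ler_wpM2l// mulr_ge0// ltW.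
have G r l x y : 0 < r -> 0 < l -> l * y <= x -> x <= D -> 2 * r * y <= 2 * r / l * D.
  move=> rr ll lyx xD; rewrite [leRHS]mulrAC -[leRHS]mulrA ler_wpM2l ?mulr_ge0 ?(ltW rr)//.
  by rewrite ler_pdivlMr// mulrC (le_trans lyx).
have F9 : 2 * r1 * uu <= 2 * r1 / l1 * D.
  by apply: G h1 (D_ge _ _); rewrite // !inE eqxx ?orbT.
have F10 : 2 * r3 * ss <= 2 * r3 / l2 * D.
  by apply: G h2 (D_ge _ _); rewrite // !inE eqxx ?orbT.
have F11 : 2 * r4 * ww <= 2 * r4 / l3 * D.
  by apply: G h3 (D_ge _ _); rewrite // !inE eqxx ?orbT.
have F12 : r5 * tt <= r5 * (la * D) by rewrite ler_wpM2l// ltW.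
(* Completing the left side to [- X] leaves twice each kinetic term; this cancels the one in [vv],
   the only one not bounded by [D]. *)
have mdl : m * (dl * vv) = 2 * (r2 * vv) by rewrite /m; field; rewrite gt_eqF.
have AD : CA * D <= CA / ga * (g1 * x1 + g2 * x2 + g3 * x3 + K * x4).
  by rewrite -mulrA ler_wpM2l// mulrC ler_pdivlMr// mulrC.
have BS : CB * (q * S) <= 2^-1 * X.
  have : CB / mu <= T by rewrite /T lerDl.
  rewrite ler_pdivrMr// => CT.
  have : CB * (q * S) <= T * mu * (q * S) by rewrite ler_wpM2r// mulr_ge0.
  move/le_trans; apply.
  have -> : T * mu * (q * S) = 2^-1 * (mu * S) by rewrite /q; field; rewrite gt_eqF.
  by rewrite ler_wpM2l.
have sum : - (g1 * e1) - g2 * e2 - g3 * e3 + dl * e4 - m * K * e5 - n * B1 * e6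
    + n * k1 * e7 + n * dl * tt + 2 * r1 * uu + 2 * r3 * ss + 2 * r4 * ww + r5 * tt
    <= CA * D + CB * (q * S).
  rewrite /CA /CB; move: F1 F2 F3 F4 F5 F6 F7 F8 F9 F10 F11 F12; clear.
  by move=> *; lra.
move: sum AD BS mdl; rewrite XE; clear => *; lra.
Qed.

(** The cross form is bounded by the energy. Each product carries a factor 2 because the form is
    evaluated on the diagonal. *)
Lemma cross_arith (R : realType) (r1 r2 r3 r4 r5 k1 k2 B1 B2 j la m : R) :
  all (fun x => 0 < x) [:: r1; r2; r3; r4; r5; k1; k2; B1; B2; j] ->
  0 < la -> 0 <= m ->
  exists C, 0 <= C /\
  forall uu vv ss ww tt pp zz a1 a2 dd phi2 y2 psi2 z2 dphi2 dy2 e1 e2 e3 e4 e5 : R,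
  all (fun x => 0 <= x) [:: uu; vv; ss; ww; pp; zz; a1; a2; dd; tt] ->
  psi2 <= la * pp -> z2 <= la * zz ->
  dphi2 <= 2 * a1 + 2 * psi2 -> dy2 <= 2 * a2 + 2 * z2 ->
  phi2 <= la * dphi2 -> y2 <= la * dy2 ->
  `|e1| <= 1 / 2 * uu + (2 * 1)^-1 * phi2 -> `|e2| <= 1 / 2 * vv + (2 * 1)^-1 * psi2 ->
  `|e3| <= 1 / 2 * ss + (2 * 1)^-1 * y2 -> `|e4| <= 1 / 2 * ww + (2 * 1)^-1 * z2 ->
  `|e5| <= la * (1 / 2 * tt + (2 * 1)^-1 * vv) ->
  `|r1 * (e1 + e1) + r2 * (e2 + e2) + r3 * (e3 + e3) + r4 * (e4 + e4)
    + m * r5 * (e5 + e5)| <=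
  C * (r1 * uu + r2 * vv + r3 * ss + r4 * ww + B1 * pp + B2 * zz + k1 * a1
    + k2 * a2 + j * dd + r5 * tt).
Proof.
move=> rpos la0 m0; have [mu [mu0 muP]] := common_lower_bound rpos.
case/and5P: rpos => r10 r20 r30 r40 /and5P[r50 k10 k20 B10] /and3P[B20 j0 _].
case/and5P: muP => mr1 mr2 mr3 mr4 /and5P[mr5 mk1 mk2 mB1] /and3P[mB2 mj _].
(* The worst case is a displacement: one Poincare step reaches its derivative, which splits into
   shear and rotation, and a second Poincare step treats the rotation. *)
pose kk := 1 + la + la * (2 + 2 * la).
pose c := r1 + r2 + r3 + r4 + m * r5.
have kk0 : 0 <= kk by rewrite /kk; nonneg.
have c0 : 0 <= c by rewrite /c; nonneg.
exists (c * kk / mu); split; first by rewrite divr_ge0 ?mulr_ge0// ltW.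
move=> uu vv ss ww tt pp zz a1 a2 dd phi2 y2 psi2 z2 dphi2 dy2 e1 e2 e3 e4 e5.
move=> all0; have := all0.
case/and5P => uu0 vv0 ss0 ww0 /and5P[pp0 zz0 a10 a20] /and3P[dd0 tt0 _].
move=> psiP zP dphiP dyP phiP yP E1 E2 E3 E4 E5.
set X := (X in _ <= _ * X).
pose S := uu + vv + ss + ww + pp + zz + a1 + a2 + dd + tt.
have SX : mu * S <= X.
  by rewrite /X /S !mulrDr; repeat (apply: lerD); rewrite ler_wpM2r.
have M x k : 0 <= k -> 0 <= x -> 0 <= k * x by exact: mulr_ge0.
have las x : 0 <= x -> 0 <= la * x by apply: M; exact: ltW.
have las2 x : 0 <= x -> 0 <= la * (la * x) by move=> x0; exact: las (las _ x0).
have dphiP' : la * dphi2 <= la * (2 * a1 + 2 * (la * pp)).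
  by rewrite ler_wpM2l ?(ltW la0)//; lra.
have dyP' : la * dy2 <= la * (2 * a2 + 2 * (la * zz)).
  by rewrite ler_wpM2l ?(ltW la0)//; lra.
have kS : kk * S = S + la * S + 2 * (la * S) + 2 * (la * (la * S)) by rewrite /kk; ring.
have sub x : x \in [:: uu; vv; ss; ww; pp; zz; a1; a2; dd; tt] -> x <= S.
  have -> : S = \sum_(y <- [:: uu; vv; ss; ww; pp; zz; a1; a2; dd; tt]) y.
    by rewrite !big_cons big_nil addr0 !addrA.
  by apply: ler_mem_sum.
have lsub x : x \in [:: uu; vv; ss; ww; pp; zz; a1; a2; dd; tt] -> la * x <= la * S.
  by move=> xs; rewrite ler_wpM2l ?sub// ltW.
have l2sub x : x \in [:: uu; vv; ss; ww; pp; zz; a1; a2; dd; tt] ->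
    la * (la * x) <= la * (la * S).
  by move=> xs; rewrite ler_wpM2l ?lsub// ltW.
have S0 : 0 <= S by apply: le_trans uu0 (sub _ _); rewrite !inE eqxx.
have lS0 := las _ S0; have l2S0 := las2 _ S0.
have n2 (e b : R) : `|e| <= b -> `|e + e| <= 2 * b.
  by move=> eb; rewrite (le_trans (ler_normD _ _))//; lra.
have K1 : `|e1 + e1| <= kk * S.
  apply: le_trans (n2 _ _ E1) _.
  have h1 := sub uu; have h2 := lsub a1; have h3 := l2sub pp.
  rewrite !inE !eqxx ?orbT in h1 h2 h3; rewrite kS.
  move: (h1 isT) (h2 isT) (h3 isT) phiP dphiP' lS0 l2S0 S0; clear => *; lra.
have K2 : `|e2 + e2| <= kk * S.
  apply: le_trans (n2 _ _ E2) _.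
  have h1 := sub vv; have h2 := lsub pp.
  rewrite !inE !eqxx ?orbT in h1 h2; rewrite kS.
  move: (h1 isT) (h2 isT) psiP lS0 l2S0 S0; clear => *; lra.
have K3 : `|e3 + e3| <= kk * S.
  apply: le_trans (n2 _ _ E3) _.
  have h1 := sub ss; have h2 := lsub a2; have h3 := l2sub zz.
  rewrite !inE !eqxx ?orbT in h1 h2 h3; rewrite kS.
  move: (h1 isT) (h2 isT) (h3 isT) yP dyP' lS0 l2S0 S0; clear => *; lra.
have K4 : `|e4 + e4| <= kk * S.
  apply: le_trans (n2 _ _ E4) _.
  have h1 := sub ww; have h2 := lsub zz.
  rewrite !inE !eqxx ?orbT in h1 h2; rewrite kS.
  move: (h1 isT) (h2 isT) zP lS0 l2S0 S0; clear => *; lra.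
have K5 : `|e5 + e5| <= kk * S.
  apply: le_trans (n2 _ _ E5) _.
  have h1 := lsub tt; have h2 := lsub vv.
  rewrite !inE !eqxx ?orbT in h1 h2; rewrite kS.
  move: (h1 isT) (h2 isT) lS0 l2S0 S0; clear => *; lra.
apply: (@le_trans _ _ (c * (kk * S))); last first.
  rewrite -[leRHS]mulrA -[leRHS]mulrA; apply: ler_wpM2l => //; apply: ler_wpM2l => //.
  by rewrite mulrC ler_pdivlMr// mulrC.
have N k x : 0 <= k -> `|x| <= kk * S -> `|k * x| <= k * (kk * S).
  by move=> k0 xS; rewrite normrM (ger0_norm k0) ler_wpM2l.
have A (x y cx cy : R) : `|x| <= cx -> `|y| <= cy -> `|x + y| <= cx + cy.
  by move=> hx hy; rewrite (le_trans (ler_normD _ _))// lerD.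
have cS t : c * t = r1 * t + r2 * t + r3 * t + r4 * t + m * r5 * t by rewrite /c; ring.
rewrite cS; apply: (A); last by apply: N => //; rewrite mulr_ge0// ltW.
by do 3 (apply: (A); last by apply: N => //; exact: ltW); apply: N => //; exact: ltW.
Qed.

(** * Boundedness of the cross form and the Lyapunov inequality for [B2] *)

Section Stability.
#[local] Opaque real_inner Defs.dx invrip Defs.L2 Defs.H10.
Context {R : realType} (p : constants R).
Hypothesis hp : positive_constants p.
Local Notation l := (len p).
Local Notation cfun := (@cfun R).
Local Notation L2 := (@L2 R l).
Local Notation norm2 := (@norm2 R l).
Local Notation rip := (@real_inner R l).
Local Notation H := (H2 p).
Local Notation dx := (@dx R l).
Local Notation lam := (@eigval R l).
Variables beta1 beta2 beta3 : R.
Hypothesis hbeta1 : 0 <= beta1 <= 1.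
Hypothesis hbeta2 : 0 <= beta2 <= 1.
Hypothesis hbeta3 : 0 <= beta3 <= 1.
Let l0 : 0 < l. Proof. by case: hp. Qed.
Let la := (lam 0)^-1.
Let la0 : 0 < la. Proof. by rewrite invr_gt0 eigval_gt0. Qed.
Let m := 2 * rho2 p / delta p.

Let rpos : all (fun x => 0 < x) [:: rho1 p; rho2 p; rho3 p; rho4 p; rho5 p;
  kappa1 p; kappa2 p; b1 p; b2 p; jj p].
Proof.
have [_ [[? ? ? ? ?] [[? ? ? ? ?] _]]] := hp.
by apply/and5P; split => //; apply/and5P; split => //; apply/and3P; split.
Qed.

(** The energy contains no [phi_x] or [y_x] alone; they are recovered by adding [psi] and [z] to the
    shears, and these are controlled by Poincare's inequality. *)
Lemma positions_bound U : H U ->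
  [/\ rip (cpsi U) (cpsi U) <= la * rip (dx (cpsi U)) (dx (cpsi U)),
      rip (cz U) (cz U) <= la * rip (dx (cz U)) (dx (cz U)),
      rip (cphi U) (cphi U) <= la * rip (dx (cphi U)) (dx (cphi U)) &
      rip (cy U) (cy U) <= la * rip (dx (cy U)) (dx (cy U))] /\
  rip (dx (cphi U)) (dx (cphi U)) <=
    2 * rip (dx (cphi U) - cpsi U) (dx (cphi U) - cpsi U) + 2 * rip (cpsi U) (cpsi U) /\
  rip (dx (cy U)) (dx (cy U)) <=
    2 * rip (dx (cy U) - cz U) (dx (cy U) - cz U) + 2 * rip (cz U) (cz U).
Proof.
move=> /H2P[[Hphi Hpsi Hy Hz] _].
split; first by split; apply: poincare => //; exact: dxP.
by split; apply: rip_le_sub; (exact: L2_dx || exact: H10_L2).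
Qed.

Lemma crossform_bound : exists C, 0 <= C /\
  forall U, H U -> `|crossform p m U U| <= C * energy p U U.
Proof.
have m0 : 0 <= m by have [_ [[? ? ? ? ?] [_ [? ? ? ? ?]]]] := hp; rewrite /m divr_ge0// ?mulr_ge0// ltW.
have [C [C0 HC]] := cross_arith rpos la0 m0.
exists C; split => // U HU; have [[b1' b2' b3 b4] [b5 b6]] := positions_bound HU.
have [[? ? ? ?] [? ? ? ? ?]] := H2_L2 HU.
have Y f g : L2 f -> L2 g -> `|rip f g| <= 1 / 2 * rip f f + (2 * 1)^-1 * rip g g.
  by move=> Lf Lg; exact: rip_young.
have Y' : `|invrip l (ctheta U) (cv U)| <= la * (1 / 2 * rip (ctheta U) (ctheta U)
    + (2 * 1)^-1 * rip (cv U) (cv U)) by exact: invrip_young.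
have P f : 0 <= rip f f by exact: rip_ge0.
have c1 := ripC l (cphi U) (cu U); have c2 := ripC l (cpsi U) (cv U).
have c3 := ripC l (cy U) (cs U); have c4 := ripC l (cz U) (cw U).
have c5 := invripC l (cv U) (ctheta U).
rewrite /crossform /energy c1 c2 c3 c4 c5.
move: (real_inner l) (Defs.dx l) (invrip l) b1' b2' b3 b4 b5 b6 Y Y' P {c1 c2 c3 c4 c5}.
move=> r d iv b1' b2' b3 b4 b5 b6 Y Y' P.
by apply: (HC _ _ _ _ _ _ _ _ _ _ _ _ _ _ _ _ _ _ _ _ _ _ b1' b2' b5 b6 b3 b4
  (Y _ _ _ _) (Y _ _ _ _) (Y _ _ _ _) (Y _ _ _ _) Y'); rewrite //= !P.
Qed.

Lemma B2_lyapunov : exists C, 0 <= C /\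
  forall U G, B2 p beta1 beta2 beta3 U G -> exists D,
  [/\ 0 <= D, energy p G U = - D &
      crossform p m G U <= - (2^-1 * energy p U U) + C * D].
Proof.
have [_ [[? ? ? ? ?] [_ [g1 g2 g3 dl0 K0]]]] := hp.
have gpos : all (fun x => 0 < x) [:: gamma1 p; gamma2 p; gamma3 p; KK p].
  by apply/and5P; split.
(* [c] is the constant of the Young inequality for the damping of order [b], and [d] its coercivity
   constant. *)
pose c b := lam 0 `^ (b - 1); pose d b := lam 0 `^ b.
have lpos : all (fun x => 0 < x)
    [:: la; c beta1; c beta2; c beta3; d beta1; d beta2; d beta3].
  by rewrite /= la0 /c /d !powR_gt0 ?eigval_gt0.
have [C [C0 HC]] := lyapunov_arith rpos gpos dl0 lpos.
exists C; split => // U G BUG.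
have [Pu [Ps [Pw [fu fs fw [HU HG Ht] [EE JJ]]]]] := B2_identities hp m BUG.
have [[b1' b2' b3 b4] [b5 b6]] := positions_bound HU.
have [[Lphi Lpsi Ly Lz] [Lu Lv Ls Lw Lt]] := H2_L2 HU.
have /H2P[[Hphi Hpsi Hy Hz] _] := HU.
have /andP[p1 q1] := hbeta1; have /andP[p2 q2] := hbeta2; have /andP[p3 q3] := hbeta3.
have x1 := frac_power_ge l0 p1 fu; have x2 := frac_power_ge l0 p2 fs.
have x3 := frac_power_ge l0 p3 fw.
have P f : 0 <= rip f f by exact: rip_ge0.
have nn b f g : lam 0 `^ b * rip f f <= rip g f -> 0 <= rip g f.
  by apply: le_trans; rewrite mulr_ge0 ?powR_ge0.
have u0 := nn _ _ _ x1; have s0 := nn _ _ _ x2; have w0 := nn _ _ _ x3.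
have x4 := poincare l0 (dxP Ht).
have LP1 := L2B (L2_dx Hphi) Lpsi.
have Y1 t (t0 : 0 < t) := frac_power_young l0 t0 q1 fu (dxP Hphi).
have Y2 t (t0 : 0 < t) := frac_power_young l0 t0 q2 fs (dxP Hy).
have Y3 t (t0 : 0 < t) := frac_power_young l0 t0 q3 fw (dxP Hz).
have Y4 t (t0 : 0 < t) := rip_young t0 (L2_dx Ht) (L2_dx Hpsi).
have Y5 t (t0 : 0 < t) := rip_young t0 Lt Lv.
have Y6 t (t0 : 0 < t) := rip_young t0 Lt Lpsi.
have Y7 t (t0 : 0 < t) := invrip_young l0 t0 Lt LP1.
have c6 := ripC l (cpsi U) (ctheta U).
have c7 := invripC l (dx (cphi U) - cpsi U) (ctheta U).
exists (dissipation p Pu Ps Pw U); split; [|exact: EE|].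
  rewrite /dissipation; apply: addr_ge0; last by rewrite mulr_ge0 ?P// ltW.
  by do 2 (apply: addr_ge0; last by rewrite mulr_ge0// ltW); rewrite mulr_ge0// ltW.
rewrite JJ c6 c7 /energy /dissipation.
move: (real_inner l) (Defs.dx l) (invrip l) b1' b2' b3 b4 b5 b6 x1 x2 x3 x4
  Y1 Y2 Y3 Y4 Y5 Y6 Y7 P {c6 c7 JJ EE u0 s0 w0 nn LP1}.
move=> r dd iv b1' b2' b3 b4 b5 b6 x1 x2 x3 x4 Y1 Y2 Y3 Y4 Y5 Y6 Y7 P.
by apply: (HC _ _ _ _ _ _ _ _ _ _ _ _ _ _ _ _ _ _ _ _ _ _ _ _ _ _ _
  _ b1' b2' b5 b6 x1 x2 x3 x4 Y1 Y2 Y3 Y4 Y5 Y6 Y7); rewrite //= !P.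
Qed.

End Stability.

(** * Density of the domain *)

Section RegularElements.
Context {R : realType} (l : R).
Hypothesis l0 : 0 < l.
Local Notation cfun := (@cfun R).
Local Notation L2 := (@L2 R l).
Local Notation norm2 := (@norm2 R l).
Local Notation rip := (@real_inner R l).
Local Notation e_ := (@eigfun R l).
Local Notation lam := (@eigval R l).

#[local] Opaque real_inner Defs.dx invrip Defs.L2 Defs.H10.

Lemma coef_lin (c : R[i]) f g n : L2 f -> L2 g ->
  coef l (c *: f + g) n = c * coef l f n + coef l g n.
Proof.
move=> Lf Lg; have Le := L2_e l n; have Li := L2_imul Le; have Lcf := L2Z c Lf.
rewrite !coefE /re_coef /im_coef (ripDl Lcf Lg Le) (ripDl Lcf Lg Li) (rip_Zl _ Lf Le) (rip_Zl _ Lf Li).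
rewrite rip_imul_imul (rip_imull Lf Le).
case: c {Lcf} => a b; move: (rip f _) (rip f _) (rip g _) (rip g _) => x y x' y'.
by apply: complex_eqP; rewrite /= ?mulrN.
Qed.

Lemma laplacian_lin (c : R[i]) f g f' g' : laplacian l f g -> laplacian l f' g' ->
  laplacian l (c *: f + f') (c *: g + g').
Proof.
move=> lf lf'; have [Hf Lf Lg] := laplacian_H10 lf; have [Hf' Lf' Lg'] := laplacian_H10 lf'.
have Lcg := L2Z c Lg; have Lcd := L2Z c (L2_dx Hf).
apply: (laplacianP l0 (H10_derivative_lin c (dxP Hf) (dxP Hf'))) => [|eta te]; first exact: L2D.
have He := test_H10 te; have [Le Le'] := H10_derivative_L2 He.
have Hie := H10_imul l0 He.
rewrite (ripDl Lcd (L2_dx Hf') Le') (ripDl Lcg Lg' Le).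
rewrite (rip_Zl _ (L2_dx Hf) Le') (rip_Zl _ Lg Le) (rip_imull (L2_dx Hf) Le') (rip_imull Lg Le).
by rewrite (laplacian_rip lf He) (laplacian_rip lf Hie) (laplacian_rip lf' He).
Qed.

Lemma frac_power_lin s (c : R[i]) f g f' g' : frac_power l s f g -> frac_power l s f' g' ->
  frac_power l s (c *: f + f') (c *: g + g').
Proof.
move=> [Lf Lg fg] [Lf' Lg' fg'].
split=> [||n]; [by apply: L2D => //; exact: L2Z..|].
by rewrite !coef_lin// fg fg'; ring.
Qed.

Lemma frac_power_eigfun s n : frac_power l s (e_ n) ((lam n `^ s)%:C *: e_ n).
Proof.
have Le := L2_e l n.
split=> [//||m]; first exact: L2Z.
have E c : coef l (c *: e_ n) m = if n == m then c else 0.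
  rewrite coefE (re_coef_eigfun l0) (im_coef_eigfun l0).
  by case: eqVneq => _; apply: complex_eqP; rewrite /= ?mulr1 ?mulr0.
have -> : coef l (e_ n) m = if n == m then 1 else 0 by rewrite -E scale1r.
by rewrite E; case: eqVneq => [->|]; rewrite ?mulr1 ?mulr0.
Qed.

(** A finite sine sum lies in the domain of every power of [A], which acts on each eigenfunction by
    a scalar. *)
Lemma proj_regular s N f :
  exists g h, laplacian l (proj l N f) g /\ frac_power l s (proj l N f) h.
Proof.
have L0 : L2 0 by have := L2B (L2_e l 0) (L2_e l 0); rewrite subrr.
have l00 : laplacian l 0 0.
  by apply: (laplacianP l0 (H10_derivative0 l0)) => [//|eta te]; rewrite !rip0l.
have f00 : frac_power l s 0 0.
  split=> // n; rewrite coefE /re_coef /im_coef !rip0l.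
  by apply: complex_eqP; rewrite /= !mulr0 ?subr0 ?addr0.
rewrite /proj; elim/big_ind: _ => [|f1 f2 [g1 [h1 [A1 B1]]] [g2 [h2 [A2 B2]]]|i _].
- by exists 0, 0.
- exists (1 *: g1 + g2), (1 *: h1 + h2).
  have -> : f1 + f2 = 1 *: f1 + f2 by rewrite scale1r.
  by split; [exact: laplacian_lin|exact: frac_power_lin].
- exists (coef l f i *: ((lam i)%:C *: e_ i) + 0).
  exists (coef l f i *: ((lam i `^ s)%:C *: e_ i) + 0).
  rewrite -[coef l f i *: e_ i]addr0.
  split; first exact: (laplacian_lin _ (eigfun_laplacian l0 i)).
  exact: (frac_power_lin _ (frac_power_eigfun s i)).
Qed.

(** The series for [A^s f] is dominated by [lam 0 ^ (2 s - 2)] times the Parseval series of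
    [A f]. *)
Lemma laplacian_dom_frac s f g : s <= 1 -> laplacian l f g -> dom_frac l s f.
Proof.
move=> s1 fg; have [_ Lf Lg] := laplacian_H10 fg; split=> //.
have gg := cvg_seriesZ (c := lam 0 `^ (2 * s - 2)) (parseval l0 Lg Lg).
have /cvg_ex[a ha] : cvgn (series (fun n => lam n `^ (2 * s) * coef_dot l f f n)).
  apply: (series_dominated _ gg) => n.
  have -> : coef_dot l g g n = lam n `^ 2 * coef_dot l f f n.
    rewrite (laplacian_coef_dot l0 _ _ fg) coef_dotC (laplacian_coef_dot l0 _ _ fg).
    by rewrite (powR_mulrn 2) ?(ltW (eigval_gt0 l0 n))// expr2; exact: mulrA.
  rewrite ger0_norm ?mulr_ge0 ?powR_ge0 ?coef_dot_ge0//.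
  rewrite [leRHS]mulrA ler_wpM2r ?coef_dot_ge0//.
  by apply: (powR_eigval_le l0); lra.
by rewrite (sqnorm_frac_cvg ha) ltry.
Qed.

(** Sine projections are used here because the damped velocities need both [A] and [A^s] in L^2,
    with closeness only in L^2. *)
Lemma dense_L2 s f d : L2 f -> 0 < d -> exists f' g h,
  [/\ laplacian l f' g, frac_power l s f' h & rip (f' - f) (f' - f) < d].
Proof.
move=> Lf d0; have sd0 : 0 < Num.sqrt d by rewrite sqrtr_gt0.
have /cvgrPdist_lt/(_ _ sd0)[N _ /(_ N (leqnn N))] := proj_cvg l0 Lf.
rewrite sub0r normrN ger0_norm ?norm2_ge0// => fN.
have [g [h [lg fh]]] := proj_regular s N f.
exists (proj l N f), g, h; split => //.
have LB := L2B Lf (L2_proj l N f).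
rewrite -norm2_sqr -opprB (norm2N LB) -(sqr_sqrtr (ltW d0)).
by rewrite ltr_pXn2r ?nnegrE ?norm2_ge0// sqrtr_ge0.
Qed.

(** For positions the derivative must be close as well, which test functions provide by the
    definition of H^1_0. *)
Lemma dense_H10 f d : H10 l f -> 0 < d -> exists f' g,
  [/\ laplacian l f' g, rip (f' - f) (f' - f) < d &
      rip (dx l (f' - f)) (dx l (f' - f)) < d].
Proof.
move=> Hf d0; have sd0 : 0 < Num.sqrt d by rewrite sqrtr_gt0.
have [Lf Ldf Hd] := dxP Hf; have [eta [te fe fe']] := Hd _ sd0.
have le := test_laplacian l0 te; have He := test_H10 te.
have [Le Le'] := H10_derivative_L2 He.
have HB := H10_derivativeB He (dxP Hf).
have LB := L2B Lf Le; have LB' := L2B Ldf Le'; have LN := L2B Le' Ldf.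
have Ldx : L2 (dx l (eta - f)) by apply: L2_dx; exists (cderive eta - dx l f).
have sq g : norm2 g < Num.sqrt d -> rip g g < d.
  move=> gd; rewrite -norm2_sqr -(sqr_sqrtr (ltW d0)).
  by rewrite ltr_pXn2r ?nnegrE ?norm2_ge0// sqrtr_ge0.
exists eta, (- cderive (cderive eta)); split => //.
  by apply: sq; rewrite -opprB (norm2N LB).
rewrite (dx_unique l0 HB Ldx) ripC (dx_unique l0 HB LN).
by apply: sq; rewrite -opprB (norm2N LB').
Qed.

End RegularElements.

(** * The domain of [B2] is dense in the phase space *)

Section CoreDensity.
Context {R : realType} (p : constants R).
Hypothesis hp : positive_constants p.
Local Notation l := (len p).
Local Notation cfun := (@cfun R).
Local Notation L2 := (@L2 R l).
Local Notation rip := (@real_inner R l).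
Local Notation H := (H2 p).
Local Notation dx := (@dx R l).
Let l0 : 0 < l. Proof. by case: hp. Qed.
#[local] Opaque real_inner Defs.dx invrip Defs.L2 Defs.H10.

Lemma energy_le W d : H W ->
  [/\ rip (cphi W) (cphi W) <= d, rip (cpsi W) (cpsi W) <= d,
      rip (cy W) (cy W) <= d & rip (cz W) (cz W) <= d] ->
  [/\ rip (dx (cphi W)) (dx (cphi W)) <= d, rip (dx (cpsi W)) (dx (cpsi W)) <= d,
      rip (dx (cy W)) (dx (cy W)) <= d & rip (dx (cz W)) (dx (cz W)) <= d] ->
  [/\ rip (cu W) (cu W) <= d, rip (cv W) (cv W) <= d, rip (cs W) (cs W) <= d,
      rip (cw W) (cw W) <= d & rip (ctheta W) (ctheta W) <= d] ->
  energy p W W <= (rho1 p + rho2 p + rho3 p + rho4 p + b1 p + b2 p + 4 * kappa1 p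
    + 4 * kappa2 p + 4 * jj p + rho5 p) * d.
Proof.
move=> HW; have [[Lphi Lpsi Ly Lz] _] := H2_L2 HW.
have [_ [[r1 r2 r3 r4 r5] [[k1 k2 B1 B2 j] _]]] := hp.
have /H2P[[Hphi Hpsi Hy Hz] _] := HW.
have h1 := ripB_le (L2_dx Hphi) Lpsi; have h2 := ripB_le (L2_dx Hy) Lz.
have h3 := ripB_le Ly Lphi.
rewrite /energy; move: (real_inner l) (Defs.dx l) h1 h2 h3 => r dd h1 h2 h3.
move=> [a1 a2 a3 a4] [a5 a6 a7 a8] [a9 a10 a11 a12 a13].
have M k x : 0 < k -> x <= d -> k * x <= k * d by move=> k0 xd; rewrite ler_wpM2l// ltW.
have M4 k x y z : 0 < k -> x <= 2 * y + 2 * z -> y <= d -> z <= d -> k * x <= 4 * k * d.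
  by move=> k0 xyz yd zd; rewrite [4 * k]mulrC -mulrA ler_wpM2l ?(ltW k0)//; lra.
rewrite !(mulrDl _ _ d).
do 9 (apply: lerD; last by [exact: M|exact: M4 h1 _ _|exact: M4 h2 _ _|exact: M4 h3 _ _]).
exact: M.
Qed.

Lemma phaseB (U W : (phase R : lmodType R[i])) :
  [/\ cphi (U - W) = cphi U - cphi W, cpsi (U - W) = cpsi U - cpsi W,
      cy (U - W) = cy U - cy W & cz (U - W) = cz U - cz W] /\
  [/\ cu (U - W) = cu U - cu W, cv (U - W) = cv U - cv W, cs (U - W) = cs U - cs W,
      cw (U - W) = cw U - cw W & ctheta (U - W) = ctheta U - ctheta W].
Proof.
by case: U W => [[[[[[[[? ?] ?] ?] ?] ?] ?] ?] ?] [[[[[[[[? ?] ?] ?] ?] ?] ?] ?] ?].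
Qed.

Variables beta1 beta2 beta3 : R.
Hypothesis hbeta1 : 0 <= beta1 <= 1.
Hypothesis hbeta2 : 0 <= beta2 <= 1.
Hypothesis hbeta3 : 0 <= beta3 <= 1.

Lemma B2_approx U d : H U -> 0 < d -> exists U' G, B2 p beta1 beta2 beta3 U' G /\
  let close f g := rip (f - g) (f - g) < d in
  let close_dx f g := rip (dx (f - g)) (dx (f - g)) < d in
  [/\ close (cphi U') (cphi U), close (cpsi U') (cpsi U),
      close (cy U') (cy U) & close (cz U') (cz U)] /\
  [/\ close_dx (cphi U') (cphi U), close_dx (cpsi U') (cpsi U),
      close_dx (cy U') (cy U) & close_dx (cz U') (cz U)] /\
  [/\ close (cu U') (cu U), close (cv U') (cv U), close (cs U') (cs U),
      close (cw U') (cw U) & close (ctheta U') (ctheta U)].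
Proof.
move: U => [[[[[[[[phi u] psi] v] y] s] z] w] theta] HU d0.
have [[Hphi Hpsi Hy Hz] [Lu Lv Ls Lw Lt]] := HU.
have [phi' [Aphi [lphi dphi dphix]]] := dense_H10 l0 Hphi d0.
have [psi' [Apsi [lpsi dpsi dpsix]]] := dense_H10 l0 Hpsi d0.
have [y' [Ay [ly dy dyx]]] := dense_H10 l0 Hy d0.
have [z' [Az [lz dz dzx]]] := dense_H10 l0 Hz d0.
have [u' [Au [Pu [lu fu du]]]] := dense_L2 l0 beta1 Lu d0.
(* The exponent 0 is an arbitrary choice: for [v], and for [theta] below, only the Laplacian enters
   [B2]. *)
have [v' [Av [_ [lv _ dv]]]] := dense_L2 l0 0 Lv d0.
have [s' [As [Ps [ls fs ds]]]] := dense_L2 l0 beta2 Ls d0.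
have [w' [Aw [Pw [lw fw dw]]]] := dense_L2 l0 beta3 Lw d0.
have [theta' [Atheta [_ [lt _ dt]]]] := dense_L2 l0 0 Lt d0.
have [Hphi' Lphi' LAphi] := laplacian_H10 lphi; have [Hpsi' Lpsi' LApsi] := laplacian_H10 lpsi.
have [Hy' Ly' LAy] := laplacian_H10 ly; have [Hz' Lz' LAz] := laplacian_H10 lz.
have [Hu' Lu' _] := laplacian_H10 lu; have [Hv' Lv' LAv] := laplacian_H10 lv.
have [Hs' Ls' _] := laplacian_H10 ls; have [Hw' Lw' _] := laplacian_H10 lw.
have [Ht' Lt' LAt] := laplacian_H10 lt.
have [_ LPu _] := fu; have [_ LPs _] := fs; have [_ LPw _] := fw.
have LD := L2B Ly' Lphi'; have LP1 := L2B (L2_dx Hphi') Lpsi'; have LP2 := L2B (L2_dx Hy') Lz'.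
have Ldpsi := L2_dx Hpsi'; have Ldz := L2_dx Hz'.
have ae f : aeeq l f f by apply: aeW.
pose U' : phase R := (phi', u', psi', v', y', s', z', w', theta').
pose g2 : cfun := - (kappa1 p / rho1 p)%:C *: Aphi - (kappa1 p / rho1 p)%:C *: dx psi'
  + (jj p / rho1 p)%:C *: (y' - phi') - (gamma1 p / rho1 p)%:C *: Pu.
pose g4 : cfun := - (b1 p / rho2 p)%:C *: Apsi
  + (kappa1 p / rho2 p)%:C *: (dx phi' - psi') + (delta p / rho2 p)%:C *: Atheta.
pose g6 : cfun := - (kappa2 p / rho3 p)%:C *: Ay - (kappa2 p / rho3 p)%:C *: dx z'
  - (jj p / rho3 p)%:C *: (y' - phi') - (gamma2 p / rho3 p)%:C *: Ps.
pose g8 : cfun := - (b2 p / rho4 p)%:C *: Az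
  + (kappa2 p / rho4 p)%:C *: (dx y' - z') - (gamma3 p / rho4 p)%:C *: Pw.
pose g9 : cfun := - (KK p / rho5 p)%:C *: Atheta - (delta p / rho5 p)%:C *: Av.
have HU' : H U' by [].
exists U', (u', g2, v', g4, s', g6, w', g8, g9); split; last exact: (conj (And4 dphi dpsi dy dz)
  (conj (And4 dphix dpsix dyx dzx) (And5 du dv ds dw dt))).
  split.
  - split => //; split => //; have df := laplacian_dom_frac l0.
    have /andP[_ c1] := hbeta1; have /andP[_ c2] := hbeta2; have /andP[_ c3] := hbeta3.
    split; [by exists Atheta| | by exists Apsi | | ].
    + by split; [exists Aphi|exact: df lphi].
    + by split; [exists Ay|exact: df ly].
    + by split; [exists Az|exact: df lz].
  - split => //; split => //.
    + by apply: L2B; [apply: L2D; [apply: L2B|]|]; exact: L2Z.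
    + by apply: L2D; [apply: L2D|]; exact: L2Z.
    + by apply: L2B; [apply: L2B; [apply: L2B|]|]; exact: L2Z.
    + by apply: L2B; [apply: L2D|]; exact: L2Z.
    + by apply: L2B; exact: L2Z.
  - by exists Aphi, Apsi, Ay, Az, Atheta, Av, Pu, Ps, Pw; split; split.
Qed.

Lemma B2_dense (U : (phase R : lmodType R[i])) e : H U -> 0 < e ->
  exists (U' : (phase R : lmodType R[i])) G,
  B2 p beta1 beta2 beta3 U' G /\ normH2 p (U' - U) < e.
Proof.
move=> HU e0; have [_ [[r1 r2 r3 r4 r5] [[k1 k2 B1 B2 j] _]]] := hp.
set K := rho1 p + rho2 p + rho3 p + rho4 p + b1 p + b2 p + 4 * kappa1 p
    + 4 * kappa2 p + 4 * jj p + rho5 p.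
have K0 : 0 < K by rewrite /K !addr_gt0 ?mulr_gt0.
(* All squared distances below [d] give an energy of at most [K d = e^2 / 2], hence a norm strictly
   below [e]. *)
pose d := e ^+ 2 / (2 * K).
have d0 : 0 < d by rewrite divr_gt0 ?exprn_gt0 ?mulr_gt0.
have [U' [G [BUG [[a1 a2 a3 a4] [[a5 a6 a7 a8] [a9 a10 a11 a12 a13]]]]]] := B2_approx HU d0.
exists U', G; split => //; have [[HU' _] _ _] := BUG.
have HW := stableB (H2_lin (p := p)) HU' HU.
have [[e1 e2 e3 e4] [e5 e6 e7 e8 e9]] := phaseB U' U.
rewrite -e1 in a1 a5; rewrite -e2 in a2 a6; rewrite -e3 in a3 a7; rewrite -e4 in a4 a8.
rewrite -e5 in a9; rewrite -e6 in a10; rewrite -e7 in a11; rewrite -e8 in a12.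
rewrite -e9 in a13.
have EW := energy_le HW (And4 (ltW a1) (ltW a2) (ltW a3) (ltW a4))
  (And4 (ltW a5) (ltW a6) (ltW a7) (ltW a8))
  (And5 (ltW a9) (ltW a10) (ltW a11) (ltW a12) (ltW a13)).
rewrite (normH2E hp HW) /formnorm.
have -> : e = Num.sqrt (e ^+ 2) by rewrite sqrtr_sqr ger0_norm// ltW.
rewrite ltr_sqrt ?exprn_gt0//; apply: le_lt_trans EW _.
rewrite -/K /d; have -> : K * (e ^+ 2 / (2 * K)) = e ^+ 2 / 2 by field; rewrite gt_eqF.
by rewrite ltr_pdivrMr// ltr_pMr ?exprn_gt0// ltr1n.
Qed.

End CoreDensity.

Theorem theorem14 (R : realType) (p : constants R) (hp : positive_constants p)
    (beta1 beta2 beta3 : R)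
    (hbeta1 : 0 <= beta1 <= 1) (hbeta2 : 0 <= beta2 <= 1)
    (hbeta3 : 0 <= beta3 <= 1)
    (S2 : R -> phase R -> phase R)
    (hS2 : C0_contraction_semigroup (H2 p) (normH2 p) S2)
    (hgen : generates (H2 p) (normH2 p) (B2 p beta1 beta2 beta3) S2) :
  exponentially_stable (H2 p) (normH2 p) S2.
Proof.
pose m := 2 * rho2 p / delta p.
have [C1 [C10 crossP]] := crossform_bound hp.
have [C2 [C20 decayP]] := B2_lyapunov hp hbeta1 hbeta2 hbeta3.
(* Small enough for two purposes: [eps C1 <= 1/2] keeps the perturbed form equivalent to the energy,
   and [eps C2 <= 1] lets the dissipation absorb the error of the cross form. *)
pose eps := (2 * (C1 + C2 + 1))^-1.
have eps0 : 0 < eps by rewrite invr_gt0 mulr_gt0// ltr_wpDl// addr_ge0.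
have [epsC1 epsC2] : eps * C1 <= 2^-1 /\ eps * C2 <= 1.
  have : eps * (2 * (C1 + C2 + 1)) = 1 by rewrite mulVf// gt_eqF// -invr_gt0.
  have := mulr_ge0 (ltW eps0) C10; have := mulr_ge0 (ltW eps0) C20.
  by split; nra.
have energy0 := energy_ge0 hp.
have bounds U : H2 p U -> `|eps * crossform p m U U| <= 2^-1 * energy p U U.
  move=> HU; rewrite normrM (gtr0_norm eps0) (le_trans (ler_wpM2l (ltW eps0) (crossP U HU)))//.
  by rewrite mulrA ler_wpM2r.
apply: (@lyapunov_exponentially_stable R (phase R) (H2 p) (normH2 p) (H2_lin (p := p))
  (energy p) (fun U W => energy p U W + eps * crossform p m U W)
  (symform_energy hp) (fun U _ => energy0 U) (normH2E hp)
  (symform_add eps (symform_energy hp) (symform_crossform hp m))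
  (* The perturbed form lies between half and 3/2 of the energy. Its dissipation is at least
     [eps / 2] times the energy, which exceeds [eps / 4] times the form. *)
  2^-1 2 (eps / 4) _ _ _ _ (B2 p beta1 beta2 beta3) _ _ _ S2 hS2 hgen).
- by [].
- by move=> U /bounds; rewrite ler_norml => /andP[+ _]; lra.
- move=> U /bounds; rewrite ler_norml => /andP[_ +]; have := energy0 U; lra.
- by rewrite divr_gt0.
- by move=> U G [[]].
- move=> U G BUG; have [D [D0 -> JD]] := decayP U G BUG; have [[HU _] _ _] := BUG.
  have := bounds U HU; rewrite ler_norml => /andP[_].
  have h1 := ler_wpM2l (ltW eps0) JD; have h2 := ler_wpM2r D0 epsC2.
  have := mulr_ge0 (ltW eps0) (energy0 U).
  move: h1 h2; rewrite -/m.
  move: (crossform p m G U) (crossform p m U U) (energy p U U) => J X E h1 h2 h3 h4.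
  have : eps / 4 * (eps * X) <= eps / 4 * (2^-1 * E) by rewrite ler_wpM2l// divr_ge0// ltW.
  move: h1 h2 h3; clear; lra.
- by move=> U HU e e0; apply: B2_dense.
Qed.
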